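(* Let $(A_0,A_1)$ be a regular Banach couple, $0<q\le1$, and let $b\in SV(0,\infty)$ satisfy $\int_0^t b^q(s)\,\frac{ds}{s}<\infty$ for $t>0$. Put $$B(t)=\Big(\int_0^t b^q(s)\,\frac{ds}{s}\Big)^{1/q},\qquad t>0,$$ and define, in the a.e. sense, $$a(t)=tB'(t)=\tfrac1q B(t)^{1-q}b(t)^q .$$ Let $\widetilde b(t)=\big\|s^{-1/q}b(s)\big\|^{-1}_{q,(0,\frac1t)}$ and $\overline a(t)=a(\tfrac1t)$ for $t>0$. If $\int_0^\infty b^q(s)\,\frac{ds}{s}=\infty$, then $$\big((A_0,A_1)^K_{1,q,b}\big)'=(A_0',A_1')^J_{1,\infty,1/\overline a}=(A_0',A_1')^K_{1,\infty,\widetilde b}.$$ If $\int_0^\infty b^q(s)\,\frac{ds}{s}<\infty$, then $$\big((A_0,A_1)^K_{1,q,b}\big)'=(A_0',A_1')^J_{1,\infty,1/\overline a}=A_1'\cap(A_0',A_1')^K_{1,\infty,\widetilde b}.$$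
   Context: A Banach couple $(A_0,A_1)$ is a compatible couple of Banach spaces (both continuously embedded in a common Hausdorff topological vector space) with $A_0\cap A_1\neq\{0\}$. It is regular if $A_0\cap A_1$ is dense in $A_0$ and in $A_1$. $SV(0,\infty)$: a positive Lebesgue measurable function $b$ on $(0,\infty)$ ($0\not\equiv b\not\equiv\infty$) is slowly varying if for each $\varepsilon>0$ the function $t\mapsto t^{\varepsilon}b(t)$ is equivalent to an increasing function and $t\mapsto t^{-\varepsilon}b(t)$ is equivalent to a decreasing function (equivalent: each is bounded by a positive constant times the other). Slowly varying parameters are considered up to equivalence. $\|\cdot\|_{r,(c,d)}$ is the $L_r$ (quasi-)norm on $(c,d)$ with respect to Lebesgue measure ($0<r\le\infty$, $1/\infty=0$), so $\|s^{-1/q}b(s)\|_{q,(c,d)}=\big(\int_c^d b(s)^q\,\frac{ds}{s}\big)^{1/q}$ for $q<\infty$. $K$-space: for a Banach couple $(X_0,X_1)$, $K(t,f)=\inf\{\|f_0\|_{X_0}+t\|f_1\|_{X_1}: f=f_0+f_1,\ f_i\in X_i\}$, and for $0<r\le\infty$, $w\in SV(0,\infty)$, $(X_0,X_1)^K_{1,r,w}$ consists of all $f\in X_0+X_1$ with $\|t^{-1-\frac1r}w(t)K(t,f)\|_{r,(0,\infty)}<\infty$, this quantity being its quasi-norm. $J$-space: $J(t,f)=\max\{\|f\|_{X_0},t\|f\|_{X_1}\}$ for $f\in X_0\cap X_1$; $(X_0,X_1)^J_{1,r,w}$ consists of all $f\in X_0+X_1$ having a representation $f=\sum_{k\in\mathbb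 Z}u_k$ (convergence in $X_0+X_1$), $u_k\in X_0\cap X_1$, with $\|(2^{-k}w(2^k)J(2^k,u_k))_k\|_{\ell_r(\mathbb Z)}<\infty$; its quasi-norm is the infimum of these quantities over all such representations. Duals: for a regular couple, each element of $A_i^*$ is identified with its restriction to $A_0\cap A_1$; $A_i'$ ($i=0,1$) is the Banach space of functionals on $A_0\cap A_1$ that extend continuously to $A_i$ (with the norm of $A_i^*$). Thus $(A_0',A_1')$ is a Banach couple inside $(A_0\cap A_1)^*$. Likewise, $E'$ denotes the dual (space of continuous linear functionals) of an intermediate quasi-Banach space $E$, its elements being identified with their restrictions to $A_0\cap A_1$. Equalities of spaces are with equivalence of norms. *)

(* Defs.v *)
From HB Require Import structures.
From mathcomp Require Import all_boot all_order all_algebra.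
From mathcomp Require Import complex.
From mathcomp Require Import all_classical all_reals all_analysis.

Set Implicit Arguments.
Unset Strict Implicit.
Unset Printing Implicit Defensive.

Import Order.TTheory GRing.Theory Num.Theory.
Import numFieldNormedType.Exports.

Local Open Scope classical_set_scope.
Local Open Scope ring_scope.

(** Banach spaces are over the reals or over the complex numbers; a norm of
    MathComp-Analysis takes its values in the scalar field, and [rabs] is the
    same norm read as an element of [R]. *)

Inductive scalars := RealScalars | ComplexScalars.

Definition scalar_field (R : realType) (s : scalars) : numFieldType :=
  match s with
  | RealScalars => R
  | ComplexScalars => R[i]
  end.

Definition real_part (R : realType) (s : scalars) : scalar_field R s -> R :=
  match s return scalar_field R s -> R with
  | RealScalars => fun x => x
  | ComplexScalars => fun z => complex.Re z
  end.

Definition rabs (R : realType) (s : scalars)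
    (A : normedModType (scalar_field R s)) (x : A) : R :=
  real_part `|x|.

(** [completed_lebesgue_measure] lives on the sigma-algebra of all
    Lebesgue measurable sets, not only on the Borel sets. *)

Definition lebesgueType (R : realType) : measurableType _ :=
  caratheodory_type ((wlength (@idfun R))^*)%mu.

Definition leb (R : realType) : {measure set (lebesgueType R) -> \bar R} :=
  @completed_lebesgue_measure R.

(** [|| f ||_{r,D}], for [0 < r <= +oo]. *)
Definition Lr_norm (R : realType) (r : \bar R) (D : set R) (f : R -> R) :
    \bar R :=
  Lnorm (leb R) r (patch (fun=> 0%E) D (EFin \o f)).

(** [(\sum_(k in Z) |x k| ^ r) ^ (1 / r)], for [0 < r <= +oo]; the value at
    [r = -oo] is irrelevant. *)
Definition lr_norm (R : realType) (r : \bar R) (x : int -> R) : \bar R :=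
  match r with
  | p%:E => ((\esum_(k in [set: int]) (`|x k| `^ p)%:E) `^ p^-1)%E
  | +oo%E => ereal_sup (range (fun k => `|x k|%:E))
  | -oo%E => 0%E
  end.

(** A positive [b] is taken real valued: equivalence of [t^e * b] to an
    increasing function and of [t^-e * b] to a decreasing one forces a
    [\bar R]-valued [b >= 0] other than 0 and [+oo] into ]0, +oo[ everywhere. *)

Definition equiv_pos (R : realType) (f g : R -> R) : Prop :=
  exists c C : R, [/\ 0 < c, 0 < C &
    forall t, 0 < t -> c * g t <= f t <= C * g t].

Definition slowly_varying (R : realType) (b : R -> R) : Prop :=
  [/\ forall t, 0 < t -> 0 < b t,
      @measurable_fun _ _ (lebesgueType R) (measurableTypeR R) `]0, +oo[ b,
      forall e, 0 < e -> exists g : R -> R,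
        (forall x y, 0 < x -> x <= y -> g x <= g y) /\
        equiv_pos (fun t => t `^ e * b t) g &
      forall e, 0 < e -> exists g : R -> R,
        (forall x y, 0 < x -> x <= y -> g y <= g x) /\
        equiv_pos (fun t => t `^ (- e) * b t) g].

(** All the spaces attached to a couple are subspaces, with a quasi-norm of
    their own, of one ambient space; the values of [qnorm] off the carrier are
    irrelevant. *)

Record qspace (R : realType) (V : Type) := QSpace {
  carrier :> V -> Prop ;
  qnorm : V -> R
}.

Definition qspace_eq (R : realType) (V : Type) (X Y : qspace R V) : Prop :=
  carrier X = carrier Y /\
  exists c C : R, [/\ 0 < c, 0 < C &
    forall f, X f -> c * qnorm Y f <= qnorm X f <= C * qnorm Y f].

Definition qspaceI (R : realType) (V : Type) (X Y : qspace R V) : qspace R V :=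
  QSpace (carrier X `&` carrier Y) (fun f => Num.max (qnorm X f) (qnorm Y f)).

Section Interpolation.
Context (R : realType) (V : zmodType) (X0 X1 : qspace R V).

Definition sum_set : set V :=
  [set f | exists f0 f1, [/\ X0 f0, X1 f1 & f = f0 + f1]].

Definition Kfun (t : R) (f : V) : R :=
  inf [set x | exists f0 f1, [/\ X0 f0, X1 f1, f = f0 + f1 &
                              x = qnorm X0 f0 + t * qnorm X1 f1]].

Definition Jfun (t : R) (f : V) : R :=
  Num.max (qnorm X0 f) (t * qnorm X1 f).

(** [|| t^(-1-1/r) w(t) K(t,f) ||_{r,(0,+oo)}]; here [fine r^-1%E] is [1 / r],
    and 0 for [r = +oo]. *)
Definition K1_norm (r : \bar R) (w : R -> R) (f : V) : \bar R :=
  Lr_norm r `]0, +oo[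
    (fun t => t `^ (- 1 - fine (r^-1)%E) * w t * Kfun t f).

Definition K1_space (r : \bar R) (w : R -> R) : qspace R V :=
  QSpace [set f | sum_set f /\ (K1_norm r w f < +oo)%E]
         (fun f => fine (K1_norm r w f)).

(** [\sum_(- m <= k < n) u k]; recall that [Negz k] is [- (k + 1)]. *)
Definition Zpartial_sum (u : int -> V) (m n : nat) : V :=
  \sum_(k < n) u (Posz k) + \sum_(k < m) u (Negz k).

(** [f = \sum_(k in Z) u k], with [u k] in the intersection of the couple and
    convergence in its sum, whose norm is [Kfun 1]. *)
Definition J_representation (u : int -> V) (f : V) : Prop :=
  (forall k, (carrier X0 `&` carrier X1) (u k)) /\
  Kfun 1 (f - Zpartial_sum u mn.1 mn.2) @[mn --> filter_prod \oo \oo] --> 0.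

Definition J1_seq_norm (r : \bar R) (w : R -> R) (u : int -> V) : \bar R :=
  lr_norm r (fun k => 2 ^ (- k) * w (2 ^ k) * Jfun (2 ^ k) (u k)).

Definition J1_space (r : \bar R) (w : R -> R) : qspace R V :=
  QSpace [set f | sum_set f /\ exists u, J_representation u f /\
                                (J1_seq_norm r w u < +oo)%E]
         (fun f => inf [set fine (J1_seq_norm r w u) | u in
            [set u | J_representation u f /\ (J1_seq_norm r w u < +oo)%E]]).

End Interpolation.

Section Couple.
Context (R : realType) (s : scalars).
Local Notation K := (scalar_field R s).

(** [j] is meant to be injective, so that the infimum is over one value. *)
Definition embedded (V : lmodType K) (A : normedModType K) (j : A -> V) :
    qspace R V :=
  QSpace (range j) (fun v => inf [set rabs x | x in [set x | j x = v]]).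

Definition banach_couple (V : topologicalLmodType K)
    (A0 A1 : completeNormedModType K)
    (j0 : {linear A0 -> V}) (j1 : {linear A1 -> V}) : Prop :=
  [/\ hausdorff_space V,
      injective j0 /\ continuous j0,
      injective j1 /\ continuous j1 &
      exists2 v, (range j0 `&` range j1) v & v != 0].

Definition regular_couple (V : topologicalLmodType K)
    (A0 A1 : completeNormedModType K)
    (j0 : {linear A0 -> V}) (j1 : {linear A1 -> V}) : Prop :=
  dense (j0 @^-1` range j1) /\ dense (j1 @^-1` range j0).

(** A linear functional on a subspace [E] of [V] is given by a map [g : V -> K]
    of which only the restriction to [E] matters. *)

Section Dual.
Context (V : lmodType K).

Definition continuous_functional (E : qspace R V) (g : V -> K) : Prop :=
  (forall (a : K) x y, E x -> E y -> g (a *: x + y) = a * g x + g y) /\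
  (forall x, E x -> forall e : R, 0 < e -> exists2 d : R, 0 < d &
     forall y, E y -> qnorm E (y - x) < d -> real_part `|g y - g x| < e).

Definition functional_norm (E : qspace R V) (g : V -> K) : R :=
  sup [set real_part `|g x| | x in [set x | E x /\ qnorm E x <= 1]].

Definition restricts_to (D : set V) (g : V -> K) (phi : D -> K) : Prop :=
  forall x : D, phi x = g (val x).

(** [E'] as a space of functions on [D] (the intersection of the couple): the
    restrictions to [D] of the continuous linear functionals on [E], with the
    norm of [E^*]. When [D] is dense in [E] the infimum is over one value. *)
Definition dual (D : set V) (E : qspace R V) : qspace R (D -> K) :=
  QSpace [set phi | exists2 g, continuous_functional E g & restricts_to g phi]
         (fun phi => inf [set functional_norm E g | g in
            [set g | continuous_functional E g /\ restricts_to g phi]]).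

(** The continuous linear functionals on [E] can be identified with their
    restrictions to [D]. *)
Definition dual_identified (D : set V) (E : qspace R V) : Prop :=
  D `<=` carrier E /\
  forall g h, continuous_functional E g -> continuous_functional E h ->
    (forall x, D x -> g x = h x) -> forall x, E x -> g x = h x.

End Dual.
End Couple.

Section Weights.
Context (R : realType) (q : R) (b : R -> R).

Definition int_bq (D : set R) : \bar R :=
  \int[leb R]_(x in D) ((b x `^ q / x)%:E).

Definition Bfun (t : R) : R := fine (int_bq `]0, t[) `^ q^-1.

(** The derivative [t * B'(t)] only determines [a] almost everywhere; this
    formula is its everywhere defined representative, which is needed because
    the [J]-space samples the weight at the points [2 ^ k]. *)
Definition afun (t : R) : R := q^-1 * Bfun t `^ (1 - q) * b t `^ q.

Definition abar (t : R) : R := afun t^-1.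

Definition btilde (t : R) : R :=
  (fine (Lr_norm q%:E `]0, t^-1[ (fun x => x `^ (- q^-1) * b x)))^-1.

End Weights.

(* Main.v *)
(** Write [D] for the intersection of the couple and [E] for the [K]-space. On
    [D] one has [|f|_E <= C (B(t) / t) J(t, f)], and by Hahn-Banach [K(t, .)] on
    the dual couple is dual to [J(1 / t, .)]; hence a functional [phi] on [E]
    satisfies [K(t, phi) <= C t B(1 / t)]. If [B] is bounded, then moreover
    [|f|_E <= C |f|_1], so that [phi] lies in [A1'].

    Conversely let [K(2^j, phi) <= C 2^j beta_j] with [beta_j = B(2^-j)], and let
    [chi_j] be the [A0']-parts of near-optimal decompositions. The differences
    [chi_(j+1) - chi_j] are only of size [beta_j], whereas the [J]-space asks for
    [a(2^-j)], which may be much smaller and only dominates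
    [beta_j - beta_(j+1)]. Therefore [chi] is kept only at the indices where [beta] has dropped
    by a fixed factor, and interpolated in between linearly in [beta].

    Finally, if [phi = \sum_k phi_k], then
    [|phi_k(f)| <= J(2^k, phi_k) K(2^-k, f)]. With [h = K(t, f) / t] one has
    [h a = (1 / q) (h B)^(1-q) (h b)^q] and [h B <= |f|_E], so, as [q <= 1],
    [\sum_k 2^k a(2^-k) K(2^-k, f) <= C |f|_E] and [phi] is bounded on [E]. *)

Require Import Defs.
From HB Require Import structures.
From mathcomp Require Import all_boot all_order all_algebra.
From mathcomp Require Import complex.
From mathcomp Require Import all_classical all_reals all_analysis.
From mathcomp Require Import measurable_realfun ess_sup_inf.
From mathcomp Require Import lra ring.

Set Implicit Arguments.
Unset Strict Implicit.
Unset Printing Implicit Defensive.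

Import Order.TTheory GRing.Theory Num.Theory.
Import numFieldNormedType.Exports.

Local Open Scope classical_set_scope.
Local Open Scope ring_scope.

(** * Hahn-Banach over the reals and the complex numbers *)

(** For [q < 1] the quasi-norm of [E] need not be a seminorm, so Hahn-Banach is not applied to it
    directly. It is applied with the dominating functional [f -> \sum_k 2^k a(2^-k) K(2^-k, f)], a
    genuine seminorm that is at most a multiple of the quasi-norm. A second use of [q <= 1] is the
    concavity of [z^q], which gives [B(t) - B(t/2) <= c a(t)] and hence the control of
    [beta_j - beta_(j+1)].

    The levels of [beta] require it to run from [+oo] down to 0. If [B] is bounded, [beta] stays
    bounded at [-oo]; then [-k] is added to [beta_k] for [k < 0], and [chi_j = 0] for [j <= 0],
    which is possible because [phi] lies in [A1']. All terms of negative index then vanish, so the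
    modified sequence is compared with [a] only where it was not modified.

    Convergence of the resulting series rests on [beta_j -> 0] at [+oo] and on [2^j beta_j -> 0] at
    [-oo]; the latter follows from slow variation, through [B(2^n) = O(2^(n/2))]. *)

Section Scalars.
Context (R : realType) (s : scalars).
Local Notation K := (scalar_field R s).

Definition kabs (z : K) : R := real_part `|z|.

Definition of_real : R -> K :=
  match s return R -> scalar_field R s with
  | RealScalars => fun x => x
  | ComplexScalars => fun x => x%:C%C
  end.

Lemma of_realD x y : of_real (x + y) = of_real x + of_real y.
Proof. by rewrite /of_real; case: s => //=; rewrite rmorphD. Qed.

Lemma of_realN x : of_real (- x) = - of_real x.
Proof. by rewrite /of_real; case: s => //=; rewrite rmorphN. Qed.

Lemma of_realM x y : of_real (x * y) = of_real x * of_real y.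
Proof. by rewrite /of_real; case: s => //=; rewrite rmorphM. Qed.

Lemma of_real0 : of_real 0 = 0.
Proof. by rewrite /of_real; case: s. Qed.

Lemma of_real1 : of_real 1 = 1.
Proof. by rewrite /of_real; case: s. Qed.

Lemma of_real_eq0 x : (of_real x == 0) = (x == 0).
Proof. by rewrite /of_real; case: s => //=; rewrite eq_complex/= eqxx andbT. Qed.

Lemma real_partD (x y : K) : real_part (x + y) = real_part x + real_part y.
Proof. by move: x y; case: s => //= -[a b] [c d]. Qed.

Lemma real_part0 : real_part (0 : K) = 0.
Proof. by case: s. Qed.

Lemma real_part_of_realM x (y : K) : real_part (of_real x * y) = x * real_part y.
Proof.
by move: y; rewrite /of_real; case: s => //= -[a b] /=; rewrite mul0r subr0.
Qed.

Lemma real_part_of_real x : real_part (of_real x) = x.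
Proof. by rewrite /of_real; case: s. Qed.

Lemma norm_kabs (z : K) : `|z| = of_real (kabs z).
Proof.
rewrite /kabs /of_real; move: z; case: s => //= z.
Qed.

Lemma real_part_le_kabs (z : K) : real_part z <= kabs z.
Proof.
rewrite /kabs; move: z; case: s => /= [z|[a b] /=]; first exact: ler_norm.
apply: le_trans (ler_norm a) _; rewrite -sqrtr_sqr ler_wsqrtr// lerDl.
exact: sqr_ge0.
Qed.

Lemma kabs_ge0 (z : K) : 0 <= kabs z.
Proof.
by rewrite /kabs; move: z; case: s => /= [z|[a b]]; rewrite ?normr_ge0 ?sqrtr_ge0.
Qed.

Lemma of_real_inj : injective of_real.
Proof.
move=> x y /eqP; rewrite -subr_eq0 -of_realN -of_realD of_real_eq0 subr_eq0.
by move/eqP.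
Qed.

Lemma kabsM (x y : K) : kabs (x * y) = kabs x * kabs y.
Proof. by apply: of_real_inj; rewrite of_realM -!norm_kabs normrM. Qed.

Lemma ler_of_real x y : (of_real x <= of_real y) = (x <= y).
Proof. by rewrite /of_real; case: s => //=; rewrite lecE/= eqxx. Qed.

Lemma ler_kabsD (x y : K) : kabs (x + y) <= kabs x + kabs y.
Proof. by rewrite -ler_of_real of_realD -!norm_kabs ler_normD. Qed.

Lemma kabsN (x : K) : kabs (- x) = kabs x.
Proof. by rewrite /kabs normrN. Qed.

Lemma kabs0 : kabs 0 = 0.
Proof. by rewrite /kabs normr0 real_part0. Qed.

Lemma kabs1 : kabs 1 = 1.
Proof. by rewrite /kabs normr1; case: s. Qed.

Lemma kabs_of_real x : kabs (of_real x) = `|x|.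
Proof.
rewrite /kabs /of_real; case: s => //=.
by rewrite expr0n/= addr0 sqrtr_sqr.
Qed.

Lemma kabs_eq0 (z : K) : kabs z = 0 -> z = 0.
Proof. by move=> z0; apply/eqP; rewrite -normr_eq0 norm_kabs z0 of_real0. Qed.

Lemma unimodular_kabs (z : K) : exists2 c : K, kabs c = 1 & c * z = of_real (kabs z).
Proof.
have [->|z0] := eqVneq z 0.
  by exists 1; [exact: kabs1|rewrite mulr0 kabs0 of_real0].
exists (`|z| / z); last by rewrite divfK// norm_kabs.
by apply: of_real_inj; rewrite -norm_kabs normf_div normr_id divff ?normr_eq0// of_real1.
Qed.

(** The real part determines a linear functional: [g x = u x - i u (i x)] in
    the complex case. *)
Definition complexify (W : lmodType K) : (W -> R) -> W -> K :=
  match s as s0 return forall W : lmodType (scalar_field R s0),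
      (W -> R) -> W -> scalar_field R s0 with
  | RealScalars => fun W u x => u x
  | ComplexScalars => fun W u x => (u x +i* (- u ('i%C *: x)))%C
  end W.

Lemma real_part_complexify (W : lmodType K) (u : W -> R) x :
  real_part (complexify u x) = u x.
Proof. by rewrite /complexify; move: W u x; case: s. Qed.

End Scalars.
Arguments of_real {R s}.

Section Subspaces.
Context (R : realType) (s : scalars).
Local Notation K := (scalar_field R s).
Context (V : lmodType K).
Implicit Types (E D : set V) (p : V -> R).

Definition subspace E := E 0 /\ forall (a : K) x y, E x -> E y -> E (a *: x + y).

Definition linear_on (W : lmodType K) (E : set W) (g : W -> K) :=
  forall (a : K) x y, E x -> E y -> g (a *: x + y) = a * g x + g y.

Definition seminorm_on E p :=
  (forall x y, E x -> E y -> p (x + y) <= p x + p y) /\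
  (forall (a : K) x, E x -> p (a *: x) = kabs a * p x).

Lemma subspaceD E x y : subspace E -> E x -> E y -> E (x + y).
Proof. by move=> sE Ex Ey; rewrite -(scale1r x); apply: sE.2. Qed.

Lemma subspaceZ E (a : K) x : subspace E -> E x -> E (a *: x).
Proof. by move=> sE Ex; rewrite -(addr0 (_ *: _)); apply: sE.2 => //; exact: sE.1. Qed.

Lemma subspaceN E x : subspace E -> E x -> E (- x).
Proof. by move=> sE Ex; rewrite -scaleN1r; exact: subspaceZ. Qed.

Lemma subspaceB E x y : subspace E -> E x -> E y -> E (x - y).
Proof. by move=> sE Ex Ey; apply: subspaceD => //; exact: subspaceN. Qed.

Lemma linear_on0 E g : subspace E -> linear_on E g -> g 0 = 0.
Proof.
move=> [E0 _] lg; have := lg 1 0 0 E0 E0.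
by rewrite scaler0 addr0 mul1r => /eqP; rewrite eq_sym -subr_eq0 addrK => /eqP.
Qed.

Lemma linear_onD E g x y : linear_on E g -> E x -> E y -> g (x + y) = g x + g y.
Proof. by move=> lg Ex Ey; rewrite -[in LHS](scale1r x) lg// mul1r. Qed.

Lemma linear_onZ E g (a : K) x : subspace E -> linear_on E g -> E x ->
  g (a *: x) = a * g x.
Proof.
move=> sE lg Ex; rewrite -[in LHS](addr0 (_ *: _)) lg//; last exact: sE.1.
by rewrite (linear_on0 sE lg) addr0.
Qed.

Lemma linear_onB E g x y : subspace E -> linear_on E g -> E x -> E y ->
  g (x - y) = g x - g y.
Proof.
move=> sE lg Ex Ey; rewrite (linear_onD lg)//; last exact: subspaceN.
by rewrite -scaleN1r (linear_onZ _ sE)// mulN1r.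
Qed.

End Subspaces.

Lemma complexify_linear (R : realType) s (V : lmodType (scalar_field R s))
    (E : set V) (u : V -> R) : subspace E ->
  (forall (a : R) x y, E x -> E y -> u (of_real a *: x + y) = a * u x + u y) ->
  linear_on E (complexify u).
Proof.
case: s V E u => W E u sE ulin //= [a b] x y Ex Ey.
have u0 : u 0 = 0.
  have := ulin 1 0 0 sE.1 sE.1.
  by rewrite scaler0 addr0 mul1r => /eqP; rewrite eq_sym -subr_eq0 addrK => /eqP.
have uZ c z : E z -> u (c%:C%C *: z) = c * u z.
  by move=> Ez; have := ulin c z 0 Ez sE.1; rewrite u0 !addr0.
have EZ c z : E z -> E (c *: z) by exact: subspaceZ.
(* [u] is only real-linear, so [i z] has to be handled as a further vector. *)
have decomp (c d : R) z w : E z -> E w ->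
    u ((c +i* d)%C *: z + w) = c * u z + d * u ('i%C *: z) + u w.
  move=> Ez Ew; rewrite [(c +i* d)%C]complexE/= mulrC scalerDl -scalerA -addrA.
  rewrite ulin//; last by apply: sE.2 => //; exact: EZ.
  by rewrite ulin ?addrA//; exact: EZ.
rewrite decomp//; apply/eqP; rewrite eq_complex/= mulrN opprK eqxx /=.
have -> : 'i%C *: ((a +i* b)%C *: x + y) = ((- b) +i* a)%C *: x + 'i%C *: y.
  rewrite scalerDr scalerA; congr (_ *: _ + _); apply/eqP.
  by rewrite eq_complex/= !(mul0r, mul1r, sub0r, add0r) !eqxx.
rewrite decomp//; last exact: EZ.
by apply/eqP; ring.
Qed.

Lemma complexify_eq (R : realType) s (V : lmodType (scalar_field R s))
    (D : set V) (u : V -> R) phi x : subspace D -> linear_on D phi ->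
  (forall x, D x -> u x = real_part (phi x)) -> D x -> complexify u x = phi x.
Proof.
case: s V D u phi x => W D u phi x sD lphi uE Dx /=.
  exact: uE.
rewrite !uE//; last exact: (@subspaceZ R ComplexScalars).
rewrite (@linear_onZ R ComplexScalars _ _ _ _ _ sD lphi)// mulrC.
by case: (phi x) => c d /=; rewrite mulr0 mulr1 sub0r opprK.
Qed.

Section HahnBanach.
Context (R : realType) (s : scalars).
Local Notation K := (scalar_field R s).
Context (V : lmodType K).
Implicit Types (E D : set V) (p : V -> R).

(** Partial real-linear functionals below [p] are encoded by their graphs, so that extension is
    inclusion. That a graph is single-valued is not imposed: it follows from the domination. *)
Definition dominated_graph E D p (phi : V -> K) (G : set (V * R)) :=
  [/\ forall x, D x -> G (x, real_part (phi x)),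
      forall (a : R) u v, G u -> G v ->
        G (of_real a *: u.1 + v.1, a * u.2 + v.2) &
      forall u, G u -> E u.1 /\ u.2 <= p u.1].

Lemma dominated_graph_max E D p phi : subspace E -> subspace D -> D `<=` E ->
  seminorm_on E p -> linear_on D phi -> (forall x, D x -> kabs (phi x) <= p x) ->
  exists2 G, dominated_graph E D p phi G &
    forall G', dominated_graph E D p phi G' -> G `<=` G' -> G' = G.
Proof.
move=> sE sD DE sp lphi phip.
pose G0 := [set u : V * R | D u.1 /\ u.2 = real_part (phi u.1)].
have dG0 : dominated_graph E D p phi G0.
  split=> [x Dx //|a [x r] [y t] /= [/= Dx ->] [/= Dy ->]|[x r] [/= Dx ->]].
    split => /=; first exact: sD.2.
    by rewrite lphi// real_partD real_part_of_realM.
  by split; [exact: DE|apply: le_trans (phip _ Dx); exact: real_part_le_kabs].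
(* The union of the empty chain is empty, whence the first alternative; a maximal [G] cannot be
   empty, because [G0] is not. *)
pose P (G : set (V * R)) := G = set0 \/ dominated_graph E D p phi G.
have [|G [PG Gmax]] := @Zorn_bigcup _ P.
  move=> F FP totF.
  have [[G FG G0']|F0] := pselect (exists2 G, F G & dominated_graph E D p phi G);
    last first.
    left; rewrite bigcup0// => G FG; have [//|dG] := FP _ FG.
    by exfalso; apply: F0; exists G.
  right.
  have dF u H : F H -> H u -> dominated_graph E D p phi H.
    by move=> FH Hu; have [H0|//] := FP _ FH; rewrite H0 in Hu.
  split=> [x Dx|a u v [H FH Hu] [H' FH' Hv]|u [H FH Hu]].
  - by exists G => //; case: G0' => + _ _; exact.
  - have [HH|HH] := totF _ _ FH FH'.
      by exists H' => //; case: (dF _ _ FH' Hv) => _ + _; apply => //; exact: HH.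
    by exists H => //; case: (dF _ _ FH Hu) => _ + _; apply => //; exact: HH.
  - by case: (dF _ _ FH Hu) => _ _; exact.
have dG : dominated_graph E D p phi G.
  case: PG => // G0e; exfalso; apply: (Gmax G0); last by right.
  rewrite G0e; split=> // /(_ (0, 0)); apply; split => /=; first exact: sD.1.
  by rewrite (linear_on0 sD lphi) real_part0.
exists G => // G' dG' GG'; apply: contrapT => /eqP ne.
apply: (Gmax G'); last by right.
by rewrite properEneq eq_sym ne.
Qed.

Lemma dominated_graphZ E D p phi G (a : R) u : subspace D -> linear_on D phi ->
  dominated_graph E D p phi G -> G u -> G (of_real a *: u.1, a * u.2).
Proof.
move=> sD lphi [DG lG _] Gu; have := lG a _ _ Gu (DG _ sD.1).
by rewrite (linear_on0 sD lphi) /= real_part0 !addr0.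
Qed.

(** For any [x0] a value [c] is found such that adjoining the line through [(x0, c)] keeps the graph
    dominated. By maximality nothing was added, so [x0] already had a value. *)
Lemma dominated_graph_total E D p phi G : subspace E -> subspace D ->
  D `<=` E -> seminorm_on E p -> linear_on D phi ->
  dominated_graph E D p phi G ->
  (forall G', dominated_graph E D p phi G' -> G `<=` G' -> G' = G) ->
  forall x, E x -> exists r, G (x, r).
Proof.
move=> sE sD DE [pD pZ] lphi dG Gmax x0 Ex0.
have GZ a u := @dominated_graphZ _ _ _ _ _ a u sD lphi dG.
case: (dG) => DG lG Gp; have G00 : G (0, 0).
  by have := DG _ sD.1; rewrite (linear_on0 sD lphi) real_part0.
have GE u : G u -> E u.1 by move=> /Gp[].
(* Every lower constraint on the value at [x0] lies below every upper one, so the supremum of the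
   lower ones satisfies both families. *)
have sep u v : G u -> G v -> u.2 - p (u.1 - x0) <= p (v.1 + x0) - v.2.
  move=> Gu Gv; rewrite lerBlDr addrAC lerBrDr.
  have [_ /=] := Gp _ (lG 1 _ _ Gu Gv); rewrite of_real1 scale1r mul1r.
  move=> /le_trans; apply; rewrite addrC.
  rewrite [in leLHS](_ : u.1 + v.1 = (u.1 - x0) + (v.1 + x0)); last first.
    by rewrite addrACA addNr addr0.
  rewrite addrC [leRHS]addrC; apply: pD.
    by apply: subspaceB => //; exact: GE.
  by apply: subspaceD => //; exact: GE.
pose S := [set u.2 - p (u.1 - x0) | u in G].
have S0 : S !=set0 by exists (0 - p (0 - x0)); exists (0, 0).
have Sub v : G v -> ubound S (p (v.1 + x0) - v.2).
  by move=> Gv _ [u Gu <-]; exact: sep.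
have hS : has_sup S by split => //; exists (p (0 + x0) - 0); exact: (Sub (0, 0)).
pose c := sup S.
have cl u : G u -> u.2 - c <= p (u.1 - x0).
  by move=> Gu; rewrite lerBlDr addrC -lerBlDr; apply: ub_le_sup; [exact: hS.2|exists u].
have cu v : G v -> v.2 + c <= p (v.1 + x0).
  by move=> Gv; rewrite -lerBrDl; apply: ge_sup => //; exact: Sub.
pose G' := [set w : V * R | exists (a : R) u,
  G u /\ w = (of_real a *: x0 + u.1, a * c + u.2)].
have GG' : G `<=` G'.
  move=> [x r] Gu; exists 0, (x, r); split => //.
  by rewrite of_real0 scale0r mul0r !add0r.
suff dG' : dominated_graph E D p phi G'.
  exists c; rewrite -(Gmax _ dG' GG'); exists 1, (0, 0); split => //.
  by rewrite of_real1 scale1r mul1r !addr0.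
split=> [x Dx|a _ _ [a1 [u1 [Gu1 ->]]] [a2 [u2 [Gu2 ->]]]|_ [a [u [Gu ->]]]] /=.
- exact/GG'/DG.
- exists (a * a1 + a2), (of_real a *: u1.1 + u2.1, a * u1.2 + u2.2).
  split; first exact: lG.
  congr (_, _) => /=; last by ring.
  by rewrite of_realD of_realM scalerDl scalerDr scalerA addrACA.
- split; first by apply: sE.2 => //; exact: GE.
  have pZ' r z : 0 < r -> E z -> r * p z = p (of_real r *: z).
    by move=> r0 Ez; rewrite pZ// kabs_of_real gtr0_norm.
  (* Dividing by [a] or by [- a] reduces the inequality to the constraint [cu] or [cl]. *)
  have [a0|a0|->] := ltgtP a 0; last first.
  + by rewrite of_real0 scale0r mul0r !add0r; exact: (Gp _ Gu).2.
  + have := cu _ (GZ a^-1 _ Gu) => /=; rewrite -(ler_pM2l a0) mulrDr mulrA divff ?gt_eqF//.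
    rewrite mul1r addrC => /le_trans; apply; rewrite pZ'//; last first.
      by apply: subspaceD => //; apply: subspaceZ => //; exact: GE.
    rewrite scalerDr scalerA -of_realM divff ?gt_eqF// of_real1 scale1r.
    by rewrite addrC.
  + have na0 : 0 < - a by rewrite oppr_gt0.
    have := cl _ (GZ (- a)^-1 _ Gu) => /=.
    rewrite -(ler_pM2l na0) mulrBr mulrA divff ?gt_eqF// mul1r mulNr opprK addrC.
    move=> /le_trans; apply; rewrite pZ'//; last first.
      by apply: subspaceB => //; apply: subspaceZ => //; exact: GE.
    rewrite scalerBr scalerA -of_realM divff ?gt_eqF// of_real1 scale1r.
    by rewrite of_realN scaleNr opprK addrC.
Qed.

Theorem hahn_banach E D p phi : subspace E -> subspace D -> D `<=` E ->
  seminorm_on E p -> linear_on D phi -> (forall x, D x -> kabs (phi x) <= p x) ->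
  exists g : V -> K, [/\ linear_on E g, forall x, E x -> kabs (g x) <= p x &
    forall x, D x -> g x = phi x].
Proof.
move=> sE sD DE sp lphi phip.
have [G dG Gmax] := dominated_graph_max sE sD DE sp lphi phip.
have Gtot := dominated_graph_total sE sD DE sp lphi dG Gmax.
case: (dG) => DG lG Gp.
have p0 : p 0 = 0 by rewrite -(scale0r 0) sp.2 ?kabs0 ?mul0r//; exact: sE.1.
(* The domination is used at [(0, r)] and at [(0, - r)], where [p 0 = 0]. This makes the graph
   single-valued. *)
have G0 r : G (0, r) -> r = 0.
  move=> Gr; apply/eqP; rewrite eq_le; have [_ /=] := Gp _ Gr; rewrite p0 => -> /=.
  have := dominated_graphZ (-1) sD lphi dG Gr => /Gp[_ /=].
  by rewrite scaler0 p0 mulN1r oppr_le0.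
have /choice[u uP] : forall x, exists r, E x -> G (x, r).
  move=> x; have [Ex|nEx] := pselect (E x); last by exists 0.
  by have [r Gr] := Gtot _ Ex; exists r.
have Gfun x r : E x -> G (x, r) -> u x = r.
  move=> Ex Gr; have := lG (-1) _ _ Gr (uP _ Ex) => /=.
  rewrite of_realN of_real1 scaleN1r addNr mulN1r addrC => /G0/eqP.
  by rewrite subr_eq0 => /eqP.
have ulin (a : R) x y : E x -> E y -> u (of_real a *: x + y) = a * u x + u y.
  move=> Ex Ey; apply: Gfun; first exact: sE.2.
  exact: (lG a _ _ (uP _ Ex) (uP _ Ey)).
have up x : E x -> u x <= p x by move=> Ex; exact: (Gp _ (uP _ Ex)).2.
have uphi x : D x -> u x = real_part (phi x).
  by move=> Dx; apply: Gfun; [exact: DE|exact: DG].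
exists (complexify u).
have lg : linear_on E (complexify u).
  exact: complexify_linear.
split => // x Ex; last exact: (complexify_eq sD lphi).
(* Only real parts are dominated so far; rotating [x] by a unimodular scalar turns the modulus of
   its value into a real part. *)
have [c c1 cg] := unimodular_kabs (complexify u x).
rewrite -(real_part_of_real s (kabs _)) -cg.
rewrite -(linear_onZ _ sE lg)// real_part_complexify.
by rewrite (le_trans (up _ (subspaceZ _ sE Ex)))// sp.2// c1 mul1r.
Qed.

End HahnBanach.

(** * Duals and the K-functional *)

Section BoundedFunctionals.
Context (R : realType) (s : scalars).
Local Notation K := (scalar_field R s).
Context (V : lmodType K).
Implicit Types (X : qspace R V) (g : V -> K).

Definition seminormed X := subspace (carrier X) /\ seminorm_on (carrier X) (qnorm X).

(** The part of the seminorm axioms that survives in the [K]-space. The bounds on functionals below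
    rest on it alone, hence apply to quasi-norms. *)
Definition homogeneous X := [/\ subspace (carrier X),
  forall x, X x -> 0 <= qnorm X x &
  forall (a : K) x, X x -> qnorm X (a *: x) = kabs a * qnorm X x].

Lemma seminormed_homogeneous X : seminormed X -> homogeneous X.
Proof.
move=> [sX [nD nZ]]; split=> // x Xx.
have := nD x (- x) Xx (subspaceN sX Xx).
rewrite subrr -{1}(scale0r 0) nZ; last exact: sX.1.
rewrite kabs0 mul0r -scaleN1r nZ// kabsN kabs1 mul1r -mulr2n.
by rewrite pmulrn_lge0.
Qed.

Lemma homogeneous_qnorm0 X : homogeneous X -> qnorm X 0 = 0.
Proof.
by move=> [sX _ nZ]; rewrite -(scale0r 0) nZ ?kabs0 ?mul0r//; exact: sX.1.
Qed.

Lemma homogeneous_qnormN X x : homogeneous X -> X x -> qnorm X (- x) = qnorm X x.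
Proof. by move=> [_ _ nZ] Xx; rewrite -scaleN1r nZ// kabsN kabs1 mul1r. Qed.

Lemma continuous_functional_bounded X g : homogeneous X ->
  continuous_functional X g ->
  exists2 M, 0 <= M & forall x, X x -> kabs (g x) <= M * qnorm X x.
Proof.
move=> hX [lg cg]; have [sX nX nZ] := hX.
have [d d0 dg] := cg _ sX.1 1 ltr01.
exists d^-1; first by rewrite invr_ge0 ltW.
move=> x Xx; apply/ler_addgt0Pr => e e0.
(* The summand [d * e] keeps [r] positive when [x] has norm 0. The multiple [(d / r) x] has norm
   below [d], so [|g x| <= r / d = |x| / d + e]. *)
pose r := qnorm X x + d * e.
have r0 : 0 < r by rewrite ltr_wpDl ?nX// mulr_gt0.
have dr0 : 0 < d / r by rewrite divr_gt0.
have := dg (of_real (d / r) *: x) (subspaceZ _ sX Xx).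
rewrite subr0 nZ// kabs_of_real gtr0_norm// (linear_on0 sX lg) subr0.
have -> : d / r * qnorm X x < d.
  by rewrite mulrAC ltr_pdivrMr// ltr_pM2l// ltrDl mulr_gt0.
move=> /(_ isT); rewrite (linear_onZ _ sX lg)// -/(kabs _) kabsM kabs_of_real.
rewrite gtr0_norm// mulrAC ltr_pdivrMr// mul1r -ltr_pdivlMl// => /ltW/le_trans.
by apply; rewrite mulrDr mulrA mulVf ?gt_eqF// mul1r.
Qed.

Lemma bounded_continuous_functional X g M : homogeneous X ->
  linear_on (carrier X) g -> (forall x, X x -> kabs (g x) <= M * qnorm X x) ->
  continuous_functional X g.
Proof.
move=> [sX nX nZ] lg gM; split=> // x Xx e e0.
have N0 : 0 < Num.max M 1 by rewrite lt_max ltr01 orbT.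
exists (e / Num.max M 1); first by rewrite divr_gt0.
move=> y Xy; rewrite ltr_pdivlMr// mulrC => le_e.
rewrite -(linear_onB sX lg)//; apply: le_lt_trans le_e.
have Xyx := subspaceB sX Xy Xx.
by apply: le_trans (gM _ Xyx) _; rewrite ler_wpM2r ?nX// le_max lexx.
Qed.

Lemma functional_norm_le X g M : homogeneous X -> 0 <= M ->
  (forall x, X x -> kabs (g x) <= M * qnorm X x) -> functional_norm X g <= M.
Proof.
move=> hX M0 gM; have [sX nX nZ] := hX; apply: ge_sup.
  exists (kabs (g 0)); exists 0 => //; split; first exact: sX.1.
  by rewrite homogeneous_qnorm0.
move=> _ [x [Xx x1] <-]; apply: le_trans (gM _ Xx) _.
by rewrite -[leRHS]mulr1 ler_wpM2l.
Qed.

Lemma functional_norm_bound X g x : homogeneous X -> continuous_functional X g ->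
  X x -> kabs (g x) <= functional_norm X g * qnorm X x.
Proof.
move=> hX cg Xx; have [sX nX nZ] := hX.
have [M M0 gM] := continuous_functional_bounded hX cg.
have [x0|x0] := eqVneq (qnorm X x) 0; first by have := gM _ Xx; rewrite x0 !mulr0.
have xp : 0 < qnorm X x by rewrite lt_neqAle eq_sym x0 nX.
rewrite -ler_pdivrMr// mulrC; apply: ub_le_sup.
  exists M => _ [y [Xy y1] <-]; apply: le_trans (gM _ Xy) _.
  by rewrite -[leRHS]mulr1 ler_wpM2l.
exists (of_real (qnorm X x)^-1 *: x).
  split; first exact: subspaceZ.
  by rewrite nZ// kabs_of_real ger0_norm ?invr_ge0 ?nX// mulVf.
rewrite (linear_onZ _ sX cg.1)// -/(kabs _) kabsM kabs_of_real.
by rewrite ger0_norm// invr_ge0 nX.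
Qed.

Lemma functional_norm_ge0 X g : homogeneous X -> continuous_functional X g ->
  0 <= functional_norm X g.
Proof.
move=> hX cg; have [sX nX nZ] := hX.
have [M M0 gM] := continuous_functional_bounded hX cg.
apply: le_trans (kabs_ge0 (g 0)) _; apply: ub_le_sup.
  exists M => _ [y [Xy y1] <-]; apply: le_trans (gM _ Xy) _.
  by rewrite -[leRHS]mulr1 ler_wpM2l.
exists 0 => //; split; first exact: sX.1.
by rewrite homogeneous_qnorm0.
Qed.

End BoundedFunctionals.

Section DualSpaces.
Context (R : realType) (s : scalars).
Local Notation K := (scalar_field R s).
Context (V : lmodType K) (D : set V).
Implicit Types (X : qspace R V) (phi psi : D -> K).

(** Elements of a dual are functions on the subtype [D]; extended by 0 they can be evaluated at sums
    and multiples formed in [V]. *)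
Definition extend phi (v : V) : K :=
  if pselect (D v) is left Dv then phi (SigSub (mem_set Dv)) else 0.

Lemma extend_val phi (x : D) : extend phi (val x) = phi x.
Proof.
rewrite /extend; case: pselect => [Dv|nD]; last by have := set_mem (valP x).
by congr phi; exact: val_inj.
Qed.

Lemma restricts_toP (g : V -> K) phi :
  restricts_to g phi <-> forall x, D x -> extend phi x = g x.
Proof.
split=> [gphi x Dx|gphi x]; last by rewrite -gphi ?extend_val//; exact/set_mem/valP.
by rewrite /extend; case: pselect => // Dx'; rewrite gphi.
Qed.

Lemma eq_extend phi psi : (forall x, D x -> extend phi x = extend psi x) ->
  phi = psi.
Proof.
move=> e; apply/funext => x; rewrite -!extend_val; apply: e.
exact/set_mem/valP.
Qed.

Lemma extend_restrict (g : V -> K) x : D x -> extend (fun y => g (val y)) x = g x.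
Proof. by move=> Dx; rewrite /extend; case: pselect. Qed.

Lemma extendD phi psi x : extend (phi + psi) x = extend phi x + extend psi x.
Proof. by rewrite /extend; case: pselect => // _; rewrite addr0. Qed.

Lemma extend0 x : extend 0 x = 0.
Proof. by rewrite /extend; case: pselect. Qed.

Lemma dual_qnorm_le X g phi M : homogeneous X -> 0 <= M ->
  continuous_functional X g -> restricts_to g phi ->
  (forall x, X x -> kabs (g x) <= M * qnorm X x) -> qnorm (dual D X) phi <= M.
Proof.
move=> hX M0 cg gphi gM; apply: le_trans (functional_norm_le hX M0 gM).
apply: ge_inf; last by exists g.
by exists 0 => _ [h [ch _] <-]; exact: functional_norm_ge0.
Qed.

Lemma dual_qnorm_ge0 X phi : homogeneous X -> dual D X phi ->
  0 <= qnorm (dual D X) phi.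
Proof.
move=> hX [g cg gphi]; apply: lb_le_inf.
  by exists (functional_norm X g); exists g.
by move=> _ [h [ch _] <-]; exact: functional_norm_ge0.
Qed.

Lemma dual_bound X phi x : homogeneous X -> D `<=` carrier X -> dual D X phi ->
  D x -> kabs (extend phi x) <= qnorm (dual D X) phi * qnorm X x.
Proof.
move=> hX DX [g cg gphi] Dx; have [sX nX nZ] := hX.
have hx h : continuous_functional X h -> restricts_to h phi ->
    kabs (extend phi x) <= functional_norm X h * qnorm X x.
  by move=> ch /restricts_toP ->//; apply: functional_norm_bound => //; exact: DX.
have [x0|x0] := eqVneq (qnorm X x) 0.
  by have := hx g cg gphi; rewrite x0 !mulr0.
have xp : 0 < qnorm X x by rewrite lt_neqAle eq_sym x0 nX//; exact: DX.
rewrite -ler_pdivrMr//; apply: lb_le_inf; first by exists (functional_norm X g); exists g.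
by move=> _ [h [ch hphi] <-]; rewrite ler_pdivrMr//; exact: hx.
Qed.

Lemma dual_linear X phi : D `<=` carrier X -> dual D X phi ->
  subspace D -> linear_on D (extend phi).
Proof.
move=> DX [g cg /restricts_toP gphi] sD a x y Dx Dy.
rewrite !gphi//; last exact: sD.2.
by apply: cg.1; exact: DX.
Qed.

(** Hahn-Banach with the seminorm [M * qnorm X] extends [phi] from [D] to [X] without loss in the
    constant. *)
Lemma dual_intro X phi M : seminormed X -> subspace D -> D `<=` carrier X ->
  0 <= M -> linear_on D (extend phi) ->
  (forall x, D x -> kabs (extend phi x) <= M * qnorm X x) ->
  dual D X phi /\ qnorm (dual D X) phi <= M.
Proof.
move=> sX sD DX M0 lphi phiM; have hX := seminormed_homogeneous sX.
have spX : seminorm_on (carrier X) (fun x => M * qnorm X x).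
  split=> [x y Xx Xy|a x Xx]; first by rewrite -mulrDr ler_wpM2l// sX.2.1.
  by rewrite sX.2.2// mulrCA.
have [g [lg gM gphi]] := hahn_banach sX.1 sD DX spX lphi phiM.
have cg := bounded_continuous_functional hX lg gM.
have rg : restricts_to g phi by apply/restricts_toP => x Dx; rewrite gphi.
split; first by exists g.
exact: (dual_qnorm_le hX M0 cg rg).
Qed.

Section DualSubspace.
Variable X : qspace R V.
Hypothesis sX : seminormed X.
Hypothesis sD : subspace D.
Hypothesis DX : D `<=` carrier X.

Definition combo (a b : R) phi psi : D -> K :=
  fun x => of_real a * phi x + of_real b * psi x.

Lemma extend_combo a b phi psi x :
  extend (combo a b phi psi) x = of_real a * extend phi x + of_real b * extend psi x.
Proof. by rewrite /extend; case: pselect => // _; rewrite !mulr0 addr0. Qed.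

Lemma dual_combo a b phi psi : dual D X phi -> dual D X psi ->
  dual D X (combo a b phi psi) /\ qnorm (dual D X) (combo a b phi psi) <=
    `|a| * qnorm (dual D X) phi + `|b| * qnorm (dual D X) psi.
Proof.
have hX := seminormed_homogeneous sX.
move=> phi' psi'; set M := (X in _ <= X).
have M0 : 0 <= M by rewrite addr_ge0// mulr_ge0// dual_qnorm_ge0.
apply: (@dual_intro X (combo a b phi psi) M sX sD DX M0).
  move=> c x y Dx Dy; rewrite !extend_combo (dual_linear DX phi')//.
  by rewrite (dual_linear DX psi')//; ring.
move=> x Dx; rewrite extend_combo; apply: le_trans (ler_kabsD _ _) _.
by rewrite !kabsM !kabs_of_real mulrDl -!mulrA lerD// ler_wpM2l ?dual_bound.
Qed.

Lemma comboB phi psi : phi - psi = combo 1 (-1) phi psi.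
Proof.
by apply/funext => x; rewrite /combo of_realN of_real1 mul1r mulN1r.
Qed.

Lemma dualB phi psi : dual D X phi -> dual D X psi -> dual D X (phi - psi).
Proof. by move=> phi' psi'; rewrite comboB; case: (dual_combo 1 (-1) phi' psi'). Qed.

Lemma dual0 : dual D X 0.
Proof.
apply: (proj1 (@dual_intro X 0 0 sX sD DX (lexx _) _ _)).
  by move=> a x y _ _; rewrite !extend0 mulr0 addr0.
by move=> x _; rewrite extend0 kabs0 mul0r.
Qed.

Lemma dualD phi psi : dual D X phi -> dual D X psi -> dual D X (phi + psi).
Proof.
move=> phi' psi'; rewrite -[psi]opprK; apply: dualB => //.
by rewrite -sub0r; exact: dualB dual0 psi'.
Qed.

Lemma dual_sum (I : Type) (r : seq I) (P : pred I) (F : I -> (D -> K)) :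
  (forall i, P i -> dual D X (F i)) -> dual D X (\sum_(i <- r | P i) F i).
Proof.
by move=> DF; elim/big_ind: _ => //; [exact: dual0|move=> x y; exact: dualD].
Qed.

End DualSubspace.

End DualSpaces.

Section KFunctional.
Context (R : realType) (V : zmodType) (X0 X1 : qspace R V).
Hypothesis X0_ge0 : forall x, X0 x -> 0 <= qnorm X0 x.
Hypothesis X1_ge0 : forall x, X1 x -> 0 <= qnorm X1 x.
Local Notation Kf := (Kfun X0 X1).

Let lb_Kfun t f : 0 <= t -> has_lbound
  [set x | exists f0 f1, [/\ X0 f0, X1 f1, f = f0 + f1 &
                          x = qnorm X0 f0 + t * qnorm X1 f1]].
Proof.
move=> t0; exists 0 => _ [f0 [f1 [Xf0 Xf1 _ ->]]].
by rewrite addr_ge0 ?X0_ge0// mulr_ge0 ?X1_ge0.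
Qed.

Lemma Kfun_le t f0 f1 : 0 <= t -> X0 f0 -> X1 f1 ->
  Kf t (f0 + f1) <= qnorm X0 f0 + t * qnorm X1 f1.
Proof. by move=> t0 Xf0 Xf1; apply: ge_inf; [exact: lb_Kfun|exists f0, f1]. Qed.

Lemma Kfun_ge t f x : sum_set X0 X1 f ->
  (forall f0 f1, X0 f0 -> X1 f1 -> f = f0 + f1 ->
     x <= qnorm X0 f0 + t * qnorm X1 f1) -> x <= Kf t f.
Proof.
move=> [f0 [f1 [Xf0 Xf1 ff]]] xK; apply: lb_le_inf.
  by exists (qnorm X0 f0 + t * qnorm X1 f1), f0, f1.
by move=> _ [g0 [g1 [Xg0 Xg1 gg ->]]]; exact: xK.
Qed.

Lemma Kfun_ge0 t f : 0 <= t -> sum_set X0 X1 f -> 0 <= Kf t f.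
Proof.
move=> t0 ff; apply: Kfun_ge => // f0 f1 Xf0 Xf1 _.
by rewrite addr_ge0 ?X0_ge0// mulr_ge0 ?X1_ge0.
Qed.

Lemma Kfun_lt t f x : sum_set X0 X1 f -> Kf t f < x ->
  exists f0 f1, [/\ X0 f0, X1 f1, f = f0 + f1 &
                    qnorm X0 f0 + t * qnorm X1 f1 < x].
Proof.
move=> [f0 [f1 [Xf0 Xf1 ff]]] /inf_lt[].
  by exists (qnorm X0 f0 + t * qnorm X1 f1), f0, f1.
by move=> _ [g0 [g1 [Xg0 Xg1 gg ->]]] ltx; exists g0, g1.
Qed.

Lemma Kfun_homo t u f : 0 <= t -> t <= u -> sum_set X0 X1 f -> Kf t f <= Kf u f.
Proof.
move=> t0 tu ff; apply: Kfun_ge => // f0 f1 Xf0 Xf1 fe.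
rewrite fe; apply: le_trans (Kfun_le t0 Xf0 Xf1) _.
by rewrite lerD2l ler_wpM2r// X1_ge0.
Qed.

(** As [u / t >= 1], passing from [t] to [u] multiplies the cost of each decomposition by at most
    [u / t]. Equivalently, [K(t, f) / t] is nonincreasing. *)
Lemma Kfun_scale t u f : 0 < t -> t <= u -> sum_set X0 X1 f ->
  Kf u f <= u / t * Kf t f.
Proof.
move=> t0 tu ff; have u0 := lt_le_trans t0 tu.
rewrite -ler_pdivrMl ?divr_gt0// invf_div; apply: Kfun_ge => // f0 f1 Xf0 Xf1 fe.
rewrite fe; apply: le_trans (ler_wpM2l _ (Kfun_le (ltW u0) Xf0 Xf1)) _.
  by rewrite divr_ge0 ?ltW.
rewrite mulrDr mulrA divfK ?gt_eqF// lerD2r ler_piMl ?X0_ge0//.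
by rewrite ler_pdivrMr// mul1r.
Qed.

End KFunctional.

Section KFunctionalSeminorm.
Context (R : realType) (s : scalars).
Local Notation K := (scalar_field R s).
Context (V : lmodType K) (X0 X1 : qspace R V).
Hypothesis sX0 : seminormed X0.
Hypothesis sX1 : seminormed X1.
Local Notation Kf := (Kfun X0 X1).
Local Notation D := (carrier X0 `&` carrier X1).

Lemma X0_ge0 x : X0 x -> 0 <= qnorm X0 x.
Proof. by have [_ + _] := seminormed_homogeneous sX0; apply. Qed.

Lemma X1_ge0 x : X1 x -> 0 <= qnorm X1 x.
Proof. by have [_ + _] := seminormed_homogeneous sX1; apply. Qed.

Let Kle := Kfun_le X0_ge0 X1_ge0.

Lemma subspace_sum_set : subspace (sum_set X0 X1).
Proof.
split; first by exists 0, 0; split; [exact: sX0.1.1|exact: sX1.1.1|rewrite addr0].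
move=> a _ _ [x0 [x1 [X0x X1x ->]]] [y0 [y1 [X0y X1y ->]]].
exists (a *: x0 + y0), (a *: x1 + y1); split; [exact: sX0.1.2|exact: sX1.1.2|].
by rewrite scalerDr addrACA.
Qed.

Lemma subspace_capD : subspace D.
Proof.
split; first by split; [exact: sX0.1.1|exact: sX1.1.1].
by move=> a x y [X0x X1x] [X0y X1y]; split; [exact: sX0.1.2|exact: sX1.1.2].
Qed.

Lemma sum_set0 x : X0 x -> sum_set X0 X1 x.
Proof. by move=> Xx; exists x, 0; split=> //; [exact: sX1.1.1|rewrite addr0]. Qed.

Lemma sum_set1 x : X1 x -> sum_set X0 X1 x.
Proof. by move=> Xx; exists 0, x; split=> //; [exact: sX0.1.1|rewrite add0r]. Qed.

Lemma Kfun_le0 t x : 0 <= t -> X0 x -> Kf t x <= qnorm X0 x.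
Proof.
move=> t0 Xx; have := @Kle t x 0 t0 Xx sX1.1.1.
by rewrite addr0 (homogeneous_qnorm0 (seminormed_homogeneous sX1)) mulr0 addr0.
Qed.

Lemma Kfun_le1 t x : 0 <= t -> X1 x -> Kf t x <= t * qnorm X1 x.
Proof.
move=> t0 Xx; have := @Kle t 0 x t0 sX0.1.1 Xx.
by rewrite add0r (homogeneous_qnorm0 (seminormed_homogeneous sX0)) add0r.
Qed.

Lemma seminorm_Kfun t : 0 <= t -> seminorm_on (sum_set X0 X1) (Kf t).
Proof.
move=> t0; split=> [x y Sx Sy|a x Sx].
  rewrite -lerBlDr; apply: Kfun_ge => // x0 x1 X0x X1x xe.
  rewrite lerBlDr -lerBlDl; apply: Kfun_ge => // y0 y1 X0y X1y ye.
  rewrite lerBlDl xe ye addrACA.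
  apply: le_trans (@Kle t _ _ t0 _ _) _ => //.
  - by apply: (@subspaceD R s) => //; exact: sX0.1.
  - by apply: (@subspaceD R s) => //; exact: sX1.1.
  - rewrite [leRHS]addrACA -mulrDr lerD ?sX0.2.1//.
    by rewrite ler_wpM2l ?sX1.2.1.
have le c z : sum_set X0 X1 z -> Kf t (c *: z) <= kabs c * Kf t z.
  move=> Sz; have [->|c0] := eqVneq c 0.
    rewrite scale0r kabs0 mul0r; apply: le_trans (Kfun_le0 t0 sX0.1.1) _.
    by rewrite (homogeneous_qnorm0 (seminormed_homogeneous sX0)).
  have c0' : 0 < kabs c.
    by rewrite lt_neqAle kabs_ge0 andbT; apply: contraNneq c0 => /esym/kabs_eq0 ->.
  rewrite -ler_pdivrMl//; apply: Kfun_ge => // z0 z1 X0z X1z ze.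
  rewrite ler_pdivrMl// ze scalerDr.
  apply: le_trans (@Kle t _ _ t0 _ _) _ => //.
  - by apply: (@subspaceZ R s) => //; exact: sX0.1.
  - by apply: (@subspaceZ R s) => //; exact: sX1.1.
  - by rewrite sX0.2.2// sX1.2.2// mulrDr mulrCA.
apply/eqP; rewrite eq_le le//=; have [->|c0] := eqVneq a 0.
  by rewrite kabs0 mul0r Kfun_ge0//; [exact: X0_ge0|exact: X1_ge0|]; exact: (subspaceZ _ subspace_sum_set).
(* The reverse inequality is [le] for the scalar [a^-1] and the vector [a x]. *)
have := le a^-1 (a *: x) (subspaceZ a subspace_sum_set Sx).
rewrite scalerA mulVf// scale1r => h.
apply: le_trans (ler_wpM2l (kabs_ge0 a) h) _.
by rewrite mulrA -kabsM divff// kabs1 mul1r.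
Qed.

(** [K(t, .)] on the dual couple is dual to [J(1 / t, .)]: split a
    Hahn-Banach extension from the diagonal of [D] to [X0 * X1]. *)
Lemma dual_decomposition (phi : D -> K) M tau : 0 <= M -> 0 < tau ->
  linear_on D (extend phi) ->
  (forall x, D x -> kabs (extend phi x) <= M * Jfun X0 X1 tau x) ->
  exists phi0 phi1, [/\ phi = phi0 + phi1, dual D X0 phi0, dual D X1 phi1,
    qnorm (dual D X0) phi0 <= M & qnorm (dual D X1) phi1 <= M * tau].
Proof.
move=> M0 tau0 lphi phiM; pose W := (V * V)%type.
pose E : set W := [set w | X0 w.1 /\ X1 w.2].
pose D' : set W := [set w | D w.1 /\ w.2 = w.1].
(* The sum dominates the maximum in [Jfun], and on the two axes it reduces to [M] and [M * tau]
   times the norms. This costs a factor 2 in the bound for [K(1 / tau, phi)]. *)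
pose p (w : W) : R := M * (qnorm X0 w.1 + tau * qnorm X1 w.2).
have sE : subspace E.
  split; first by split; [exact: sX0.1.1|exact: sX1.1.1].
  by move=> a x y [x0 x1] [y0 y1]; split; [exact: sX0.1.2|exact: sX1.1.2].
have sD' : subspace D'.
  split; first by split=> //; exact: subspace_capD.1.
  move=> a [x x'] [y y'] /= [/= Dx ->] [/= Dy ->]; split=> //=.
  exact: subspace_capD.2.
have DE : D' `<=` E by move=> [x x'] /= [/= [? ?] ->].
have sp : seminorm_on E p.
  split=> [[x0 x1] [y0 y1] [/= ? ?] [/= ? ?]|a [x0 x1] [/= ? ?]]; rewrite /p/=.
    rewrite -mulrDr ler_wpM2l// addrACA -mulrDr lerD ?sX0.2.1//.
    by rewrite ler_wpM2l ?(ltW tau0) ?sX1.2.1.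
  by rewrite sX0.2.2// sX1.2.2//; ring.
have lphi' : linear_on D' (fun w => extend phi w.1).
  by move=> a [x x'] [y y'] [/= ? _] [/= ? _]; exact: lphi.
have phip w : D' w -> kabs (extend phi w.1) <= p w.
  case: w => x x' [/= Dx ->]; apply: le_trans (phiM _ Dx) _.
  rewrite /p ler_wpM2l//= /Jfun ge_max lerDl lerDr X0_ge0 ?mulr_ge0 ?X1_ge0 ?ltW//.
    by case: Dx.
  by case: Dx.
have [g [lg gM gphi]] := hahn_banach sE sD' DE sp lphi' phip.
pose phi0 (x : D) := g (val x, 0); pose phi1 (x : D) := g (0, val x).
have q0 := homogeneous_qnorm0 (seminormed_homogeneous sX0).
have q1 := homogeneous_qnorm0 (seminormed_homogeneous sX1).
have Z0 := sX0.1.1; have Z1 := sX1.1.1.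
have E0 x : D x -> E (x, 0) by case=> ? ?; split.
have E1 x : D x -> E (0, x) by case=> ? ?; split.
have e0 x : D x -> extend phi0 x = g (x, 0).
  exact: (@extend_restrict _ _ _ _ (fun y => g (y, 0))).
have e1 x : D x -> extend phi1 x = g (0, x).
  exact: (@extend_restrict _ _ _ _ (fun y => g (0, y))).
have [d0 n0] : dual D X0 phi0 /\ qnorm (dual D X0) phi0 <= M.
  apply: dual_intro => //; [exact: subspace_capD| |].
    move=> a x y Dx Dy; rewrite !e0//; last exact: subspace_capD.2.
    rewrite -(lg _ _ _ (E0 _ Dx) (E0 _ Dy)).
    by congr g; congr (_, _) => /=; rewrite scaler0 addr0.
  move=> x Dx; rewrite e0//; apply: le_trans (gM _ (E0 _ Dx)) _.
  by rewrite /p/= q1 mulr0 addr0.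
have [d1 n1] : dual D X1 phi1 /\ qnorm (dual D X1) phi1 <= M * tau.
  apply: dual_intro => //; [exact: subspace_capD|
    by rewrite mulr_ge0// ltW| |].
    move=> a x y Dx Dy; rewrite !e1//; last exact: subspace_capD.2.
    rewrite -(lg _ _ _ (E1 _ Dx) (E1 _ Dy)).
    by congr g; congr (_, _) => /=; rewrite scaler0 addr0.
  move=> x Dx; rewrite e1//; apply: le_trans (gM _ (E1 _ Dx)) _.
  by rewrite /p/= q0 add0r mulrA.
exists phi0, phi1; split => //; apply: eq_extend => x Dx.
rewrite extendD e0// e1// -(gphi (x, x))//.
rewrite -(linear_onD lg (E0 _ Dx) (E1 _ Dx)).
by congr g; congr (_, _) => /=; rewrite ?addr0 ?add0r.
Qed.

(** If [x] lies in [D], both parts of any decomposition [x = x0 + x1] lie in [D], so [phi] can be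
    bounded on each: by [J] on the first and by [J / t] on the second. *)
Lemma dual_Kfun_bound (phi : D -> K) t x : 0 < t ->
  dual D X0 phi -> dual D X1 phi -> D x ->
  kabs (extend phi x) <= Jfun (dual D X0) (dual D X1) t phi * Kf t^-1 x.
Proof.
move=> t0 phi0 phi1 Dx.
have D0 : D `<=` carrier X0 by move=> ? [].
have D1 : D `<=` carrier X1 by move=> ? [].
have [h0 h1] := (seminormed_homogeneous sX0, seminormed_homogeneous sX1).
have [sD lphi] := (subspace_capD, dual_linear D0 phi0 subspace_capD).
set J := Jfun _ _ _ _.
have J0 : 0 <= J by rewrite le_max dual_qnorm_ge0.
have [Jeq|Jpos] := eqVneq J 0.
  rewrite Jeq mul0r; apply: le_trans (dual_bound h0 D0 phi0 Dx) _.
  rewrite -(mul0r (qnorm X0 x)) ler_wpM2r ?X0_ge0//; first by case: Dx.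
  by rewrite -Jeq le_max lexx.
have {}J0 : 0 < J by rewrite lt_neqAle eq_sym Jpos.
rewrite -ler_pdivrMl//; apply: Kfun_ge => //; first exact/sum_set0/D0.
move=> x0 x1 X0x X1x xe; rewrite ler_pdivrMl//.
have Dx0 : D x0.
  split=> //; rewrite -(addrK x1 x0) -xe.
  by apply: (@subspaceB R s) => //; [exact: sX1.1|exact: D1].
have Dx1 : D x1.
  split=> //; rewrite -(addrK x0 x1) (addrC x1) -xe.
  by apply: (@subspaceB R s) => //; [exact: sX0.1|exact: D0].
rewrite xe (linear_onD lphi)//; apply: le_trans (ler_kabsD _ _) _.
rewrite mulrDr lerD//.
  apply: le_trans (dual_bound h0 D0 phi0 Dx0) _.
  by rewrite ler_wpM2r ?X0_ge0// le_max lexx.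
apply: le_trans (dual_bound h1 D1 phi1 Dx1) _.
rewrite mulrA ler_wpM2r ?X1_ge0// ler_pdivlMr// mulrC.
by rewrite le_max lexx orbT.
Qed.

End KFunctionalSeminorm.

(** * Integrals over the Lebesgue sigma-algebra *)

Lemma ler_powRl (R : realType) (p x y : R) : 0 <= p -> 0 <= x -> x <= y ->
  x `^ p <= y `^ p.
Proof. by move=> p0 x0 xy; rewrite ge0_ler_powR ?nnegrE// (le_trans x0). Qed.

Lemma powR_ge1 (R : realType) (p x : R) : 0 <= p -> 1 <= x -> 1 <= x `^ p.
Proof.
move=> p0 x1; have := ler_powRl p0 ler01 x1.
by rewrite (_ : 1 `^ p = 1)// powR1.
Qed.

Lemma powR_addr_le (R : realType) (p u v : R) : 0 <= p -> 0 <= u -> 0 <= v ->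
  (u + v) `^ p <= 2 `^ p * (u `^ p + v `^ p).
Proof.
move=> p0; wlog vu : u v / v <= u => [wlg u0 v0|u0 v0].
  have [vu|uv'] := leP v u; first exact: wlg.
  by rewrite [u `^ p + _]addrC [u + v]addrC; apply: (wlg v u) => //; exact: ltW.
apply: le_trans (_ : (2 * u) `^ p <= _).
  apply: ler_powRl => //; first exact: addr_ge0.
  by rewrite mulr_natl mulr2n lerD2l.
by rewrite powRM// ler_wpM2l ?powR_ge0// lerDl powR_ge0.
Qed.

Section LebesgueMeasurable.
Context (R : realType).
Local Notation measurableL := (@measurable_fun _ _ (lebesgueType R) (measurableTypeR R)).

Lemma measurable_lebesgueType (A : set R) :
  @measurable _ (measurableTypeR R) A -> @measurable _ (lebesgueType R) A.
Proof. exact: sub_caratheodory. Qed.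

Lemma measurable_itvL (i : interval R) : @measurable _ (lebesgueType R) [set` i].
Proof. by apply: (@measurable_lebesgueType [set` i]); exact: measurable_itv. Qed.

Lemma measurable_funL (D : set R) (f : R -> R) : @measurable _ (measurableTypeR R) D ->
  @measurable_fun _ _ (measurableTypeR R) (measurableTypeR R) D f -> measurableL D f.
Proof.
by move=> mD mf _ Y mY; apply: (@measurable_lebesgueType (D `&` f @^-1` Y)); exact: mf.
Qed.

(** The preimage of a ray under a monotone function is an interval. *)
Lemma homo_measurableL (f : R -> R) :
  (forall x y, 0 < x -> x <= y -> f x <= f y) -> measurableL `]0, +oo[ f.
Proof.
move=> homf; apply: measurable_funL; first exact: measurable_itv.
apply: (measurability (@RGenCInfty.G R)) => [|/= _ [_] [r] -> <-].
  exact: RGenCInfty.measurableE.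
apply: is_interval_measurable => x y [/= x0 fx] [/= _ fy] z /andP[xz zy].
move: x0 fx; rewrite /= !in_itv/= !andbT => x0 fx.
by rewrite (lt_le_trans x0 xz) (le_trans fx)// homf.
Qed.

Lemma nhomo_measurableL (f : R -> R) :
  (forall x y, 0 < x -> x <= y -> f y <= f x) -> measurableL `]0, +oo[ f.
Proof.
move=> homf; rewrite -(opprK f); apply/measurable_funN.
by apply: homo_measurableL => x y x0 xy; rewrite lerN2 homf.
Qed.

Lemma powR_measurableL (D : set R) (f : R -> R) p : measurableL D f ->
  measurableL D (fun x => f x `^ p).
Proof. exact: (measurableT_comp (measurable_powR p)). Qed.

Lemma measurable_addL (D : set R) (F G : R -> R) :
  measurableL D F -> measurableL D G -> measurableL D (fun x => F x + G x).
Proof. exact: measurable_funD. Qed.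

Lemma inv_measurableL : measurableL `]0, +oo[ (fun x => x^-1).
Proof. by apply: nhomo_measurableL => x y x0 xy; rewrite lef_pV2// posrE (lt_le_trans x0). Qed.

Lemma leb_itv (x y : R) : x <= y -> leb R `[x, y[%classic = (y - x)%:E.
Proof.
move=> xy; have -> : leb R `[x, y[%classic = lebesgue_measure `[x, y[%classic by [].
rewrite lebesgue_measure_itv/= lte_fin; case: ltP => // yx.
by have -> : y = x by [apply/eqP; rewrite eq_le yx]; rewrite subrr.
Qed.

Lemma itv_ooy_pos (t : R) : `]0, t[ `<=` (`]0, +oo[%classic : set R).
Proof. by move=> x /=; rewrite !in_itv/= andbT => /andP[]. Qed.

Lemma itv_coy_pos (x y : R) : 0 < x -> `[x, y[ `<=` (`]0, +oo[%classic : set R).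
Proof. by move=> x0 z /=; rewrite !in_itv/= andbT => /andP[/(lt_le_trans x0)]. Qed.

Lemma itv_cy_pos (x : R) : 0 < x -> `[x, +oo[ `<=` (`]0, +oo[%classic : set R).
Proof. by move=> x0 z /=; rewrite !in_itv/= !andbT => /(lt_le_trans x0). Qed.

Definition lint (F : R -> R) (D : set R) : \bar R :=
  (\int[leb R]_(x in D) (F x)%:E)%E.

Section NonnegativeIntegral.
Variable F : R -> R.
Hypothesis mF : measurableL `]0, +oo[ F.
Hypothesis F_ge0 : forall x, 0 < x -> 0 <= F x.

Lemma measurable_pos_sub (D : set R) : D `<=` `]0, +oo[ ->
  @measurable_fun _ _ (lebesgueType R) _ D (EFin \o F).
Proof.
move=> DO; apply/measurable_EFinP.
apply: (@measurable_funS _ _ (lebesgueType R) _ `]0, +oo[%classic) => //.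
exact: measurable_itvL.
Qed.

Lemma pos_sub_ge0 (D : set R) : D `<=` `]0, +oo[ ->
  forall x, D x -> (0 <= (F x)%:E)%E.
Proof.
by move=> DO x /DO/=; rewrite in_itv/= andbT => x0; rewrite lee_fin F_ge0.
Qed.

Lemma integral_pos_sub_ge0 (D : set R) : D `<=` `]0, +oo[ -> (0 <= lint F D)%E.
Proof. by move=> DO; apply: integral_ge0; exact: pos_sub_ge0. Qed.

Lemma integral_pos_subset (D E : set R) : @measurable _ (lebesgueType R) D ->
  @measurable _ (lebesgueType R) E -> D `<=` E -> E `<=` `]0, +oo[ ->
  (lint F D <= lint F E)%E.
Proof.
move=> mD mE DE EO; apply: (ge0_subset_integral _ mD mE _ _ DE); last exact: pos_sub_ge0.
exact: measurable_pos_sub.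
Qed.

Lemma integral_pos_setU (D E : set R) : @measurable _ (lebesgueType R) D ->
  @measurable _ (lebesgueType R) E -> D `<=` `]0, +oo[ -> E `<=` `]0, +oo[ ->
  [disjoint D & E] -> lint F (D `|` E) = (lint F D + lint F E)%E.
Proof.
move=> mD mE DO EO dDE.
have DEO : D `|` E `<=` `]0, +oo[ by move=> x [/DO|/EO].
apply: (ge0_integral_setU _ mD mE _ _ dDE); last exact: pos_sub_ge0.
exact: measurable_pos_sub.
Qed.

Lemma integral_itv_split (x y : R) : 0 < x -> x <= y ->
  lint F `]0, y[ = (lint F `]0%R, x[ + lint F `[x, y[)%E.
Proof.
move=> x0 xy; rewrite -integral_pos_setU.
- by rewrite -itv_bndbnd_setU// bnd_simp.
- exact: measurable_itvL.
- exact: measurable_itvL.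
- exact: itv_ooy_pos.
- exact: itv_coy_pos.
- apply/disj_setPS => z [/=]; rewrite !in_itv/= => /andP[_ zx] /andP[xz _].
  by move: (lt_le_trans zx xz); rewrite ltxx.
Qed.

Lemma integral_itv_split3 (x y z : R) : 0 < x -> x <= y -> y <= z ->
  lint F `[x, z[ = (lint F `[x, y[ + lint F `[y, z[)%E.
Proof.
move=> x0 xy yz; rewrite -integral_pos_setU.
- by rewrite -itv_bndbnd_setU// bnd_simp.
- exact: measurable_itvL.
- exact: measurable_itvL.
- exact: itv_coy_pos.
- exact/itv_coy_pos/(lt_le_trans x0).
- apply/disj_setPS => t [/=]; rewrite !in_itv/= => /andP[_ ty] /andP[yt _].
  by move: (lt_le_trans ty yt); rewrite ltxx.
Qed.

Lemma integral_itvy_split (x : R) : 0 < x ->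
  lint F `]0, +oo[ = (lint F `]0%R, x[ + lint F `[x, +oo[)%E.
Proof.
move=> x0; rewrite -integral_pos_setU.
- by rewrite -itv_bndbnd_setU// bnd_simp.
- exact: measurable_itvL.
- exact: measurable_itvL.
- exact: itv_ooy_pos.
- exact: itv_cy_pos.
- apply/disj_setPS => z [/=]; rewrite !in_itv/= => /andP[_ zx] /andP[xz _].
  by move: (lt_le_trans zx xz); rewrite ltxx.
Qed.

Lemma integral_itv_le (x y M : R) : 0 < x -> x <= y ->
  (forall z, x <= z < y -> F z <= M) -> (lint F `[x, y[ <= (M * (y - x))%:E)%E.
Proof.
move=> x0 xy FM.
have [->|xy'] := eqVneq x y.
  by rewrite subrr mulr0 set_itvco0 /lint integral_set0.
have M0 : 0 <= M.
  by apply: le_trans (FM x _); [exact: F_ge0|rewrite lexx lt_neqAle xy' xy].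
rewrite EFinM -leb_itv// -integral_cst; last exact: measurable_itvL.
apply: (@ge0_le_integral _ (lebesgueType R) R (leb R) _ (measurable_itvL `[x, y[)).
- exact/pos_sub_ge0/itv_coy_pos.
- exact/measurable_pos_sub/itv_coy_pos.
- exact: measurable_cst.
- by move=> z /=; rewrite in_itv/= lee_fin; exact: FM.
Qed.

Lemma integral_itv_ge (x y M : R) : 0 < x -> x <= y -> 0 <= M ->
  (forall z, x <= z < y -> M <= F z) -> ((M * (y - x))%:E <= lint F `[x, y[)%E.
Proof.
move=> x0 xy M0 FM; rewrite EFinM -leb_itv// -integral_cst; last exact: measurable_itvL.
apply: (@ge0_le_integral _ (lebesgueType R) R (leb R) _ (measurable_itvL `[x, y[)).
- by move=> z _; rewrite lee_fin.
- exact: measurable_cst.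
- exact/measurable_pos_sub/itv_coy_pos.
- by move=> z /=; rewrite in_itv/= lee_fin; exact: FM.
Qed.

(** Monotone convergence, in the form of a uniform bound passing to an increasing union. *)
Lemma lint_bigcup_le (G : (set R)^nat) (M : \bar R) :
  (forall n, @measurable _ (lebesgueType R) (G n)) ->
  {homo G : m n / (m <= n)%N >-> m `<=` n} -> (forall n, G n `<=` `]0, +oo[) ->
  (forall n, (lint F (G n) <= M)%E) -> (lint F (\bigcup_n G n) <= M)%E.
Proof.
move=> mG ndG GO GM.
have ndG' : nondecreasing_seq G by move=> m n mn; rewrite subsetEset; exact: ndG.
have := @ge0_nondecreasing_set_cvg_integral _ (lebesgueType R) R G (EFin \o F)
  (leb R) ndG' mG (fun n => measurable_pos_sub (GO n)) (fun n => pos_sub_ge0 (GO n)).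
move=> /(@cvg_lim _ (@ereal_hausdorff R)) limE; rewrite /lint -[leLHS]limE.
apply: lime_le; last exact: nearW.
apply: ereal_nondecreasing_is_cvgn => m n mn.
by apply: integral_pos_subset => //; exact: ndG.
Qed.

Lemma bigcup_itv_cy : `]0, +oo[%classic = \bigcup_n `[n.+1%:R^-1, +oo[%classic :> set R.
Proof.
have n0 (n : nat) : 0 < n.+1%:R^-1 :> R by rewrite invr_gt0.
apply/seteqP; split=> x /=.
  rewrite in_itv/= andbT => x0.
  have [n _ nx] := near_infty_natSinv_lt (PosNum x0).
  by exists n => //; rewrite /= in_itv/= andbT ltW// nx//=.
by move=> [n _]; rewrite /= !in_itv/= !andbT => /(lt_le_trans (n0 n)).
Qed.

Lemma bigcup_itv_oo : `]0, +oo[%classic = \bigcup_n `]0, n.+1%:R[%classic :> set R.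
Proof.
apply/seteqP; split=> x /=.
  rewrite in_itv/= andbT => x0; exists (Num.truncn x) => //.
  by rewrite /= in_itv/= x0/= truncnS_gt.
by move=> [n _]; rewrite /= !in_itv/= andbT => /andP[].
Qed.

(** If each head had mass at least [e], the tails would have mass at most the total minus [e]; but
    they increase to the whole half-line. *)
Lemma lint_small0 e : (lint F `]0%R, +oo[ < +oo)%E -> 0 < e ->
  exists2 t, 0 < t & (lint F `]0%R, t[ < e%:E)%E.
Proof.
move=> Ffin e0; apply: contrapT => nt.
have Bge t : 0 < t -> (e%:E <= lint F `]0%R, t[)%E.
  by move=> t0; rewrite leNgt; apply/negP => te; apply: nt; exists t.
have I0 : (0 <= lint F `]0%R, +oo[)%E by apply: integral_pos_sub_ge0.
have n0 (n : nat) : 0 < n.+1%:R^-1 :> R by rewrite invr_gt0.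
suff : (lint F `]0%R, +oo[ <= lint F `]0%R, +oo[ - e%:E)%E.
  move: Ffin I0; case: (lint F `]0%R, +oo[) => // r _ _.
  by rewrite -EFinB lee_fin lerDl oppr_ge0 leNgt e0.
rewrite {1}bigcup_itv_cy; apply: lint_bigcup_le.
- by move=> n; exact: measurable_itvL.
- move=> m n mn x; rewrite /= !in_itv/= !andbT => /(le_trans _); apply.
  by rewrite lef_pV2 ?posrE// ler_nat.
- by move=> n; exact: itv_cy_pos.
- move=> n; rewrite leeBrDr// addeC (integral_itvy_split (n0 n)).
  by apply: leeD => //; exact: Bge.
Qed.

(** The argument of [lint_small0] with heads and tails exchanged. *)
Lemma lint_smally e : (lint F `]0%R, +oo[ < +oo)%E -> 0 < e ->
  exists2 t, 0 < t & (lint F `[t, +oo[ < e%:E)%E.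
Proof.
move=> Ffin e0; apply: contrapT => nt.
have Bge t : 0 < t -> (e%:E <= lint F `[t, +oo[)%E.
  by move=> t0; rewrite leNgt; apply/negP => te; apply: nt; exists t.
have I0 : (0 <= lint F `]0%R, +oo[)%E by apply: integral_pos_sub_ge0.
have n0 (n : nat) : 0 < n.+1%:R :> R by [].
suff : (lint F `]0%R, +oo[ <= lint F `]0%R, +oo[ - e%:E)%E.
  move: Ffin I0; case: (lint F `]0%R, +oo[) => // r _ _.
  by rewrite -EFinB lee_fin lerDl oppr_ge0 leNgt e0.
rewrite {1}bigcup_itv_oo; apply: lint_bigcup_le.
- by move=> n; exact: measurable_itvL.
- move=> m n mn x; rewrite /= !in_itv/= => /andP[-> /=] /lt_le_trans; apply.
  by rewrite ler_nat.
- by move=> n; exact: itv_ooy_pos.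
- move=> n; rewrite leeBrDr// (integral_itvy_split (n0 n)).
  by apply: leeD => //; exact: Bge.
Qed.

End NonnegativeIntegral.

Lemma le_integral_pos (F G : R -> R) (D : set R) :
  measurableL `]0, +oo[ F -> measurableL `]0, +oo[ G ->
  @measurable _ (lebesgueType R) D -> D `<=` `]0, +oo[ ->
  (forall x, D x -> 0 <= F x <= G x) ->
  (lint F D <= lint G D)%E.
Proof.
move=> mF mG mD DO FG; apply: (@ge0_le_integral _ (lebesgueType R) R (leb R) D mD).
- by move=> x /FG /andP[]; rewrite lee_fin.
- exact: measurable_pos_sub.
- exact: measurable_pos_sub.
- by move=> x /FG /andP[]; rewrite lee_fin.
Qed.

Lemma integral_posZl (F : R -> R) k (D : set R) :
  measurableL `]0, +oo[ F -> (forall x, 0 < x -> 0 <= F x) -> 0 <= k ->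
  @measurable _ (lebesgueType R) D -> D `<=` `]0, +oo[ ->
  lint (fun x => k * F x) D = (k%:E * lint F D)%E.
Proof.
move=> mF F0 k0 mD DO; rewrite /lint; under eq_integral do rewrite EFinM.
apply: (@ge0_integralZl _ (lebesgueType R) R (leb R) D mD); last by rewrite lee_fin.
  exact: measurable_pos_sub.
exact: pos_sub_ge0.
Qed.

Lemma lintD (F G : R -> R) (D : set R) :
  measurableL `]0, +oo[ F -> (forall x, 0 < x -> 0 <= F x) ->
  measurableL `]0, +oo[ G -> (forall x, 0 < x -> 0 <= G x) ->
  @measurable _ (lebesgueType R) D -> D `<=` `]0, +oo[ ->
  lint (fun x => F x + G x) D = (lint F D + lint G D)%E.
Proof.
move=> mF F0 mG G0 mD DO; rewrite /lint; under eq_integral do rewrite EFinD.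
apply: (@ge0_integralD _ (lebesgueType R) R (leb R) D mD).
- exact: pos_sub_ge0.
- exact: measurable_pos_sub.
- exact: pos_sub_ge0.
- exact: measurable_pos_sub.
Qed.

(** [t ^ (- p) <= C (t ^ (- p) - (2 t) ^ (- p))], and the right-hand side
    telescopes over dyadic intervals. *)
Lemma lint_power_tail (p : R) : 0 < p -> exists2 C, 0 < C & forall t, 0 < t ->
  (lint (fun x => x `^ (- p) / x)%R `[t, +oo[ <= (C * t `^ (- p))%:E)%E.
Proof.
move=> p0; have p21 : 2 `^ (- p) < 1 :> R.
  rewrite powRN invf_lt1 ?powR_gt0//.
  have := @gt0_ltr_powR R p p0 1 2; rewrite !nnegrE (_ : 1 `^ p = 1) ?powR1//.
  by apply => //; rewrite ltr1n.
pose C : R := (1 - 2 `^ (- p))^-1; have C0 : 0 < C by rewrite invr_gt0 subr_gt0.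
exists C => // t t0; pose f (x : R) := x `^ (- p) / x.
have mf : measurableL `]0, +oo[ f.
  apply: measurable_funM; last exact: inv_measurableL.
  by apply: nhomo_measurableL => x y x0 xy; rewrite !powRN lef_pV2 ?posrE
    ?powR_gt0 ?(lt_le_trans x0 xy)// ler_powRl ?(ltW p0) ?(ltW x0).
have f0 x : 0 < x -> 0 <= f x.
  by move=> x0; rewrite /f divr_ge0 ?powR_ge0 ?(ltW x0).
have t2 n : 0 < 2 ^+ n * t by rewrite mulr_gt0// exprn_gt0.
have t22 n : 2 ^+ n * t <= 2 ^+ n.+1 * t.
  by rewrite ler_pM2r// exprS ler_peMl ?ler1n// exprn_ge0.
have tt2 n : t <= 2 ^+ n * t by rewrite ler_peMl ?(ltW t0)// exprn_ege1 ?ler1n.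
have step n : (lint f `[t, (2 ^+ n * t)%R[ <=
    (C * (t `^ (- p) - (2 ^+ n * t) `^ (- p)))%:E)%E.
  elim: n => [|n ih].
    by rewrite expr0 mul1r subrr mulr0 set_itvco0 /lint integral_set0.
  rewrite (integral_itv_split3 mf f0 t0 (tt2 n) (t22 n)).
  set u := (2 ^+ n * t)%R in ih *.
  have u0 : 0 < u := t2 n.
  have -> : 2 ^+ n.+1 * t = 2 * u by rewrite exprS mulrA.
  have uu : u <= 2 * u by rewrite ler_peMl ?ler1n ?(ltW u0).
  apply: le_trans (leeD ih (integral_itv_le mf f0 u0 uu (M := f u) _)) _.
    move=> z /andP[uz _]; have z0 := lt_le_trans u0 uz.
    rewrite /f ler_pM ?powR_ge0 ?invr_ge0 ?(ltW z0)//.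
      by rewrite !powRN lef_pV2 ?posrE ?powR_gt0// ler_powRl ?(ltW p0) ?(ltW u0).
    by rewrite lef_pV2.
  rewrite -EFinD lee_fin (_ : 2 * u - u = u); last by ring.
  rewrite /f divfK ?gt_eqF// (powRM _ (ler0n _ 2) (ltW u0)).
  have CY : C * (1 - 2 `^ (- p)) = 1 by rewrite mulVf// subr_eq0 gt_eqF.
  rewrite (_ : C * (_ - _ * _) = C * (t `^ (- p) - u `^ (- p)) +
    C * (1 - 2 `^ (- p)) * u `^ (- p)); last by ring.
  by rewrite CY mul1r.
have -> : `[t, +oo[%classic = \bigcup_n `[t, 2 ^+ n * t[%classic :> set R.
  apply/seteqP; split=> x /=.
    rewrite in_itv/= andbT => tx.
    exists (Num.truncn (x / t)).+1 => //=; rewrite in_itv/= tx/= -ltr_pdivrMr//.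
    apply: lt_trans (truncnS_gt _) _.
    by rewrite -natrX ltr_nat ltn_expl.
  by move=> [n _]; rewrite /= !in_itv/= andbT => /andP[].
apply: (lint_bigcup_le mf f0).
- by move=> n; exact: measurable_itvL.
- move=> m n mn x; rewrite /= !in_itv/= => /andP[-> /=] /lt_le_trans; apply.
  by rewrite ler_pM2r// ler_weXn2l ?ler1n.
- by move=> n; exact: itv_coy_pos.
- move=> n; apply: le_trans (step n) _.
  by rewrite lee_fin ler_pM2l// gerBl powR_ge0.
Qed.

End LebesgueMeasurable.

(** * Slowly varying weights *)

Section SlowVariation.
Context (R : realType) (b : R -> R).
Hypothesis b_sv : slowly_varying b.

Lemma sv_gt0 t : 0 < t -> 0 < b t.
Proof. by case: b_sv => + _ _ _; apply. Qed.

(** The auxiliary monotone function of the definition is eliminated: up to a constant, [t^e b(t)] is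
    itself increasing. *)
Lemma sv_incr e : 0 < e -> exists2 C, 0 < C &
  forall x y, 0 < x -> x <= y -> x `^ e * b x <= C * (y `^ e * b y).
Proof.
case: b_sv => _ _ + _ => /[apply] -[g [gm [c [C [c0 C0 gE]]]]].
exists (C / c); first exact: divr_gt0.
move=> x y x0 xy; have y0 := lt_le_trans x0 xy.
have /andP[_ +] := gE x x0; have /andP[+ _] := gE y y0.
rewrite -ler_pdivlMl// => gy bx; apply: le_trans bx _.
rewrite -mulrA ler_pM2l//; exact: le_trans (gm _ _ x0 xy) gy.
Qed.

Lemma sv_decr e : 0 < e -> exists2 C, 0 < C &
  forall x y, 0 < x -> x <= y -> y `^ (- e) * b y <= C * (x `^ (- e) * b x).
Proof.
case: b_sv => _ _ _ + => /[apply] -[g [gm [c [C [c0 C0 gE]]]]].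
exists (C / c); first exact: divr_gt0.
move=> x y x0 xy; have y0 := lt_le_trans x0 xy.
have /andP[_ +] := gE y y0; have /andP[+ _] := gE x x0.
rewrite -ler_pdivlMl// => gx b_y; apply: le_trans b_y _.
rewrite -mulrA ler_pM2l//; exact: le_trans (gm _ _ x0 xy) gx.
Qed.

(** The exponents 1 and -1 suffice, since these powers vary by a factor at most 2 between [x] and
    [2 * x]. *)
Lemma sv_doubling : exists2 c, 1 <= c &
  forall x y, 0 < x -> x <= y -> y <= 2 * x -> b y <= c * b x /\ b x <= c * b y.
Proof.
have [C C0 bC] := sv_incr ltr01; have [C' C'0 bC'] := sv_decr ltr01.
exists (Num.max 1 (Num.max (2 * C) (2 * C'))); first by rewrite le_max lexx.
move=> x y x0 xy yx; have y0 := lt_le_trans x0 xy.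
have [bx by_] := (sv_gt0 x0, sv_gt0 y0).
have yx' : y / x <= 2 by rewrite ler_pdivrMr.
have C1 : 0 < C * b y by rewrite mulr_gt0.
have C1' : 0 < C' * b x by rewrite mulr_gt0.
split.
  have := bC' x y x0 xy; rewrite (powR_inv1 (ltW x0)) (powR_inv1 (ltW y0)) ler_pdivrMl// => h.
  apply: le_trans (_ : 2 * C' * b x <= _); last first.
    by rewrite ler_pM2r// !le_max lexx !orbT.
  apply: le_trans h _; rewrite -mulrA.
  by rewrite (_ : y * _ = (y / x) * (C' * b x)) ?ler_pM2r//; ring.
have := bC x y x0 xy; rewrite (powRr1 (ltW x0)) (powRr1 (ltW y0)) -ler_pdivlMl// => h.
apply: le_trans (_ : 2 * C * b y <= _); last first.
  by rewrite ler_pM2r// !le_max lexx !orbT.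
apply: le_trans h _; rewrite -mulrA.
by rewrite (_ : x^-1 * _ = (y / x) * (C * b y)) ?ler_pM2r//; ring.
Qed.

End SlowVariation.

(** * The integral of [b^q] and its dyadic increments *)

Section WeightIntegrals.
Context (R : realType) (q : R) (b : R -> R).
Hypothesis q_gt0 : 0 < q.
Hypothesis b_sv : slowly_varying b.
Hypothesis b_int : forall t : R, 0 < t -> (int_bq q b `]0%R, t[ < +oo)%E.
Local Notation measurableL := (@measurable_fun _ _ (lebesgueType R) (measurableTypeR R)).

Local Notation W := (fun x => b x `^ q / x).

Lemma measurable_weight : measurableL `]0, +oo[ W.
Proof.
apply: measurable_funM; last exact: inv_measurableL.
by apply: powR_measurableL; case: b_sv.
Qed.

Lemma weight_ge0 x : 0 < x -> 0 <= W x.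
Proof. by move=> x0; rewrite divr_ge0 ?powR_ge0 ?ltW. Qed.

(** This is [B^q]. Unlike [B] it is additive over intervals, so estimates are made for it and roots
    are taken last. *)
Definition BQ (t : R) : R := fine (int_bq q b `]0, t[).

Lemma BQE t : 0 < t -> lint W `]0, t[ = (BQ t)%:E.
Proof.
move=> t0; rewrite fineK// ge0_fin_numE ?b_int//.
exact: (integral_pos_sub_ge0 weight_ge0 (@itv_ooy_pos _ t)).
Qed.

Lemma BQ_ge0 t : 0 <= BQ t.
Proof.
apply: fine_ge0.
exact: (integral_pos_sub_ge0 weight_ge0 (@itv_ooy_pos _ t)).
Qed.

Lemma lint_weight x y : 0 < x -> x <= y -> lint W `[x, y[ = (BQ y - BQ x)%:E.
Proof.
move=> x0 xy; have := integral_itv_split measurable_weight weight_ge0 x0 xy.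
rewrite !BQE//; last exact: lt_le_trans xy.
have := integral_pos_sub_ge0 weight_ge0 (@itv_coy_pos _ x y x0).
by case: (lint _ _) => //= r _; rewrite -EFinD => -[->]; rewrite addrAC subrr add0r.
Qed.

Lemma BQ_homo x y : 0 < x -> x <= y -> BQ x <= BQ y.
Proof.
move=> x0 xy; rewrite -subr_ge0 -lee_fin -lint_weight//.
exact: (integral_pos_sub_ge0 weight_ge0 (@itv_coy_pos _ x y x0)).
Qed.

(** On [[x, 2 x[], an interval of length [x], the integrand is comparable to [b(x)^q / x] by
    [sv_doubling]; the factor 2 in the constant comes from [1 / z]. *)
Lemma BQ_dyadic : exists2 c, 1 <= c & forall x, 0 < x ->
  b x `^ q <= c * (BQ (2 * x) - BQ x) /\ BQ (2 * x) - BQ x <= c * b x `^ q.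
Proof.
have [d d1 bd] := sv_doubling b_sv; have d0 : 0 < d := lt_le_trans ltr01 d1.
have dq0 : 0 < d `^ q by exact: powR_gt0.
have dq1 : 1 <= d `^ q.
  by apply: powR_ge1 => //; exact: ltW.
exists (2 * d `^ q); first by rewrite (le_trans dq1)// ler_peMl ?ler1n// ltW.
move=> x x0; have x2 : x <= 2 * x by rewrite ler_peMl ?ler1n// ltW.
have x2' : 2 * x - x = x by ring.
have bdz z : x <= z < 2 * x -> b z <= d * b x /\ b x <= d * b z.
  by move=> /andP[xz z2]; apply: bd => //; exact: ltW.
have pz z : x <= z < 2 * x -> 0 < z by move=> /andP[xz _]; exact: lt_le_trans xz.
have bx0 := sv_gt0 b_sv x0.
split.
  rewrite -mulrA -ler_pdivrMl// -ler_pdivrMl//.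
  rewrite -lee_fin -lint_weight//.
  have h : forall z, x <= z < 2 * x -> 2^-1 * ((d `^ q)^-1 * b x `^ q) / x <= W z.
    move=> z xz; have z0 := pz _ xz; have [_ bxz] := bdz _ xz.
    have {}bxz : (d `^ q)^-1 * b x `^ q <= b z `^ q.
      rewrite ler_pdivrMl// -powRM ?(ltW d0) ?(ltW (sv_gt0 b_sv z0))//.
      by apply: ler_powRl => //; rewrite ltW// sv_gt0.
    apply: le_trans (_ : b z `^ q / (2 * x) <= _).
      rewrite (_ : _ / x = (d `^ q)^-1 * b x `^ q / (2 * x)); last by rewrite invfM; ring.
      by rewrite ler_wpM2r// invr_ge0 mulr_ge0 ?(ltW x0).
    rewrite ler_wpM2l ?powR_ge0// lef_pV2 ?posrE ?mulr_gt0//.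
    by case/andP: xz => _ /ltW.
  apply: le_trans (integral_itv_ge measurable_weight x0 x2 _ h).
    by rewrite x2' divfK ?gt_eqF// mulrCA.
  by rewrite divr_ge0 ?(ltW x0) ?mulr_ge0 ?invr_ge0 ?powR_ge0.
rewrite -lee_fin -lint_weight//.
apply: le_trans (integral_itv_le measurable_weight weight_ge0 x0 x2
  (M := d `^ q * b x `^ q / x) _) _.
  move=> z xz; have z0 := pz _ xz; have [bzx _] := bdz _ xz.
  rewrite ler_pM ?invr_ge0 ?powR_ge0 ?(ltW z0)//.
    rewrite -powRM ?(ltW d0) ?(ltW bx0)//.
    by apply: ler_powRl => //; rewrite ltW// sv_gt0.
  by rewrite lef_pV2 ?posrE//; case/andP: xz.
rewrite x2' divfK ?gt_eqF// lee_fin -mulrA ler_peMl ?ler1n//.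
by rewrite mulr_ge0 ?powR_ge0.
Qed.

(** [BQ_dyadic] with the weight sampled at the right end of the interval. The right end is the one
    needed for sums of the nonincreasing [K(t, f) / t] and for [B(t) - B(t/2)] against [a(t)]. *)
Lemma BQ_ge_weight : exists2 c, 1 <= c & forall x, 0 < x ->
  b x `^ q <= c * (BQ x - BQ (x / 2)) /\ BQ x - BQ (x / 2) <= c * b x `^ q.
Proof.
have [d d1 bd] := sv_doubling b_sv; have d0 : 0 < d := lt_le_trans ltr01 d1.
have [c c1 bc] := BQ_dyadic; have c0 : 0 < c := lt_le_trans ltr01 c1.
have dq0 : 0 < d `^ q by exact: powR_gt0.
have dq1 : 1 <= d `^ q.
  by apply: powR_ge1 => //; exact: ltW.
exists (d `^ q * c); first by rewrite (le_trans dq1)// ler_peMr ?(ltW dq0).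
move=> x x0; have y0 : 0 < x / 2 by rewrite divr_gt0.
have yx : x = 2 * (x / 2) by rewrite mulrC divfK.
have [h1 h2] := bc _ y0; rewrite -yx in h1 h2.
have le_yx : x / 2 <= x by rewrite [leRHS]yx ler_peMl ?ler1n// ltW.
have le_xy : x <= 2 * (x / 2) by rewrite -yx.
have [g1 g2] := bd (x / 2) x y0 le_yx le_xy.
have [bx0 by0] := (sv_gt0 b_sv x0, sv_gt0 b_sv y0).
split.
  rewrite -mulrA; apply: le_trans (_ : d `^ q * b (x / 2) `^ q <= _).
    rewrite -powRM ?(ltW d0) ?(ltW by0)//.
    by apply: ler_powRl => //; exact: ltW.
  by rewrite ler_pM2l.
apply: le_trans h2 _; rewrite [d `^ q * c]mulrC -mulrA ler_pM2l//.
rewrite -powRM ?(ltW d0) ?(ltW bx0)//.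
by apply: ler_powRl => //; exact: ltW.
Qed.

Lemma BQ_gt0 x : 0 < x -> 0 < BQ x.
Proof.
move=> x0; have [c c1 /(_ _ x0)[h _]] := BQ_ge_weight.
have c0 : 0 < c := lt_le_trans ltr01 c1.
have : 0 < c * (BQ x - BQ (x / 2)).
  by apply: lt_le_trans h; rewrite powR_gt0// sv_gt0.
by rewrite pmulr_rgt0// subr_gt0; apply: le_lt_trans; exact: BQ_ge0.
Qed.

Lemma weight_le_BQ : exists2 c, 1 <= c & forall x, 0 < x -> b x `^ q <= c * BQ x.
Proof.
have [c c1 bc] := BQ_ge_weight; have c0 : 0 < c := lt_le_trans ltr01 c1.
exists c => // x x0; have [h _] := bc _ x0; apply: le_trans h _.
by rewrite ler_pM2l// gerBl BQ_ge0.
Qed.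

Lemma BQ_doubling : exists2 c, 1 <= c & forall x, 0 < x -> BQ (2 * x) <= c * BQ x.
Proof.
have [c c1 bc] := BQ_dyadic; have c0 : 0 < c := lt_le_trans ltr01 c1.
have [d d1 bd] := weight_le_BQ; have d0 : 0 < d := lt_le_trans ltr01 d1.
exists (1 + c * d); first by rewrite lerDl mulr_ge0// ltW.
move=> x x0; have [_ h] := bc _ x0; rewrite [leRHS]mulrDl mul1r -lerBlDl.
by apply: le_trans h _; rewrite -mulrA ler_pM2l// bd.
Qed.

Lemma BQ_small e : 0 < e -> exists2 t, 0 < t & BQ t < e.
Proof.
move=> e0; apply: contrapT => nt.
have Bge t : 0 < t -> e <= BQ t.
  by move=> t0; rewrite leNgt; apply/negP => te; apply: nt; exists t.
suff : (BQ 1 <= BQ 1 - e) by rewrite lerDl oppr_ge0 leNgt e0.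
pose G (n : nat) : set R := `[n.+1%:R^-1, 1[%classic.
have n0 (n : nat) : 0 < n.+1%:R^-1 :> R by rewrite invr_gt0.
have n1 (n : nat) : n.+1%:R^-1 <= 1 :> R by rewrite invf_le1// ler1n.
rewrite -lee_fin -BQE//.
have -> : `]0, 1[%classic = \bigcup_n G n :> set R.
  apply/seteqP; split=> x /=.
    rewrite in_itv/= => /andP[x0 x1].
    have [n _ nx] := near_infty_natSinv_lt (PosNum x0).
    by exists n => //; rewrite /G/= in_itv/= x1 andbT ltW// nx//=.
  by move=> [n _]; rewrite /G/= !in_itv/= => /andP[/(lt_le_trans (n0 n)) -> ->].
apply: (lint_bigcup_le measurable_weight weight_ge0).
- by move=> n; exact: measurable_itvL.
- move=> m n mn x; rewrite /G/= !in_itv/= => /andP[mx ->]; rewrite andbT.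
  by apply: le_trans mx; rewrite lef_pV2 ?posrE// ler_nat.
- by move=> n; exact: itv_coy_pos.
- by move=> n; rewrite lint_weight// lee_fin lerD2l lerN2 Bge.
Qed.

Lemma BQ_large : int_bq q b `]0, +oo[ = +oo%E -> forall M, exists2 t, 0 < t & M < BQ t.
Proof.
move=> byy M; apply: contrapT => nt.
have Bge t : 0 < t -> BQ t <= M.
  by move=> t0; rewrite leNgt; apply/negP => te; apply: nt; exists t.
suff : (lint W `]0%R, +oo[ <= M%:E)%E by rewrite [lint _ _]byy leye_eq.
rewrite (bigcup_itv_oo R); apply: (lint_bigcup_le measurable_weight weight_ge0).
- by move=> n; exact: measurable_itvL.
- move=> m n mn x; rewrite /= !in_itv/= => /andP[-> /=] /lt_le_trans; apply.
  by rewrite ler_nat.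
- by move=> n; exact: itv_ooy_pos.
- by move=> n; rewrite BQE// lee_fin Bge.
Qed.

End WeightIntegrals.

Section WeightBounds.
Context (R : realType) (q : R) (b : R -> R).
Hypothesis q_gt0 : 0 < q.
Hypothesis b_sv : slowly_varying b.
Hypothesis b_int : forall t : R, 0 < t -> (int_bq q b `]0%R, t[ < +oo)%E.
Local Notation measurableL := (@measurable_fun _ _ (lebesgueType R) (measurableTypeR R)).
Local Notation W := (fun x => b x `^ q / x).
Local Notation BQ := (BQ q b).

Lemma half_gt0 (x : R) : 0 < x -> 0 < x / 2.
Proof. by move=> x0; rewrite divr_gt0. Qed.

(** Only half of the exponent [q] is spent on monotonicity, so that in [t^(-q)] another factor
    [t^(-q/2)] remains to make tails integrable. *)
Lemma weight_decr : exists2 C, 0 < C & forall x y, 0 < x -> x <= y ->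
  y `^ (- (q / 2)) * b y `^ q <= C * (x `^ (- (q / 2)) * b x `^ q).
Proof.
have h0 : 0 < 2^-1 :> R by rewrite invr_gt0.
have [C C0 bC] := sv_decr b_sv h0.
exists (C `^ q); first exact: powR_gt0.
move=> x y x0 xy; have y0 := lt_le_trans x0 xy.
have [bx0 by0] := (sv_gt0 b_sv x0, sv_gt0 b_sv y0).
have e z : 0 < b z -> z `^ (- (q / 2)) * b z `^ q = (z `^ (- 2^-1) * b z) `^ q.
  by move=> bz; rewrite (powRM _ (powR_ge0 _ _) (ltW bz)) -powRrM mulNr [q / 2]mulrC.
rewrite (e x)// (e y)// -(powRM _ (ltW C0)); last first.
  by rewrite mulr_ge0 ?powR_ge0// ltW.
apply: ler_powRl; [exact: ltW| |exact: bC].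
by rewrite mulr_ge0 ?powR_ge0 ?(ltW by0).
Qed.

(** After a root is taken, [B(2^n)] is at most of order [2^(n/2)]. This is what makes [2^j B(2^-j)]
    vanish as [j] tends to [-oo]. *)
Lemma BQ_growth : exists2 M, 0 < M & forall n : nat,
  BQ (2 ^+ n) <= M * (2 ^+ n) `^ (q / 2).
Proof.
have [C C0 bC] := weight_decr.
have [d d1 bd] := BQ_dyadic q_gt0 b_sv b_int; have d0 := lt_le_trans ltr01 d1.
have b10 : 0 < b 1 `^ q by rewrite powR_gt0// sv_gt0.
have r1 : 1 < 2 `^ (q / 2) :> R.
  have := @gt0_ltr_powR R _ (half_gt0 q_gt0) 1 2.
  rewrite !nnegrE (_ : 1 `^ (q / 2) = 1) ?powR1//.
  by apply => //; rewrite ltr1n.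
pose r : R := 2 `^ (q / 2); have r0 : 0 < r - 1 by rewrite subr_gt0.
(* The induction step adds [d C b(1)^q u^(q/2)] and has [M (r - 1) u^(q/2)] available; the first
   summand settles the base case. *)
pose M := BQ 1 + d * (C * b 1 `^ q) / (r - 1).
have M1 : BQ 1 <= M by rewrite lerDl !mulr_ge0// ltW// invr_gt0.
have M2 : d * (C * b 1 `^ q) <= M * (r - 1).
  by rewrite mulrDl divfK ?gt_eqF// lerDr mulr_ge0 ?BQ_ge0 ?(ltW r0).
have M0 : 0 < M by apply: lt_le_trans M1; exact: BQ_gt0.
exists M => //; elim=> [|n ih].
  by rewrite expr0 (_ : 1 `^ _ = 1) ?powR1// mulr1.
have u0 : 0 < 2 ^+ n :> R by rewrite exprn_gt0.
have u1 : 1 <= 2 ^+ n :> R by rewrite exprn_ege1// ler1n.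
rewrite exprS; set u : R := 2 ^+ n in ih u0 u1 *.
have [_ h] := bd _ u0; move: h; rewrite lerBlDr => /le_trans; apply.
rewrite (powRM _ (ler0n _ 2) (ltW u0)) -/r.
have := bC 1 u ltr01 u1; rewrite (_ : 1 `^ _ = 1) ?powR1// mul1r powRN.
rewrite ler_pdivrMl ?powR_gt0// => h.
have {}h : d * b u `^ q <= M * (r - 1) * u `^ (q / 2).
  apply: le_trans (_ : d * (C * b 1 `^ q) * u `^ (q / 2) <= _).
    by rewrite -mulrA ler_pM2l// mulrC.
  by rewrite ler_wpM2r ?powR_ge0.
apply: le_trans (lerD h ih) _.
by rewrite le_eqVlt; apply/orP; left; apply/eqP; ring.
Qed.

(** Beyond [t], where [K(x, f)] will only be known to be bounded, the integral is thereby no larger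
    than the head []0, t[] allows. *)
Lemma weight_tail : exists2 C, 0 < C & forall t, 0 < t ->
  (lint (fun x => x `^ (- q) * W x)%R `[t, +oo[ <= (C * (t `^ (- q) * BQ t))%:E)%E.
Proof.
have [C C0 bC] := weight_decr.
have [d d1 bd] := weight_le_BQ q_gt0 b_sv b_int; have d0 := lt_le_trans ltr01 d1.
have [c c0 tail] := lint_power_tail (half_gt0 q_gt0).
have split_q x : x `^ (- q) = x `^ (- (q / 2)) * x `^ (- (q / 2)).
  have q2 : - q = - (q / 2) + - (q / 2) by rewrite -opprD -splitr.
  by rewrite {1}q2 powRD// -q2 oppr_eq0 gt_eqF.
exists (C * c * d); first by rewrite !mulr_gt0.
move=> t t0; pose k := C * (t `^ (- (q / 2)) * b t `^ q).
have k0 : 0 <= k by rewrite !mulr_ge0 ?powR_ge0 ?(ltW C0).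
pose g (x : R) := x `^ (- (q / 2)) / x.
have nh p : 0 < p -> measurableL `]0, +oo[ (fun x => x `^ (- p)).
  move=> p0; apply: nhomo_measurableL => x y x0 xy.
  by rewrite !powRN lef_pV2 ?posrE ?powR_gt0 ?(lt_le_trans x0 xy)//
    ler_powRl ?(ltW p0) ?(ltW x0).
have mg : measurableL `]0, +oo[ g.
  by apply: measurable_funM; [exact/nh/half_gt0|exact: inv_measurableL].
have g0 x : 0 < x -> 0 <= g x.
  by move=> x0; rewrite divr_ge0 ?powR_ge0 ?(ltW x0).
apply: le_trans (@le_integral_pos _ _ (fun x => k * g x) _ _ _ _ _ _) _.
- by apply: measurable_funM; [exact: nh|exact: measurable_weight].
- by apply: measurable_funM.
- exact: measurable_itvL.
- exact: itv_cy_pos.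
- move=> x /=; rewrite in_itv/= andbT => tx; have x0 := lt_le_trans t0 tx.
  rewrite mulr_ge0 ?powR_ge0 ?weight_ge0//= /g split_q.
  have := bC t x t0 tx; rewrite -/k => h.
  rewrite (_ : _ * _ * _ = x `^ (- (q / 2)) * b x `^ q * (x `^ (- (q / 2)) / x)).
    by rewrite ler_wpM2r// divr_ge0 ?powR_ge0 ?(ltW x0).
  by ring.
rewrite integral_posZl//; [|exact: measurable_itvL|exact: itv_cy_pos].
apply: le_trans (lee_wpmul2l _ (tail _ t0)) _; first by rewrite lee_fin.
rewrite -EFinM lee_fin /k split_q.
set X := t `^ _; have X0 : 0 <= X by exact: powR_ge0.
rewrite (_ : _ * _ * (c * X) = C * c * (X * X) * b t `^ q); last by ring.
rewrite (_ : C * c * d * _ = C * c * (X * X) * (d * BQ t)); last by ring.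
by rewrite ler_wpM2l ?bd// !mulr_ge0 ?(ltW C0) ?(ltW c0).
Qed.

End WeightBounds.

(** * The K-space with weight b *)

Section KSpace.
Context (R : realType) (s : scalars).
Local Notation K := (scalar_field R s).
Context (V : lmodType K) (X0 X1 : qspace R V).
Hypothesis sX0 : seminormed X0.
Hypothesis sX1 : seminormed X1.
Context (q : R) (b : R -> R).
Hypothesis q_gt0 : 0 < q.
Hypothesis b_sv : slowly_varying b.
Hypothesis b_int : forall t : R, 0 < t -> (int_bq q b `]0%R, t[ < +oo)%E.
Local Notation measurableL := (@measurable_fun _ _ (lebesgueType R) (measurableTypeR R)).
Local Notation W := (fun x => b x `^ q / x).
Local Notation BQ := (BQ q b).
Local Notation Kf := (Kfun X0 X1).
Local Notation D := (carrier X0 `&` carrier X1).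
Local Notation E := (K1_space X0 X1 q%:E b).

Let Kge0 t f : 0 < t -> sum_set X0 X1 f -> 0 <= Kf t f.
Proof.
by move=> t0; apply: Kfun_ge0; [exact: X0_ge0|exact: X1_ge0|exact: ltW].
Qed.

Lemma Kdiv_nincr t u f : 0 < t -> t <= u -> sum_set X0 X1 f ->
  Kf u f / u <= Kf t f / t.
Proof.
move=> t0 tu ff; have u0 := lt_le_trans t0 tu.
rewrite ler_pdivrMr//; apply: le_trans (Kfun_scale _ _ t0 tu ff) _.
- exact: X0_ge0.
- exact: X1_ge0.
- by rewrite [leLHS](_ : _ = Kf t f / t * u)//; ring.
Qed.

(** The [q]-th power of the quasi-norm, arranged as the integral of the nonincreasing
    [(K(t, f) / t)^q] against the density behind [BQ]. *)
Definition Kint f : \bar R := lint (fun t => (Kf t f / t) `^ q * W t) `]0, +oo[.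

Lemma measurable_Kdiv f : sum_set X0 X1 f -> measurableL `]0, +oo[ (fun t => Kf t f / t).
Proof. by move=> ff; apply: nhomo_measurableL => x y x0 xy; exact: Kdiv_nincr. Qed.

Lemma measurable_Kint f : sum_set X0 X1 f ->
  measurableL `]0, +oo[ (fun t => (Kf t f / t) `^ q * W t).
Proof.
move=> ff; apply: measurable_funM; last exact: measurable_weight.
by apply: powR_measurableL; exact: measurable_Kdiv.
Qed.

Lemma Kint_integrand_ge0 f x : 0 < x -> 0 <= (Kf x f / x) `^ q * W x.
Proof. by move=> x0; rewrite mulr_ge0 ?powR_ge0 ?weight_ge0. Qed.

Lemma Kint_ge0 f : (0 <= Kint f)%E.
Proof. by apply: (integral_pos_sub_ge0 (Kint_integrand_ge0 f)). Qed.

Lemma K1_normE f : sum_set X0 X1 f -> K1_norm X0 X1 q%:E b f = (Kint f `^ q^-1)%E.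
Proof.
move=> ff; rewrite /K1_norm /Lr_norm unlock; congr (_ `^ _)%E.
rewrite /Kint /lint [RHS]integral_mkcond; apply: eq_integral => x _.
rewrite /= !patchE; case: ifPn => [|_]; last by rewrite abse0 poweR0r ?gt_eqF.
rewrite inE/= in_itv/= andbT => x0; congr (_%:E).
have K0 := Kge0 x0 ff; have bx := sv_gt0 b_sv x0.
rewrite inver gt_eqF//= ger0_norm; last first.
  by rewrite !mulr_ge0 ?powR_ge0 ?(ltW bx).
have xq : (x `^ (- 1 - q^-1)) `^ q = x^-1 `^ q / x.
  rewrite -powRrM mulrBl mulVf ?gt_eqF// mulN1r powRB; last first.
    by apply/implyP => _; rewrite gt_eqF.
  by rewrite powRr1 ?(ltW x0)// -(powR_inv1 (ltW x0)) -[in RHS]powRrM mulN1r.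
have b0 := ltW bx; have x0' := ltW x0; have xV : 0 <= x^-1 by rewrite invr_ge0.
rewrite (powRM _ (mulr_ge0 (powR_ge0 _ _) b0) K0) (powRM _ (powR_ge0 _ _) b0).
by rewrite xq (powRM _ K0 xV); ring.
Qed.

Lemma K1_spaceP f : E f <-> sum_set X0 X1 f /\ (Kint f < +oo)%E.
Proof.
split=> [[ff]|[ff fi]]; last by split=> //; rewrite K1_normE// poweR_lty.
by rewrite K1_normE// => /lty_poweRy fi; split=> //; apply: fi; rewrite invr_neq0 ?gt_eqF.
Qed.

Lemma KintE f : E f -> Kint f = (qnorm E f `^ q)%:E.
Proof.
move=> /K1_spaceP[ff]; have := Kint_ge0 f; rewrite /= K1_normE//.
case: (Kint f) => // r; rewrite lee_fin => r0 _.
by rewrite poweR_EFin /= -powRrM mulVf ?gt_eqF// powRr1.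
Qed.

Lemma K1_qnorm_ge0 f : sum_set X0 X1 f -> 0 <= qnorm E f.
Proof. by move=> ff; rewrite /= K1_normE//; apply/fine_ge0/poweR_ge0. Qed.

Lemma K1_qnorm_le f C : sum_set X0 X1 f -> 0 <= C -> (Kint f <= (C `^ q)%:E)%E ->
  E f /\ qnorm E f <= C.
Proof.
move=> ff C0 fC; have Ef : E f.
  by apply/K1_spaceP; split=> //; apply: le_lt_trans fC _; rewrite ltry.
split=> //; move: fC; rewrite KintE// lee_fin => fC.
rewrite leNgt; apply/negP => Cf.
have := @gt0_ltr_powR R q q_gt0 C (qnorm E f); rewrite !nnegrE C0 K1_qnorm_ge0//.
by move=> /(_ isT isT Cf); rewrite ltNge fC.
Qed.

Lemma Kint_le f C (h : R -> R) : sum_set X0 X1 f -> 0 <= C ->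
  measurableL `]0, +oo[ (fun t => h t `^ q * W t) ->
  (forall t, 0 < t -> Kf t f / t <= C * h t) -> (forall t, 0 < t -> 0 <= h t) ->
  (Kint f <= (C `^ q)%:E * lint (fun t => h t `^ q * W t)%R `]0%R, +oo[)%E.
Proof.
move=> ff C0 mh fh h0; have mO : @measurable _ (lebesgueType R) `]0%R, +oo[%classic.
  exact: measurable_itvL.
rewrite -(integral_posZl mh _ _ mO) ?powR_ge0//; last first.
  by move=> x x0; rewrite mulr_ge0 ?powR_ge0 ?weight_ge0.
apply: (le_integral_pos (measurable_Kint ff) _ mO).
- by apply: measurable_funM mh; exact: measurable_cst.
- by [].
move=> x /=; rewrite in_itv/= andbT => x0.
rewrite Kint_integrand_ge0//= [leRHS]mulrA ler_wpM2r ?weight_ge0// -powRM ?h0//.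
by apply: ler_powRl; rewrite ?fh ?(ltW q_gt0)// divr_ge0 ?Kge0 ?(ltW x0).
Qed.

Lemma Kint_add f g : sum_set X0 X1 f -> sum_set X0 X1 g ->
  (Kint (f + g) <= (2 `^ q)%:E * (Kint f + Kint g))%E.
Proof.
move=> ff gg; have mO := @measurable_itvL R `]0%R, +oo[.
have fg : sum_set X0 X1 (f + g).
  exact: (subspaceD (subspace_sum_set sX0 sX1)).
pose F t := (Kf t f / t) `^ q * W t; pose G t := (Kf t g / t) `^ q * W t.
have mF : measurableL `]0, +oo[ F := measurable_Kint ff.
have mG : measurableL `]0, +oo[ G := measurable_Kint gg.
have F0 : forall x, 0 < x -> 0 <= F x := Kint_integrand_ge0 f.
have G0 : forall x, 0 < x -> 0 <= G x := Kint_integrand_ge0 g.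
have mFG := measurable_addL mF mG.
have FG0 x : 0 < x -> 0 <= F x + G x by move=> x0; rewrite addr_ge0 ?F0 ?G0.
have OO : `]0, +oo[%classic `<=` (`]0, +oo[%classic : set R) by [].
rewrite /Kint -(lintD mF F0 mG G0 mO OO).
rewrite -(integral_posZl mFG FG0 (powR_ge0 _ _) mO OO).
apply: (le_integral_pos (measurable_Kint fg) _ mO OO).
  by apply: measurable_funM mFG; exact: measurable_cst.
move=> x /=; rewrite in_itv/= andbT => x0; rewrite Kint_integrand_ge0//=.
have W0 := weight_ge0 q b x0.
rewrite /F /G -mulrDl [leRHS]mulrA ler_wpM2r//.
set u := Kf x f / x; set v := Kf x g / x.
have u0 : 0 <= u by rewrite divr_ge0 ?Kge0 ?(ltW x0).
have v0 : 0 <= v by rewrite divr_ge0 ?Kge0 ?(ltW x0).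
have uv : Kf x (f + g) / x <= u + v.
  by rewrite /u /v -mulrDl ler_wpM2r ?invr_ge0 ?(ltW x0)// (seminorm_Kfun sX0 sX1 (ltW x0)).1.
have w0 : 0 <= Kf x (f + g) / x by rewrite divr_ge0 ?Kge0 ?(ltW x0).
apply: le_trans (ler_powRl (ltW q_gt0) w0 uv) _.
exact: powR_addr_le (ltW q_gt0) u0 v0.
Qed.

Lemma homogeneous_K1 : homogeneous E.
Proof.
have sS := subspace_sum_set sX0 sX1; have mO := @measurable_itvL R `]0%R, +oo[.
have Kint_scale (a : K) f : sum_set X0 X1 f ->
    Kint (a *: f) = ((kabs a `^ q)%:E * Kint f)%E.
  move=> ff; rewrite /Kint -(integral_posZl (measurable_Kint ff) _ _ mO) ?powR_ge0//.
    rewrite /lint; apply: eq_integral => x; rewrite inE/= in_itv/= andbT => x0.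
    congr (_%:E); rewrite (seminorm_Kfun sX0 sX1 (ltW x0)).2// -mulrA.
    rewrite powRM ?kabs_ge0 ?divr_ge0 ?Kge0 ?(ltW x0)//; ring.
  exact: Kint_integrand_ge0.
split=> [|x [xx _]|a x Ex].
- split=> [|a x y /K1_spaceP[xx xi] /K1_spaceP[yy yi]].
    apply/K1_spaceP; split; first exact: sS.1.
    rewrite -(scale0r 0) Kint_scale; last exact: sS.1.
    by rewrite kabs0 powR0 ?gt_eqF// mul0e ltry.
  apply/K1_spaceP; split; first exact: sS.2.
  have ax : sum_set X0 X1 (a *: x) by exact: (@subspaceZ R s).
  apply: le_lt_trans (Kint_add ax yy) _; rewrite Kint_scale//.
  apply: lte_mul_pinfty; [by rewrite lee_fin powR_ge0|by []|].
  apply: lte_add_pinfty yi; apply: lte_mul_pinfty xi; last by [].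
  by rewrite lee_fin powR_ge0.
- exact: (K1_qnorm_ge0 xx).
- have [xx xi] := (K1_spaceP x).1 Ex; have := Kint_ge0 x; move: xi.
  rewrite /= !K1_normE//; last exact: (@subspaceZ R s).
  rewrite Kint_scale//; case: (Kint x) => // r _; rewrite lee_fin => r0.
  rewrite -EFinM !poweR_EFin /= powRM ?powR_ge0// -powRrM mulfV ?gt_eqF//.
  by rewrite powRr1// kabs_ge0.
Qed.

End KSpace.

Section KSpaceEstimates.
Context (R : realType) (s : scalars).
Local Notation K := (scalar_field R s).
Context (V : lmodType K) (X0 X1 : qspace R V).
Hypothesis sX0 : seminormed X0.
Hypothesis sX1 : seminormed X1.
Context (q : R) (b : R -> R).
Hypothesis q_gt0 : 0 < q.
Hypothesis b_sv : slowly_varying b.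
Hypothesis b_int : forall t : R, 0 < t -> (int_bq q b `]0%R, t[ < +oo)%E.
Local Notation measurableL := (@measurable_fun _ _ (lebesgueType R) (measurableTypeR R)).
Local Notation W := (fun x => b x `^ q / x).
Local Notation BQ := (BQ q b).
Local Notation Kf := (Kfun X0 X1).
Local Notation D := (carrier X0 `&` carrier X1).
Local Notation E := (K1_space X0 X1 q%:E b).
Local Notation Kint := (Kint X0 X1 q b).
Local Notation Bfun := (Bfun q b).

Let mW := measurable_weight q b_sv.
Let W0 := weight_ge0 q b.

Lemma Bfun_powR t : Bfun t `^ q = BQ t.
Proof. by rewrite /Bfun -powRrM mulVf ?gt_eqF// powRr1// BQ_ge0. Qed.

Lemma Bfun_gt0 t : 0 < t -> 0 < Bfun t.
Proof. by move=> t0; apply: powR_gt0; exact: BQ_gt0 t0. Qed.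

Let mG f : sum_set X0 X1 f -> measurableL `]0, +oo[ (fun t => (Kf t f / t) `^ q * W t).
Proof. exact: measurable_Kint. Qed.

Let G0 f x : 0 < x -> 0 <= (Kf x f / x) `^ q * W x.
Proof. exact: Kint_integrand_ge0. Qed.

Let Kd0 f t : sum_set X0 X1 f -> 0 < t -> 0 <= Kf t f / t.
Proof.
move=> ff t0; rewrite divr_ge0 ?(ltW t0)//.
by apply: Kfun_ge0; [exact: X0_ge0|exact: X1_ge0|exact: ltW|].
Qed.

Lemma lint_le_Kint f (A : set R) : sum_set X0 X1 f ->
  @measurable _ (lebesgueType R) A -> A `<=` `]0, +oo[ ->
  (lint (fun t => (Kf t f / t) `^ q * W t)%R A <= Kint f)%E.
Proof.
move=> ff mA AO; apply: (integral_pos_subset (mG ff) (G0 f) mA _ AO) => //.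
exact: measurable_itvL.
Qed.

Lemma nincr_measurable_weight (h : R -> R) :
  (forall x y, 0 < x -> x <= y -> h y <= h x) ->
  measurableL `]0, +oo[ (fun x => h x `^ q * W x).
Proof.
move=> hd; apply: measurable_funM mW.
by apply: powR_measurableL; exact: nhomo_measurableL.
Qed.

(** On []0, t[], which has mass [BQ t], the function [h] is at least [h t]. *)
Lemma nincr_weight_le (h : R -> R) t : 0 < t -> (forall x, 0 < x -> 0 <= h x) ->
  (forall x y, 0 < x -> x <= y -> h y <= h x) ->
  ((h t `^ q * BQ t)%:E <= lint (fun x => h x `^ q * W x)%R `]0%R, t[)%E.
Proof.
move=> t0 h0 hd; have mt := @measurable_itvL R `]0%R, t[.
have mh := nincr_measurable_weight hd.
rewrite EFinM -BQE// -(integral_posZl mW W0 (powR_ge0 _ _) mt (@itv_ooy_pos _ t)).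
apply: (le_integral_pos _ mh mt (@itv_ooy_pos _ t)).
  by apply: measurable_funM mW; exact: measurable_cst.
move=> x /=; rewrite in_itv/= => /andP[x0 xt].
rewrite mulr_ge0 ?powR_ge0 ?W0//= ler_wpM2r ?W0//.
by apply: ler_powRl; [exact: ltW|exact: h0|exact/hd/ltW].
Qed.

Lemma Kdiv_BQ_le f t : sum_set X0 X1 f -> 0 < t ->
  (((Kf t f / t) `^ q * BQ t)%:E <= Kint f)%E.
Proof.
move=> ff t0; have mt := @measurable_itvL R `]0%R, t[.
apply: le_trans (lint_le_Kint ff mt (@itv_ooy_pos _ t)).
apply: (nincr_weight_le (h := fun x => Kf x f / x) t0) => [x x0|x y x0 xy].
  exact: Kd0.
exact: Kdiv_nincr.
Qed.

Lemma Kdiv_B_le f t : E f -> 0 < t -> Kf t f / t * Bfun t <= qnorm E f.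
Proof.
move=> Ef t0; have [ff _] := (K1_spaceP sX0 sX1 q_gt0 b_sv f).1 Ef.
have := Kdiv_BQ_le ff t0; rewrite (KintE sX0 sX1 q_gt0 b_sv Ef) lee_fin.
rewrite -Bfun_powR -(powRM _ (Kd0 ff t0) (ltW (Bfun_gt0 t0))) => h.
have n0 := K1_qnorm_ge0 sX0 sX1 q_gt0 b_sv ff.
have := ler_powRl (p := q^-1) _ (powR_ge0 _ _) h.
rewrite -!powRrM mulfV ?gt_eqF// !powRr1//.
  by apply; rewrite invr_ge0 ltW.
by rewrite mulr_ge0 ?Kd0 ?(ltW (Bfun_gt0 t0)).
Qed.

(** On each dyadic interval [K(t, f) / t] is at least its value at the right end, where the terms
    are sampled. The constant does not depend on [x] and [n], so the window of summation may later
    exhaust all of [Z]. *)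
Lemma dyadic_sum_le : exists2 c, 0 < c & forall f x n, E f -> 0 < x ->
  \sum_(i < n) (Kf (2 ^+ i.+1 * x) f / (2 ^+ i.+1 * x)) `^ q *
     b (2 ^+ i.+1 * x) `^ q <= c * qnorm E f `^ q.
Proof.
have [c c1 bc] := BQ_ge_weight q_gt0 b_sv b_int; have c0 := lt_le_trans ltr01 c1.
exists c => // f x n Ef x0.
have [ff _] := (K1_spaceP sX0 sX1 q_gt0 b_sv f).1 Ef.
pose h t := Kf t f / t; pose F t := h t `^ q * W t.
have x2 m : 0 < 2 ^+ m * x by rewrite mulr_gt0// exprn_gt0.
have x22 m : 2 ^+ m * x <= 2 ^+ m.+1 * x.
  by rewrite ler_pM2r// exprS ler_peMl ?ler1n// exprn_ge0.
have xx2 m : x <= 2 ^+ m * x by rewrite ler_peMl ?(ltW x0)// exprn_ege1 ?ler1n.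
rewrite -lee_fin EFinM -(KintE sX0 sX1 q_gt0 b_sv Ef).
apply: le_trans (_ : (c%:E * lint F `[x, (2 ^+ n * x)%R[ <= _)%E); last first.
  apply: lee_wpmul2l; first by rewrite lee_fin ltW.
  by apply: lint_le_Kint => //; [exact: measurable_itvL|exact: itv_coy_pos].
elim: n => [|n ih].
  by rewrite big_ord0 expr0 mul1r set_itvco0 /lint integral_set0 mule0.
rewrite big_ord_recr/= (integral_itv_split3 (mG ff) (G0 f) x0 (xx2 n) (x22 n)).
rewrite ge0_muleDr; last 2 first.
  exact: (integral_pos_sub_ge0 (G0 f) (@itv_coy_pos _ _ _ x0)).
  exact: (integral_pos_sub_ge0 (G0 f) (@itv_coy_pos _ _ _ (x2 n))).
rewrite EFinD; apply: leeD ih _.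
have -> : 2 ^+ n.+1 * x = 2 * (2 ^+ n * x) by rewrite exprS mulrA.
have := x22 n; have -> : 2 ^+ n.+1 * x = 2 * (2 ^+ n * x) by rewrite exprS mulrA.
move: (x2 n); set u := 2 ^+ n * x => u0 u2.
have u20 := lt_le_trans u0 u2.
have mu := @measurable_itvL R `[u, 2 * u[.
have [+ _] := bc _ u20; rewrite (_ : 2 * u / 2 = u); last by rewrite mulrAC divff ?mul1r.
move=> bu; apply: le_trans (_ : (c * (h (2 * u) `^ q * (BQ (2 * u) - BQ u)))%:E <= _)%E.
  by rewrite lee_fin [leRHS]mulrCA ler_wpM2l ?powR_ge0.
rewrite EFinM; apply: lee_wpmul2l; first by rewrite lee_fin ltW.
rewrite EFinM -lint_weight//.
rewrite -(integral_posZl mW W0 (powR_ge0 _ _) mu (@itv_coy_pos _ _ _ u0)).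
apply: (le_integral_pos _ (mG ff) mu (@itv_coy_pos _ _ _ u0)).
  by apply: measurable_funM mW; exact: measurable_cst.
move=> y /=; rewrite in_itv/= => /andP[uy yu]; have y0 := lt_le_trans u0 uy.
rewrite mulr_ge0 ?powR_ge0 ?W0//= ler_wpM2r ?W0//.
apply: ler_powRl; [exact: ltW|exact: Kd0|].
by apply: Kdiv_nincr => //; exact: ltW.
Qed.

(** Split at [t]: the head is bounded by hypothesis, and beyond [t] the constant bound on [K(x, f)]
    is integrated by [weight_tail]. *)
Lemma Kint_split_le : exists2 C, 0 < C & forall f t (A : \bar R) M, sum_set X0 X1 f ->
  0 < t -> 0 <= M ->
  (lint (fun x => (Kf x f / x) `^ q * W x)%R `]0%R, t[ <= A)%E ->
  (forall x, t <= x -> Kf x f <= M) ->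
  (Kint f <= A + (C * ((M / t) `^ q * BQ t))%:E)%E.
Proof.
have [C C0 tail] := weight_tail q_gt0 b_sv b_int.
exists C => // f t A M ff t0 M0 fA fM.
have mt := @measurable_itvL R `[t, +oo[.
rewrite [Kint f](integral_itvy_split (mG ff) (G0 f) t0); apply: leeD fA _.
pose g x := x `^ (- q) * W x.
have mg : measurableL `]0, +oo[ g.
  apply: measurable_funM mW; apply: nhomo_measurableL => x y x0 xy.
  by rewrite !powRN lef_pV2 ?posrE ?powR_gt0 ?(lt_le_trans x0 xy)//
    ler_powRl ?(ltW q_gt0) ?(ltW x0).
have g0 x : 0 < x -> 0 <= g x by move=> x0; rewrite mulr_ge0 ?powR_ge0 ?W0.
apply: le_trans (_ : ((M `^ q)%:E * lint g `[t, +oo[ <= _)%E); last first.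
  have Mq : (0 <= (M `^ q)%:E)%E by rewrite lee_fin powR_ge0.
  apply: le_trans (lee_wpmul2l Mq (tail _ t0)) _.
  rewrite -EFinM lee_fin powRM ?invr_ge0 ?(ltW t0)// -(powR_inv1 (ltW t0)) -powRrM mulN1r.
  by rewrite [leLHS](_ : _ = C * (M `^ q * t `^ (- q) * BQ t))//; ring.
rewrite -(integral_posZl mg g0 (powR_ge0 _ _) mt (itv_cy_pos t0)).
apply: (le_integral_pos (mG ff) _ mt (itv_cy_pos t0)).
  by apply: measurable_funM mg; exact: measurable_cst.
move=> x /=; rewrite in_itv/= andbT => tx; have x0 := lt_le_trans t0 tx.
rewrite G0//= /g [leRHS]mulrA ler_wpM2r ?W0//.
have -> : x `^ (- q) = x^-1 `^ q by rewrite -(powR_inv1 (ltW x0)) -powRrM mulN1r.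
have xV : 0 <= x^-1 by rewrite invr_ge0 ltW.
rewrite -(powRM _ M0 xV); apply: ler_powRl; [exact: ltW|exact: Kd0|].
by rewrite ler_wpM2r// fM.
Qed.

Lemma lint_Kdiv_le f t M : sum_set X0 X1 f -> 0 < t ->
  (forall x, 0 < x -> x < t -> Kf x f / x <= M) ->
  (lint (fun x => (Kf x f / x) `^ q * W x)%R `]0%R, t[ <= (M `^ q * BQ t)%:E)%E.
Proof.
move=> ff t0 fM; have mt := @measurable_itvL R `]0%R, t[.
rewrite EFinM -BQE// -(integral_posZl mW W0 (powR_ge0 _ _) mt (@itv_ooy_pos _ t)).
apply: (le_integral_pos (mG ff) _ mt (@itv_ooy_pos _ t)).
  by apply: measurable_funM mW; exact: measurable_cst.
move=> x /=; rewrite in_itv/= => /andP[x0 xt].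
rewrite G0//= ler_wpM2r ?W0//.
by apply: ler_powRl; [exact: ltW|exact: Kd0|exact: fM].
Qed.

(** Before [t] one uses [K(x, f) <= x |f|_1 <= x J / t], beyond it [K(x, f) <= |f|_0 <= J]. *)
Lemma K1_qnorm_le_J : exists2 C, 0 < C & forall f t, D f -> 0 < t ->
  E f /\ qnorm E f <= C * (Jfun X0 X1 t f / t) * Bfun t.
Proof.
have [C C0 splitK] := Kint_split_le.
exists ((1 + C) `^ q^-1); first by apply: powR_gt0; rewrite addr_gt0.
move=> f t [X0f X1f] t0; have ff := sum_set0 sX1 X0f.
pose J := Jfun X0 X1 t f.
have J0 : 0 <= J by rewrite le_max X0_ge0.
have Jt : 0 <= J / t by rewrite divr_ge0// ltW.
have B0 := ltW (Bfun_gt0 t0); have C10 : 0 <= (1 + C) `^ q^-1 by exact: powR_ge0.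
apply: (K1_qnorm_le sX0 sX1 q_gt0 b_sv ff).
  by rewrite mulr_ge0// mulr_ge0.
rewrite (powRM _ (mulr_ge0 C10 Jt) B0) (powRM _ C10 Jt) -powRrM mulVf ?gt_eqF// powRr1 ?addr_ge0 ?(ltW C0)//.
rewrite Bfun_powR.
apply: le_trans (splitK f t _ J ff t0 J0 (lint_Kdiv_le (M := J / t) ff t0 _) _) _.
- move=> x x0 xt; rewrite ler_pdivrMr//; apply: le_trans (Kfun_le1 sX0 sX1 (ltW x0) X1f) _.
  by rewrite mulrC ler_wpM2r ?(ltW x0)// ler_pdivlMr// mulrC le_max lexx orbT.
- move=> x tx; apply: le_trans (Kfun_le0 sX0 sX1 _ X0f) _; last by rewrite le_max lexx.
  exact: le_trans (ltW t0) tx.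
- by rewrite -EFinD lee_fin -/J [leRHS](_ : _ = (J / t) `^ q * BQ t +
    C * ((J / t) `^ q * BQ t))//; ring.
Qed.

(** [K(t, f) / t <= |f|_1] everywhere, and the weight has finite total mass. *)
Lemma K1_qnorm_le_X1 : (int_bq q b `]0%R, +oo[ < +oo)%E -> exists2 C, 0 < C &
  forall f, X1 f -> E f /\ qnorm E f <= C * qnorm X1 f.
Proof.
move=> bfin; have OO : `]0, +oo[ `<=` (`]0, +oo[%classic : set R) by [].
have I0 : (0 <= lint W `]0%R, +oo[)%E := integral_pos_sub_ge0 W0 OO.
pose M := fine (lint W `]0%R, +oo[).
have ME : lint W `]0%R, +oo[ = M%:E by rewrite fineK// ge0_fin_numE.
have M0 : 0 < M.
  apply: lt_le_trans (BQ_gt0 q_gt0 b_sv b_int ltr01) _.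
  rewrite -lee_fin -ME -BQE//; apply: (integral_pos_subset mW W0 _ _ _ OO).
  - exact: measurable_itvL.
  - exact: measurable_itvL.
  - exact: itv_ooy_pos.
exists (M `^ q^-1); first exact: powR_gt0.
move=> f X1f; have ff := sum_set1 sX0 X1f; have n0 := X1_ge0 sX1 X1f.
apply: (K1_qnorm_le sX0 sX1 q_gt0 b_sv ff); first by rewrite mulr_ge0 ?powR_ge0.
have := @Kint_le _ _ _ _ _ sX0 sX1 _ _ q_gt0 b_sv f (qnorm X1 f) (fun=> 1) ff n0 _ _ _.
have e1 : (fun t => 1 `^ q * W t) = W by apply/funext => t; rewrite (_ : 1 `^ q = 1) ?mul1r ?powR1.
rewrite /= e1 ME => h; apply: le_trans (h _ _ _) _ => //.
  by move=> t t0; rewrite mulr1 ler_pdivrMr// mulrC Kfun_le1 ?(ltW t0).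
by rewrite -EFinM lee_fin powRM ?powR_ge0// -powRrM mulVf ?gt_eqF// powRr1 ?(ltW M0)// mulrC.
Qed.

(** * Approximation in the K-space by decompositions at small and at large [t] *)

Section Density.
Variable f : V.
Hypothesis Ef : E f.

Let ff : sum_set X0 X1 f.
Proof. by have [] := (K1_spaceP sX0 sX1 q_gt0 b_sv f).1 Ef. Qed.

Let fi : (Kint f < +oo)%E.
Proof. by have [] := (K1_spaceP sX0 sX1 q_gt0 b_sv f).1 Ef. Qed.

(** A positive majorant of [K(t, f)], so that near-optimal decompositions
    exist even where [K(t, f) = 0]. *)
Let L (t : R) : R := Kf t f + Num.min 1 t.
Let h (t : R) : R := L t / t.

Let L_homo (t u : R) : 0 < t -> t <= u -> L t <= L u.
Proof.
move=> t0 tu; apply: lerD; last exact: le_min2.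
by apply: Kfun_homo; [exact: X0_ge0|exact: X1_ge0|exact: ltW| |].
Qed.

Let min1_nincr (t u : R) : 0 < t -> t <= u -> Num.min 1 u / u <= Num.min 1 t / t.
Proof.
move=> t0 tu; have u0 := lt_le_trans t0 tu.
rewrite ler_pdivrMr// mulrAC ler_pdivlMr//.
have [t1|t1] := leP 1 t.
  rewrite min_l; last exact: le_trans tu.
  by rewrite !mul1r.
by rewrite mulrC ler_pM2l// ge_min lexx orbT.
Qed.

Let h_nincr (t u : R) : 0 < t -> t <= u -> h u <= h t.
Proof.
by move=> t0 tu; rewrite /h !mulrDl lerD ?min1_nincr// Kdiv_nincr.
Qed.

Let m0 (t : R) : 0 < t -> 0 <= Num.min 1 t.
Proof. by move=> t0; rewrite le_min ler01 ltW. Qed.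

Let h_ge0 (t : R) : 0 < t -> 0 <= h t.
Proof.
by move=> t0; rewrite /h mulrDl addr_ge0 ?Kd0// divr_ge0 ?m0 ?(ltW t0).
Qed.

Let G (t : R) : R := h t `^ q * W t.

Let mGL : measurableL `]0, +oo[ G.
Proof. exact: nincr_measurable_weight. Qed.

Let GL0 (x : R) : 0 < x -> 0 <= G x.
Proof. by move=> x0; rewrite mulr_ge0 ?powR_ge0 ?W0. Qed.

Let OO : `]0, +oo[ `<=` (`]0, +oo[%classic : set R).
Proof. by []. Qed.

(** The added [min(1, t) / t] equals 1 on []0, 1[], where the weight is integrable, and [1 / t]
    beyond, where [weight_tail] applies. *)
Let lint_G_fin : (lint G `]0%R, +oo[ < +oo)%E.
Proof.
have mO := @measurable_itvL R `]0%R, +oo[.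
pose v (t : R) := Num.min 1 t / t; pose F t := v t `^ q * W t.
have v0 x : 0 < x -> 0 <= v x by move=> x0; rewrite divr_ge0 ?m0 ?(ltW x0).
have mF : measurableL `]0, +oo[ F by apply: nincr_measurable_weight.
have F0 x : 0 < x -> 0 <= F x by move=> x0; rewrite mulr_ge0 ?powR_ge0 ?W0.
have mS := measurable_addL (mG ff) mF.
have S0 x : 0 < x -> 0 <= (Kf x f / x) `^ q * W x + F x.
  by move=> x0; rewrite addr_ge0 ?G0 ?F0.
apply: (@le_lt_trans _ _ ((2 `^ q)%:E * (Kint f + lint F `]0%R, +oo[))%E).
  rewrite -[Kint f]/(lint _ _) -(lintD (mG ff) (G0 f) mF F0 mO OO).
  rewrite -(integral_posZl mS S0 (powR_ge0 _ _) mO OO).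
  apply: (le_integral_pos mGL _ mO OO).
    by apply: measurable_funM mS; exact: measurable_cst.
  move=> x /=; rewrite in_itv/= andbT => x0; rewrite GL0//=.
  rewrite /G /F -mulrDl [leRHS]mulrA ler_wpM2r ?W0// /h mulrDl.
  by apply: powR_addr_le (ltW q_gt0) _ _; [exact: Kd0|exact: v0].
apply: lte_mul_pinfty; [by rewrite lee_fin powR_ge0|by []|].
apply: lte_add_pinfty; first exact: fi.
have [C C0 tail] := weight_tail q_gt0 b_sv b_int.
rewrite (integral_itvy_split mF F0 ltr01); apply: lte_add_pinfty.
  apply: (@le_lt_trans _ _ (lint W `]0%R, 1%R[)); last by rewrite BQE// ltry.
  apply: (le_integral_pos mF mW (measurable_itvL _) (@itv_ooy_pos _ 1)).
  move=> x /=; rewrite in_itv/= => /andP[x0 x1]; rewrite F0//=.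
  rewrite /F /v min_r ?(ltW x1)// divff ?gt_eqF// (_ : 1 `^ q = 1) ?powR1//.
  by rewrite mul1r.
apply: le_lt_trans (ltry (C * (1 `^ (- q) * BQ 1))).
apply: le_trans (tail _ ltr01); apply: (le_integral_pos mF _ (measurable_itvL _) (itv_cy_pos ltr01)).
  apply: measurable_funM mW; apply: nhomo_measurableL => x y x0 xy.
  by rewrite !powRN lef_pV2 ?posrE ?powR_gt0 ?(lt_le_trans x0 xy)//
    ler_powRl ?(ltW q_gt0) ?(ltW x0).
move=> x /=; rewrite in_itv/= andbT => x1; have x0 := lt_le_trans ltr01 x1.
by rewrite F0//= /F /v min_l// div1r -(powR_inv1 (ltW x0)) -powRrM mulN1r.
Qed.

Let decomposition (t : R) : 0 < t -> exists f0 f1, [/\ X0 f0, X1 f1, f = f0 + f1 &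
  qnorm X0 f0 + t * qnorm X1 f1 < L t].
Proof. by move=> t0; apply: Kfun_lt => //; rewrite ltrDl lt_min ltr01. Qed.

Let KfD (x : R) f0 f1 : 0 < x -> X0 f0 -> X1 f1 -> f = f0 + f1 ->
  Kf x f0 <= L x + x * qnorm X1 f1 /\ Kf x f1 <= L x + qnorm X0 f0.
Proof.
move=> x0 Xf0 Xf1 fE; have sK := seminorm_Kfun sX0 sX1 (ltW x0).
have [s0 s1] := (sum_set0 sX1 Xf0, sum_set1 sX0 Xf1).
have KN g : sum_set X0 X1 g -> Kf x (- g) = Kf x g.
  by move=> gg; rewrite -scaleN1r sK.2// kabsN kabs1 mul1r.
have sN g : sum_set X0 X1 g -> sum_set X0 X1 (- g).
  by move=> gg; exact: (subspaceN (subspace_sum_set sX0 sX1)).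
have KL : Kf x f <= L x by rewrite lerDl m0.
split.
  have := sK.1 f (- f1) ff (sN _ s1); rewrite fE addrK -fE KN// => /le_trans; apply.
  by apply: lerD => //; exact: Kfun_le1 (ltW x0) Xf1.
have := sK.1 f (- f0) ff (sN _ s0); rewrite {1}fE addrC addKr KN// => /le_trans; apply.
by apply: lerD => //; exact: Kfun_le0 (ltW x0) Xf0.
Qed.

(** For a near-optimal decomposition at [t], [K(x, f0)] is at most [2 L(x)] before [t] and at most
    [L(t)] beyond. Both contributions are bounded by the integral of [G] over []0, t[], which is
    small for small [t]. *)
Lemma K1_approx_small e : 0 < e -> exists f0 f1,
  [/\ X0 f0, X1 f1, f = f0 + f1 & (Kint f0 < e%:E)%E].
Proof.
move=> e0; have [C C0 splitK] := Kint_split_le.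
(* Here [2^q] is the cost of the head of [f0] and [C] that of its tail, in multiples of the integral
   of [G] over []0, t[]. *)
have k0 : 0 < 2 `^ q + C by rewrite addr_gt0 ?powR_gt0.
have [t t0 tG] := lint_small0 mGL GL0 lint_G_fin (divr_gt0 e0 k0).
have [f0 [f1 [Xf0 Xf1 fE fL]]] := decomposition t0.
exists f0, f1; split => //.
have s0 := sum_set0 sX1 Xf0; have mt := @measurable_itvL R `]0%R, t[.
have [n0 n1] := (X0_ge0 sX0 Xf0, X1_ge0 sX1 Xf1).
have L0 : 0 <= L t by apply: le_trans (ltW fL); rewrite addr_ge0// mulr_ge0// ltW.
have n1L : qnorm X1 f1 <= L t / t.
  by rewrite ler_pdivlMr// mulrC; apply: le_trans (ltW fL); rewrite lerDr.
have n0L : qnorm X0 f0 <= L t.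
  by apply: le_trans (ltW fL); rewrite lerDl mulr_ge0// ltW.
apply: le_lt_trans (splitK f0 t _ (L t) s0 t0 L0 (le_integral_pos (G := fun x => 2 `^ q * G x)
  (mG s0) _ mt (@itv_ooy_pos _ t) _) _) _.
- by apply: measurable_funM mGL; exact: measurable_cst.
- move=> x /=; rewrite in_itv/= => /andP[x0 xt]; rewrite G0//=.
  rewrite /G [leRHS]mulrA ler_wpM2r ?W0// -(powRM _ (ler0n _ 2) (h_ge0 x0)).
  apply: ler_powRl; [exact: ltW|exact: Kd0|].
  rewrite /h mulrA ler_wpM2r ?invr_ge0 ?(ltW x0)//.
  apply: le_trans (KfD x0 Xf0 Xf1 fE).1 _.
  rewrite mulr_natl mulr2n lerD2l; apply: le_trans (ler_wpM2l (ltW x0) n1L) _.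
  by rewrite mulrC -ler_pdivlMr//; apply: h_nincr => //; exact: ltW.
- move=> x tx; apply: le_trans n0L; apply: Kfun_le0 => //.
  by rewrite (le_trans (ltW t0)).
- rewrite (integral_posZl mGL GL0 (powR_ge0 _ _) mt (@itv_ooy_pos _ t)).
  have hB := nincr_weight_le t0 h_ge0 h_nincr.
  have I0 := integral_pos_sub_ge0 GL0 (@itv_ooy_pos _ t).
  move: tG hB I0; rewrite -/G; case: (lint G _) => // r.
  rewrite !lte_fin lee_fin => re hB r0.
  apply: le_lt_trans (_ : (2 `^ q + C) * r < _).
    by rewrite [leRHS]mulrDl lerD2l ler_pM2l.
  by rewrite -ltr_pdivlMl// mulrC.
Qed.

(** On []0, t[] one has [K(x, f1) / x <= h(t)]. The mass of []0, t[] is split at a fixed [T]: up to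
    [T] the contribution is small because [h(t)] tends to 0 when [B] is unbounded, and after [T] it
    is dominated by the tail of [G]. *)
Lemma K1_approx_large e : int_bq q b `]0, +oo[ = +oo%E -> 0 < e ->
  exists f0 f1, [/\ X0 f0, X1 f1, f = f0 + f1 & (Kint f1 < e%:E)%E].
Proof.
move=> byy e0; have q20 : 0 < 2 `^ q :> R by exact: powR_gt0.
have k0 : 0 < 2 + 2 `^ q by rewrite addr_gt0.
(* One [d] for []0, T[], one for [[T, t[], and [2^q d] for [[t, +oo[], where
   [K(x, f1) <= 2 L(x)]. *)
pose d : R := e / (2 + 2 `^ q); have d0 : 0 < d by exact: divr_gt0.
have [T T0 TG] := lint_smally mGL GL0 lint_G_fin d0.
have mO := @measurable_itvL R `]0%R, +oo[.
pose I := fine (lint G `]0%R, +oo[).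
have IE : lint G `]0%R, +oo[ = I%:E.
  by rewrite fineK// ge0_fin_numE// (integral_pos_sub_ge0 GL0 OO).
(* Since [h(t)^q BQ(t) <= I], a value of [BQ] above this threshold forces [h(t)^q BQ(T) < d]. *)
have [t1 t10 t1M] := BQ_large b_sv b_int byy (I * BQ T / d).
pose t := Num.max T t1; have Tt : T <= t by rewrite le_max lexx.
have t0 : 0 < t := lt_le_trans T0 Tt.
have BT0 := BQ_gt0 q_gt0 b_sv b_int T0; have Bt0 := BQ_gt0 q_gt0 b_sv b_int t0.
have tM : I * BQ T / d < BQ t.
  apply: lt_le_trans t1M _; apply: BQ_homo => //.
  by rewrite le_max lexx orbT.
have [f0 [f1 [Xf0 Xf1 fE fL]]] := decomposition t0.
exists f0, f1; split => //.
have s1 := sum_set1 sX0 Xf1; have mt := @measurable_itvL R `[t, +oo[.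
have mTt := @measurable_itvL R `[T, t[; have mT := @measurable_itvL R `[T, +oo[.
have mt' := @measurable_itvL R `]0%R, t[.
have [n0 n1] := (X0_ge0 sX0 Xf0, X1_ge0 sX1 Xf1).
have n1h : qnorm X1 f1 <= h t.
  by rewrite /h ler_pdivlMr// mulrC; apply: le_trans (ltW fL); rewrite lerDr.
have n0L : qnorm X0 f0 <= L t.
  by apply: le_trans (ltW fL); rewrite lerDl mulr_ge0// ltW.
have small_h : h t `^ q * BQ T < d.
  have hB : h t `^ q * BQ t <= I.
    rewrite -lee_fin -IE; apply: le_trans (nincr_weight_le t0 h_ge0 h_nincr) _.
    exact: (integral_pos_subset mGL GL0 mt' mO (@itv_ooy_pos _ t) OO).
  rewrite -(ltr_pM2r Bt0) mulrAC; apply: le_lt_trans (ler_wpM2r (ltW BT0) hB) _.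
  by rewrite [d * _]mulrC -ltr_pdivrMr.
have tail_h : (lint G `[T, t[ < d%:E)%E.
  apply: le_lt_trans TG; apply: (integral_pos_subset mGL GL0 mTt mT _ (itv_cy_pos T0)).
  by move=> x /=; rewrite !in_itv/= andbT => /andP[].
have mid : (((h t) `^ q * (BQ t - BQ T))%:E <= lint G `[T, t[)%E.
  rewrite EFinM -lint_weight//.
  rewrite -(integral_posZl mW W0 (powR_ge0 _ _) mTt (itv_coy_pos T0)).
  apply: (le_integral_pos _ mGL mTt (itv_coy_pos T0)).
    by apply: measurable_funM mW; exact: measurable_cst.
  move=> x /=; rewrite in_itv/= => /andP[Tx xt]; have x0 := lt_le_trans T0 Tx.
  rewrite mulr_ge0 ?powR_ge0 ?W0//= ler_wpM2r ?W0//.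
  by apply: ler_powRl; [exact: ltW|exact: h_ge0|apply: h_nincr => //; exact: ltW].
have head : (lint (fun x => (Kf x f1 / x) `^ q * W x)%R `]0%R, t[ < (d + d)%:E)%E.
  apply: le_lt_trans (lint_Kdiv_le (M := h t) s1 t0 _) _.
    move=> x x0 xt; apply: le_trans n1h.
    by rewrite ler_pdivrMr// mulrC; exact: Kfun_le1 (ltW x0) Xf1.
  rewrite (_ : h t `^ q * BQ t = h t `^ q * BQ T + h t `^ q * (BQ t - BQ T)); last by ring.
  by rewrite !EFinD lteD ?lte_fin//; exact: le_lt_trans mid tail_h.
have tail_f1 : (lint (fun x => (Kf x f1 / x) `^ q * W x)%R `[t, +oo[ < (2 `^ q * d)%:E)%E.
  apply: (@le_lt_trans _ _ (lint (fun x => 2 `^ q * G x) `[t, +oo[)).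
    apply: (le_integral_pos (mG s1) _ mt (itv_cy_pos t0)).
      by apply: measurable_funM mGL; exact: measurable_cst.
    move=> x /=; rewrite in_itv/= andbT => tx; have x0 := lt_le_trans t0 tx.
    rewrite G0//= /G [leRHS]mulrA ler_wpM2r ?W0// -(powRM _ (ler0n _ 2) (h_ge0 x0)).
    apply: ler_powRl; [exact: ltW|exact: Kd0|].
    rewrite /h mulrA ler_wpM2r ?invr_ge0 ?(ltW x0)//.
    apply: le_trans (KfD x0 Xf0 Xf1 fE).2 _.
    by rewrite mulr_natl mulr2n lerD2l; apply: le_trans n0L _; exact: L_homo.
  rewrite (integral_posZl mGL GL0 (powR_ge0 _ _) mt (itv_cy_pos t0)) EFinM.
  rewrite lte_pmul2l ?lte_fin//; apply: le_lt_trans TG.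
  apply: (integral_pos_subset mGL GL0 mt mT _ (itv_cy_pos T0)).
  by move=> x /=; rewrite !in_itv/= !andbT; exact: le_trans.
rewrite [Kint f1](integral_itvy_split (mG s1) (G0 f1) t0).
have -> : e = d + d + 2 `^ q * d.
  by rewrite -[LHS](divfK (lt0r_neq0 k0)) -/d; ring.
by rewrite EFinD; apply: lteD.
Qed.

End Density.

(** Split [f] near 0, and near infinity when [B] is unbounded; when [B] is
    bounded the [X1]-part is approximated in [X1] instead. *)
Lemma D_dense_K1 : (forall x e, X1 x -> 0 < e ->
    exists2 y, D y & qnorm X1 (x - y) < e) ->
  forall f e, E f -> 0 < e -> exists2 y, D y & qnorm E (f - y) < e.
Proof.
move=> dense1 f e Ef e0.
have eq0 : 0 < e `^ q by exact: powR_gt0.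
have k0 : 0 < 2 `^ q * 2 :> R by rewrite mulr_gt0// powR_gt0.
(* Chosen so that [2^q (d + d) = (e / 2)^q], where [2^q] is the constant of [Kint_add]. *)
pose d : R := (e / 2) `^ q / (2 `^ q * 2).
have d0 : 0 < d by rewrite divr_gt0// powR_gt0// divr_gt0.
have small g g' : sum_set X0 X1 g -> sum_set X0 X1 g' ->
    (Kint g < d%:E)%E -> (Kint g' < d%:E)%E -> qnorm E (g + g') < e.
  move=> gg gg' gd gd'.
  have ggs : sum_set X0 X1 (g + g') by exact: (subspaceD (subspace_sum_set sX0 sX1)).
  have e20 : 0 <= e / 2 by rewrite divr_ge0// ltW.
  have [|_ ge] := K1_qnorm_le sX0 sX1 q_gt0 b_sv ggs e20.
    apply: le_trans (Kint_add sX0 sX1 q_gt0 b_sv gg gg') _.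
    have -> : (e / 2) `^ q = 2 `^ q * (d + d).
      by rewrite -[LHS](divfK (lt0r_neq0 k0)) -/d; ring.
    rewrite EFinM EFinD; apply: lee_wpmul2l; first by rewrite lee_fin powR_ge0.
    exact: (leeD (ltW gd) (ltW gd')).
  by apply: le_lt_trans ge _; rewrite ltr_pdivrMr// ltr_pMr// ltr1n.
have [f0 [f1 [Xf0 Xf1 fE fd]]] := K1_approx_small Ef d0.
have sf0 := sum_set0 sX1 Xf0.
have [bfin|] := ltP (int_bq q b `]0%R, +oo[) +oo%E; last first.
  rewrite leye_eq => /eqP binf.
  have [g0 [g1 [Xg0 Xg1 gE gd]]] := K1_approx_large Ef binf d0.
  (* The middle part of [f = f0 + (f1 - g1) + g1] lies in [X1] in one form and in [X0] in the other,
     hence in [D]. *)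
  have fg : f1 - g1 = g0 - f0.
    have -> : f1 = g0 + g1 - f0 by rewrite -gE fE addrAC subrr add0r.
    by rewrite addrAC addrK.
  exists (f1 - g1).
    split; last by apply: (@subspaceB R s) => //; exact: sX1.1.
    by rewrite fg; apply: (@subspaceB R s) => //; exact: sX0.1.
  rewrite (_ : f - (f1 - g1) = f0 + g1); last by rewrite fE opprB addrA addrAC addrK addrC.
  exact: (small _ _ sf0 (sum_set1 sX0 Xg1) fd gd).
have [C C0 CX1] := K1_qnorm_le_X1 bfin.
pose r := d `^ q^-1 / C; have r0 : 0 < r by rewrite divr_gt0// powR_gt0.
have [y Dy yr] := dense1 _ _ Xf1 r0.
exists y => //; rewrite fE -addrA.
have Xf1y : X1 (f1 - y) by apply: (@subspaceB R s) => //; [exact: sX1.1|case: Dy].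
have [Efy Cfy] := CX1 _ Xf1y.
apply: (small _ _ sf0 (sum_set1 sX0 Xf1y) fd).
rewrite (KintE sX0 sX1 q_gt0 b_sv Efy) lte_fin.
have n0 := K1_qnorm_ge0 sX0 sX1 q_gt0 b_sv (sum_set1 sX0 Xf1y).
have : qnorm E (f1 - y) < d `^ q^-1.
  by apply: le_lt_trans Cfy _; rewrite mulrC -ltr_pdivlMr.
move=> /(gt0_ltr_powR q_gt0); rewrite !nnegrE n0 powR_ge0 => /(_ isT isT).
by rewrite -powRrM mulVf ?gt_eqF// powRr1// ltW.
Qed.

End KSpaceEstimates.

(** * From the J-space to the dual *)

Section JToDual.
Context (R : realType) (s : scalars).
Local Notation K := (scalar_field R s).
Context (V : lmodType K) (X0 X1 : qspace R V).
Hypothesis sX0 : seminormed X0.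
Hypothesis sX1 : seminormed X1.
Context (q : R) (b : R -> R).
Hypothesis q_gt0 : 0 < q.
Hypothesis q_le1 : q <= 1.
Hypothesis b_sv : slowly_varying b.
Hypothesis b_int : forall t : R, 0 < t -> (int_bq q b `]0%R, t[ < +oo)%E.
Local Notation Kf := (Kfun X0 X1).
Local Notation D := (carrier X0 `&` carrier X1).
Local Notation E := (K1_space X0 X1 q%:E b).
Local Notation afun := (afun q b).
Local Notation Bfun := (Bfun q b).
Local Notation A0' := (dual D X0).
Local Notation A1' := (dual D X1).

Lemma afun_gt0 t : 0 < t -> 0 < afun t.
Proof.
move=> t0; rewrite /afun !mulr_gt0 ?invr_gt0 ?powR_gt0 ?(sv_gt0 b_sv)//.
exact: (BQ_gt0 q_gt0 b_sv b_int t0).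
Qed.

Definition Kterm (f : V) (t : R) : R := t^-1 * afun t * Kf t f.

Lemma Kterm_ge0 f t : sum_set X0 X1 f -> 0 < t -> 0 <= Kterm f t.
Proof.
move=> ff t0; apply: mulr_ge0.
  by apply: mulr_ge0; [rewrite invr_ge0 ltW|exact/ltW/afun_gt0].
by apply: Kfun_ge0; [exact: X0_ge0|exact: X1_ge0|exact: ltW|].
Qed.

(** With [h = K / t], [h a = (1 / q) (h B) ^ (1 - q) (h b) ^ q], and [h B] is
    at most the norm of [f]. *)
Lemma Kterm_sum_le : exists2 C, 0 < C & forall f x n, E f -> 0 < x ->
  \sum_(i < n) Kterm f (2 ^+ i.+1 * x) <= C * qnorm E f.
Proof.
have [c c0 cE] := dyadic_sum_le sX0 sX1 q_gt0 b_sv b_int.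
exists (q^-1 * c); first by rewrite mulr_gt0 ?invr_gt0.
move=> f x n Ef x0.
have [ff _] := (K1_spaceP sX0 sX1 q_gt0 b_sv f).1 Ef.
have nE := K1_qnorm_ge0 sX0 sX1 q_gt0 b_sv ff.
have split_pow u : 0 <= u -> u = u `^ (1 - q) * u `^ q.
  move=> u0; rewrite -powRD ?subrK ?powRr1//.
  by apply/implyP; rewrite oner_eq0.
have q1 : 0 <= 1 - q by rewrite subr_ge0.
have term t : 0 < t -> Kterm f t <=
    q^-1 * qnorm E f `^ (1 - q) * ((Kf t f / t) `^ q * b t `^ q).
  move=> t0; have h0 : 0 <= Kf t f / t.
    rewrite divr_ge0 ?(ltW t0)//.
    by apply: Kfun_ge0; [exact: X0_ge0|exact: X1_ge0|exact: ltW|].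
  have B0 := ltW (Bfun_gt0 q_gt0 b_sv b_int t0).
  rewrite /Kterm /Defs.afun.
  rewrite (_ : _ * _ * _ = q^-1 * (Bfun t `^ (1 - q) * (Kf t f / t)) * b t `^ q); last by ring.
  rewrite [X in _ * (_ * X) * _](split_pow _ h0); set h := Kf t f / t in h0 *.
  rewrite [leLHS](_ : _ = q^-1 * (h `^ (1 - q) * Bfun t `^ (1 - q)) *
    (h `^ q * b t `^ q)); last by ring.
  rewrite -(powRM _ h0 B0) ler_wpM2r ?mulr_ge0 ?powR_ge0// ler_wpM2l ?invr_ge0 ?(ltW q_gt0)//.
  apply: (ler_powRl q1); first exact: mulr_ge0.
  exact: (Kdiv_B_le sX0 sX1 q_gt0 b_sv b_int Ef t0).
apply: le_trans (ler_sum _ (fun (i : 'I_n) _ => term _ (mulr_gt0 (exprn_gt0 i.+1 (ltr0n _ 2)) x0))) _.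
rewrite -mulr_sumr; apply: le_trans (ler_wpM2l _ (cE f x n Ef x0)) _.
  by rewrite mulr_ge0 ?powR_ge0 ?invr_ge0 ?(ltW q_gt0).
rewrite [in leRHS](split_pow _ nE).
by rewrite [leLHS](_ : _ = q^-1 * c * (qnorm E f `^ (1 - q) * qnorm E f `^ q))//; ring.
Qed.

Lemma seminorm_Kterm t : 0 < t -> seminorm_on (sum_set X0 X1) (Kterm^~ t).
Proof.
move=> t0; have [KD KZ] := seminorm_Kfun sX0 sX1 (ltW t0).
have at0 : 0 <= t^-1 * afun t.
  by apply: mulr_ge0; [rewrite invr_ge0 ltW|exact/ltW/afun_gt0].
split=> [x y xx yy|a x xx]; rewrite /Kterm; first by rewrite -mulrDr ler_wpM2l ?KD.
by rewrite KZ// mulrCA.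
Qed.

(** The points run from [2^(1-n)] to [2^n] in one increasing progression, the form that
    [Kterm_sum_le] handles. *)
Definition Ksum (f : V) (n : nat) : R :=
  \sum_(i < n + n) Kterm f (2 ^+ i.+1 * 2 ^- n).

(** The two halves match those of [Zpartial_sum u n n]: the term of index [k] is paired with
    [t = 2^-k]. *)
Lemma KsumE f n : Ksum f n =
  \sum_(i < n) Kterm f (2 ^- i) + \sum_(i < n) Kterm f (2 ^+ i.+1).
Proof.
rewrite /Ksum big_split_ord /=; congr (_ + _).
  rewrite (reindex_inj rev_ord_inj) /=; apply: eq_bigr => i _; congr Kterm.
  rewrite subnSK// -[n in 2 ^- n](subnK (ltnW (ltn_ord i))) exprD invfM.
  by rewrite mulrA divff ?mul1r// expf_neq0.
apply: eq_bigr => i _; congr Kterm.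
by rewrite addnC -addSn exprD mulfK// expf_neq0.
Qed.

(** The full sum over [Z], a seminorm on [E] since each [K(t, .)] is one. It takes the place of the
    quasi-norm in Hahn-Banach. *)
Definition Ksup (f : V) : R := sup (range (Ksum f)).

Lemma Ksum_bounded : exists2 C, 0 < C & forall f n, E f -> Ksum f n <= C * qnorm E f.
Proof.
have [C C0 CE] := Kterm_sum_le; exists C => // f n Ef.
by apply: CE => //; rewrite invr_gt0 exprn_gt0.
Qed.

Lemma Ksup_ge f n : E f -> Ksum f n <= Ksup f.
Proof.
have [C C0 CE] := Ksum_bounded => Ef; apply: ub_le_sup; last by exists n.
by exists (C * qnorm E f) => _ [m _ <-]; exact: CE.
Qed.

Lemma Ksup_le f M : (forall n, Ksum f n <= M) -> Ksup f <= M.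
Proof. by move=> fM; apply: ge_sup; [exists (Ksum f 0), 0|move=> _ [n _ <-]]. Qed.

Lemma seminorm_Ksup : seminorm_on (carrier E) Ksup.
Proof.
have [sE _ _] := homogeneous_K1 sX0 sX1 q_gt0 b_sv.
have Es f : E f -> sum_set X0 X1 f by move=> /(K1_spaceP sX0 sX1 q_gt0 b_sv f).1[].
have p0 n i : 0 < 2 ^+ i * 2 ^- n :> R by rewrite mulr_gt0 ?invr_gt0 ?exprn_gt0.
have KsumZ a x n : E x -> Ksum (a *: x) n = kabs a * Ksum x n.
  move=> Ex; rewrite /Ksum mulr_sumr; apply: eq_bigr => i _.
  by rewrite (seminorm_Kterm (p0 n i.+1)).2//; exact: Es.
have Ksum0 x : Ksum x 0 = 0 by rewrite /Ksum big_ord0.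
have KsupZ a x : E x -> Ksup (a *: x) <= kabs a * Ksup x.
  move=> Ex; apply: Ksup_le => n; rewrite KsumZ// ler_wpM2l ?kabs_ge0//.
  exact: Ksup_ge.
split=> [x y Ex Ey|a x Ex].
  apply: Ksup_le => n; apply: (@le_trans _ _ (Ksum x n + Ksum y n)).
    rewrite /Ksum -big_split/=; apply: ler_sum => i _.
    by apply: (seminorm_Kterm (p0 n i.+1)).1; exact: Es.
  by apply: lerD; exact: Ksup_ge.
apply/eqP; rewrite eq_le KsupZ//=; have [->|a0] := eqVneq a 0.
  rewrite kabs0 mul0r -(Ksum0 (0 *: x)); apply: Ksup_ge.
  exact: (subspaceZ _ sE).
have := KsupZ a^-1 (a *: x) (subspaceZ a sE Ex); rewrite scalerA mulVf// scale1r => h.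
apply: le_trans (ler_wpM2l (kabs_ge0 a) h) _.
by rewrite mulrA -kabsM mulfV// kabs1 mul1r.
Qed.

Lemma J_term_bound (u : int -> (D -> K)) (M : R) k x :
  (forall k, (carrier A0' `&` carrier A1') (u k)) ->
  (forall k, 2 ^ (- k) * (abar q b (2 ^ k))^-1 * Jfun A0' A1' (2 ^ k) (u k) <= M) ->
  D x -> kabs (extend (u k) x) <= M * Kterm x (2 ^ (- k)).
Proof.
move=> uD uM Dx; have k0 : 0 < 2 ^ k :> R by exact: exprz_gt0.
have kV : 2 ^ (- k) = (2 ^ k)^-1 :> R by rewrite invr_expz.
have [u0 u1] := uD k.
apply: le_trans (dual_Kfun_bound sX0 sX1 k0 u0 u1 Dx) _.
have a0 : 0 < abar q b (2 ^ k) by apply: afun_gt0; rewrite invr_gt0.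
have := uM k; rewrite -mulrA kV ler_pdivrMl// ler_pdivrMl// => h.
have K0 : 0 <= Kf (2 ^ k)^-1 x.
  apply: Kfun_ge0; [exact: X0_ge0|exact: X1_ge0|by rewrite invr_ge0 ltW|].
  by case: Dx => X0x _; exact: sum_set0.
apply: le_trans (ler_wpM2r K0 h) _.
by rewrite /Kterm invrK /abar [leLHS](_ : _ = M * (2 ^ k * afun (2 ^ k)^-1 * Kf (2 ^ k)^-1 x))//; ring.
Qed.

Lemma partial_sum_bound (u : int -> (D -> K)) (M : R) n x : 0 <= M ->
  (forall k, (carrier A0' `&` carrier A1') (u k)) ->
  (forall k, 2 ^ (- k) * (abar q b (2 ^ k))^-1 * Jfun A0' A1' (2 ^ k) (u k) <= M) ->
  D x -> kabs (extend (Zpartial_sum u n n) x) <= M * Ksum x n.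
Proof.
move=> M0 uD uM Dx; rewrite /Zpartial_sum extendD KsumE mulrDr.
have sumE (F : nat -> (D -> K)) (G : nat -> R) :
    (forall i, kabs (extend (F i) x) <= M * Kterm x (G i)) ->
    kabs (extend (\sum_(i < n) F i) x) <= M * \sum_(i < n) Kterm x (G i).
  move=> FG; elim: n => [|m ih]; first by rewrite !big_ord0 extend0 kabs0 mulr0.
  rewrite !big_ord_recr/= extendD mulrDr; apply: le_trans (ler_kabsD _ _) _.
  exact: lerD.
apply: le_trans (ler_kabsD _ _) _; apply: lerD.
  apply: (sumE (fun i => u (Posz i)) (fun i => 2 ^- i)) => i.
  by have := J_term_bound (Posz i) uD uM Dx; rewrite -exprnN.
apply: (sumE (fun i => u (Negz i)) (fun i => 2 ^+ i.+1)) => i.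
by have := J_term_bound (Negz i) uD uM Dx.
Qed.

(** The terms of the series are summed on [D] against [Ksup]; the bound [|phi| <= M Ksup] on [D]
    extends to [E], where [Ksup] is at most [C] times the quasi-norm. *)
Lemma J_to_dual : exists2 C, 0 < C & forall phi (u : int -> (D -> K)) M, 0 <= M ->
  sum_set A0' A1' phi -> J_representation A0' A1' u phi ->
  (forall k, 2 ^ (- k) * (abar q b (2 ^ k))^-1 * Jfun A0' A1' (2 ^ k) (u k) <= M) ->
  dual D E phi /\ qnorm (dual D E) phi <= C * M.
Proof.
have [C C0 CE] := Ksum_bounded; exists C => // phi u M M0 phiS [uD ulim] uM.
have hE := homogeneous_K1 sX0 sX1 q_gt0 b_sv; have [sE nE _] := hE.
have sD := subspace_capD sX0 sX1.
have D0 : D `<=` carrier X0 by move=> ? [].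
have D1 : D `<=` carrier X1 by move=> ? [].
have [h0 h1] := (seminormed_homogeneous sX0, seminormed_homogeneous sX1).
have DE : D `<=` carrier E.
  have [c c0 cJ] := K1_qnorm_le_J sX0 sX1 q_gt0 b_sv b_int.
  by move=> x Dx; exact: (cJ x 1 Dx ltr01).1.
have lphi : linear_on D (extend phi).
  case: phiS => phi0 [phi1 [d0 d1 ->]] a x y Dx Dy; rewrite !extendD.
  rewrite (dual_linear D0 d0 sD)// (dual_linear D1 d1 sD)//; ring.
have dge0 : forall x, A0' x -> 0 <= qnorm A0' x by move=> x; exact: dual_qnorm_ge0.
have dge1 : forall x, A1' x -> 0 <= qnorm A1' x by move=> x; exact: dual_qnorm_ge0.
have sumS m n : sum_set A0' A1' (phi - Zpartial_sum u m n).
  case: phiS => phi0 [phi1 [d0 d1 ->]].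
  exists (phi0 - Zpartial_sum u m n), phi1; split=> //; last by rewrite addrAC.
  apply: dualB => //; apply: dualD => //; apply: dual_sum => // i _.
    by case: (uD (Posz i)).
  by case: (uD (Negz i)).
have phiN x : D x -> kabs (extend phi x) <= M * Ksup x.
  move=> Dx; apply/ler_addgt0Pr => e e0.
  have [X0x X1x] := Dx; have [n0 n1] := (X0_ge0 sX0 X0x, X1_ge0 sX1 X1x).
  (* A remainder split as [psi0 + psi1] acts on [x] by at most [N] times the sum of the norms of its
     parts; the 1 makes [N] positive. *)
  pose N := qnorm X0 x + qnorm X1 x + 1.
  have N0 : 0 < N by rewrite ltr_wpDl ?addr_ge0.
  have eN : 0 < e / N by exact: divr_gt0.
  have [n Kn] : exists n, Kfun A0' A1' 1 (phi - Zpartial_sum u n n) < e / N.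
    have /cvgr0Pnorm_lt /(_ _ eN)[[P Q] /= [[i _ Pi] [j _ Qj]] PQ] := ulim.
    exists (maxn i j); apply: le_lt_trans (ler_norm _) (PQ (maxn i j, maxn i j) _).
    by split; [apply: Pi|apply: Qj]; rewrite /= ?leq_maxl ?leq_maxr.
  have [psi0 [psi1 [d0 d1 psiE psiK]]] := Kfun_lt (sumS n n) Kn.
  have -> : phi = Zpartial_sum u n n + (psi0 + psi1) by rewrite -psiE addrC subrK.
  rewrite (extendD (Zpartial_sum u n n)) (extendD psi0).
  apply: le_trans (ler_kabsD _ _) _; apply: lerD.
    apply: le_trans (partial_sum_bound n M0 uD uM Dx) _.
    by rewrite ler_wpM2l// Ksup_ge//; exact: DE.
  apply: le_trans (ler_kabsD _ _) _.
  apply: le_trans (lerD (dual_bound h0 D0 d0 Dx) (dual_bound h1 D1 d1 Dx)) _.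
  have [m0 m1] := (dge0 _ d0, dge1 _ d1).
  rewrite mul1r in psiK; rewrite -[leRHS](divfK (lt0r_neq0 N0)).
  apply: le_trans (ler_wpM2r (ltW N0) (ltW psiK)).
  rewrite mulrDl; apply: lerD; rewrite ler_wpM2l// /N.
    by rewrite -addrA lerDl addr_ge0.
  by rewrite addrAC lerDr addr_ge0.
have sp : seminorm_on (carrier E) (fun x => M * Ksup x).
  have [ND NZ] := seminorm_Ksup.
  split=> [x y Ex Ey|a x Ex]; first by rewrite -mulrDr ler_wpM2l// ND.
  by rewrite NZ// mulrCA.
(* The extension is dominated by [M * Ksup] and only afterwards compared with the quasi-norm. *)
have [g [lg gM gphi]] := hahn_banach sE sD DE sp lphi phiN.
have gC x : E x -> kabs (g x) <= C * M * qnorm E x.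
  move=> Ex; apply: le_trans (gM _ Ex) _; rewrite mulrAC [leRHS]mulrC ler_wpM2l//.
  by apply: Ksup_le => n; exact: CE.
have cg := bounded_continuous_functional hE lg gC.
have rg : restricts_to g phi by apply/restricts_toP => x Dx; rewrite gphi.
split; first by exists g.
by apply: (dual_qnorm_le hE _ cg rg gC); rewrite mulr_ge0// ltW.
Qed.

End JToDual.

(** * From the K-functional to a J-representation *)

Section Levels.
Context (R : realType) (beta : int -> R) (C : R).
Hypothesis C_ge1 : 1 <= C.
Hypothesis beta_gt0 : forall k, 0 < beta k.
Hypothesis beta_nincr : forall k, beta (k + 1) <= beta k.
Hypothesis beta_doubling : forall k, beta k <= C * beta (k + 1).
Hypothesis beta_cvg0 : forall e, 0 < e -> exists k, beta k < e.
Hypothesis beta_cvgy : forall M, exists k, M < beta k.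

(** The factor [C] compensates for the drop of [beta] in the single step that reaches a level; the
    factor 2 then leaves a gap between successive levels. *)
Definition level_ratio : R := 2 * C.
Local Notation lam := level_ratio.

Lemma level_ratio_gt1 : 1 < lam.
Proof. by rewrite (lt_le_trans (ltr1n R 2))// ler_peMr. Qed.

Lemma beta_homo j k : j <= k -> beta k <= beta j.
Proof.
move=> jk; have [n ->] : exists n : nat, k = j + n%:Z.
  by exists `|k - j|%N; rewrite gez0_abs ?subr_ge0// addrCA subrr addr0.
elim: n => [|n ih]; first by rewrite addr0.
by apply: le_trans ih; rewrite -[n.+1]addn1 PoszD addrA.
Qed.

(** The blow-up of [beta] provides an index above [e] from which to search, its decay one at or
    below [e]; the least such index is taken. *)
Lemma drop_index e : 0 < e -> exists k, beta k <= e < beta (k - 1).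
Proof.
move=> e0; have [i ib] := beta_cvg0 e0; have [j jb] := beta_cvgy e.
have ji : j < i.
  by rewrite ltNge; apply/negP => /beta_homo ij; move: (lt_trans (le_lt_trans ij ib) jb); rewrite ltxx.
have [n ni] : exists n : nat, i = j + n%:Z.
  by exists `|i - j|%N; rewrite gez0_abs ?subr_ge0 ?(ltW ji)// addrCA subrr addr0.
have ex : exists n : nat, beta (j + n%:Z) <= e by exists n; rewrite -ni ltW.
exists (j + (ex_minn ex)%:Z); case: ex_minnP => m mb mmin; rewrite mb/=.
case: m mb mmin => [|m] mb mmin; first by move: mb; rewrite addr0 leNgt jb.
rewrite -[m.+1]addn1 PoszD addrA addrK ltNge; apply/negP => /mmin.
by rewrite ltnn.
Qed.

Lemma level_exists x : 0 < x -> exists m : int, lam ^ (- (m + 1)) < x <= lam ^ (- m).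
Proof.
move=> x0; have l1 := level_ratio_gt1; have l0 : 0 < lam := lt_trans ltr01 l1.
have ll0 : 0 < ln lam by rewrite ln_gt0.
pose y := - ln x / ln lam; exists (Num.floor y).
have /andP[y1 y2] := floor_itv y.
have ye : ln x = - y * ln lam by rewrite /y mulNr divfK ?gt_eqF// opprK.
have lnE (z : int) : ln (lam ^ z) = z%:~R * ln lam by rewrite -powR_intmul ?(ltW l0)// ln_powR.
have lz (z : int) : 0 < lam ^ z by exact: exprz_gt0.
rewrite -ltr_ln ?posrE// -ler_ln ?posrE// !lnE ye.
by rewrite ltr_pM2r// ler_pM2r// !rmorphN/= ltrN2 lerN2 y1 y2.
Qed.

Definition level_start_spec (n : int -> int) :=
  forall m, beta (n m) <= lam ^ (- m) < beta (n m - 1).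

Section LevelStart.
Variable n : int -> int.
Hypothesis nP : level_start_spec n.

Let lam_gt0 : 0 < lam := lt_trans ltr01 level_ratio_gt1.

Let lamS (m : int) : lam ^ (- m) = lam * lam ^ (- (m + 1)).
Proof. by rewrite opprD expfzDr ?gt_eqF// mulrCA mulfV ?mulr1// gt_eqF. Qed.

Let C_gt0 : 0 < C := lt_le_trans ltr01 C_ge1.

Lemma level_start_lower m : 2 * lam ^ (- (m + 1)) < beta (n m).
Proof.
have /andP[_ h] := nP m; have := lt_le_trans h (beta_doubling _).
by rewrite subrK lamS /lam [2 * C]mulrC -mulrA ltr_pM2l.
Qed.

Lemma level_start_lt m : n m < n (m + 1).
Proof.
rewrite ltNge; apply/negP => /beta_homo h; have /andP[h' _] := nP (m + 1).
have := lt_le_trans (level_start_lower m) (le_trans h h').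
by rewrite -[X in _ < X]mul1r ltr_pM2r ?exprz_gt0// ltNge ler1n.
Qed.

Lemma level_gap m : lam ^ (- (m + 1)) <= beta (n m) - beta (n (m + 1)).
Proof.
have /andP[h _] := nP (m + 1); rewrite lerBrDr.
apply: le_trans (ltW (level_start_lower m)); rewrite mulr_natl mulr2n.
by rewrite lerD2l.
Qed.

(** By monotonicity [n m] is the first index where [beta] has fallen to [lam^(-m)]. In this form
    covering and uniqueness of levels become comparisons of powers of [lam]. *)
Lemma level_start_le j m : n m <= j <-> beta j <= lam ^ (- m).
Proof.
have /andP[h1 h2] := nP m; split=> [/beta_homo h|h]; first exact: le_trans h1.
rewrite leNgt; apply/negP => jn; move: h2; rewrite ltNge => /negP; apply.
apply: le_trans h; apply: beta_homo.
by rewrite -ltzD1 subrK.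
Qed.

Lemma level_cover k : exists m, n m <= k < n (m + 1).
Proof.
have [m /andP[m1 m2]] := level_exists (beta_gt0 k); exists m.
rewrite ltNge; apply/andP; split; first exact/level_start_le.
by apply/negP => /level_start_le; rewrite leNgt m1.
Qed.

Lemma level_unique k m m' : n m <= k < n (m + 1) -> n m' <= k < n (m' + 1) -> m = m'.
Proof.
have nm j i : j < i -> n (j + 1) <= n i.
  move=> ji; apply/level_start_le; have /andP[h _] := nP i; apply: le_trans h _.
  by rewrite ler_weXz2l ?(ltW level_ratio_gt1)// lerN2 lezD1.
move=> /andP[h1 h2] /andP[g1 g2]; have [mm|mm|//] := ltgtP m m'.
  by move: (lt_le_trans h2 (le_trans (nm _ _ mm) g1)); rewrite ltxx.
by move: (lt_le_trans g2 (le_trans (nm _ _ mm) h1)); rewrite ltxx.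
Qed.

End LevelStart.

End Levels.

Section BlockDecomposition.
Context (R : realType) (s : scalars).
Local Notation K := (scalar_field R s).
Context (V : lmodType K) (D : set V) (X0 X1 : qspace R V).
Hypothesis sX0 : seminormed X0.
Hypothesis sX1 : seminormed X1.
Hypothesis sD : subspace D.
Hypothesis D0 : D `<=` carrier X0.
Hypothesis D1 : D `<=` carrier X1.
Local Notation A0' := (dual D X0).
Local Notation A1' := (dual D X1).
Context (beta : int -> R) (C : R).
Hypothesis C_ge1 : 1 <= C.
Hypothesis beta_gt0 : forall k, 0 < beta k.
Hypothesis beta_nincr : forall k, beta (k + 1) <= beta k.
Hypothesis beta_doubling : forall k, beta k <= C * beta (k + 1).
Hypothesis beta_cvg0 : forall e, 0 < e -> exists k, beta k < e.
Hypothesis beta_cvgy : forall M, exists k, M < beta k.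
Context (phi : D -> K) (chi : int -> (D -> K)) (M : R).
Hypothesis M_ge0 : 0 <= M.
Hypothesis chi0 : forall j, A0' (chi j) /\ qnorm A0' (chi j) <= M * (2 ^ j * beta j).
Hypothesis chi1 : forall j, A1' (phi - chi j) /\ qnorm A1' (phi - chi j) <= M * beta j.
Hypothesis chi_small : forall e, 0 < e -> exists k, forall j, j <= k -> qnorm A0' (chi j) < e.

Local Notation lam := (level_ratio C).

(** [P k] interpolates [chi] between the starts [n m.-1] and [n m] of the
    levels around [k], linearly in [beta k]; hence [P (k + 1) - P k] is
    [beta k - beta (k + 1)] times a bounded slope. *)
Lemma block_decomposition : exists u : int -> (D -> K),
  [/\ J_representation A0' A1' u phi,
      forall k, Jfun A0' A1' (2 ^ k) (u k) <=
        lam * (1 + lam) * M * 2 ^ k * (beta k - beta (k + 1)) &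
      forall k, (forall j, j <= k + 1 -> chi j = 0) -> u k = 0].
Proof.
have l1 := level_ratio_gt1 C_ge1; have l0 : 0 < lam := lt_trans ltr01 l1.
have lz (z : int) : 0 < lam ^ z by exact: exprz_gt0.
have /choice[n nP] : forall m : int, exists k, beta k <= lam ^ (- m) < beta (k - 1).
  by move=> m; apply: drop_index.
have /choice[mu muP] := level_cover C_ge1 beta_gt0 beta_nincr nP.
have bhomo := beta_homo beta_nincr.
(* The level of [k] starts at [p k] and ends before [e k]; [r k] starts the previous one. Lagging
   one level behind keeps both nodes [r k] and [p k] at or before [k], so that their powers of 2 are
   at most [2^k]; the price is a factor [lam] in [beta]. *)
pose p k := n (mu k); pose r k := n (mu k - 1); pose e k := n (mu k + 1).
have rp k : r k < p k.
  by have := level_start_lt C_ge1 beta_nincr beta_doubling nP (mu k - 1); rewrite subrK.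
have pk k : p k <= k by have /andP[] := muP k.
have ke k : k < e k by have /andP[] := muP k.
have gap k : 0 < beta (p k) - beta (e k).
  apply: lt_le_trans (lz (- (mu k + 1))) _.
  exact: (level_gap C_ge1 beta_doubling nP (mu k)).
pose th k := (beta (p k) - beta k) / (beta (p k) - beta (e k)).
have th01 k : 0 <= th k <= 1.
  rewrite divr_ge0 ?(ltW (gap k)) ?subr_ge0 ?bhomo//= ler_pdivrMr// mul1r.
  by rewrite lerD2l lerN2 bhomo// ltW.
pose P k := combo (1 - th k) (th k) (chi (r k)) (chi (p k)).
pose c k := (beta k - beta (k + 1)) / (beta (p k) - beta (e k)).
have c0 k : 0 <= c k by apply: divr_ge0; [rewrite subr_ge0|exact: ltW].
pose u k := combo (c k) (- c k) (chi (p k)) (chi (r k)).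
(* Inside a level [c k] is the increment of [th]. When [k + 1] starts a new level, [th (k + 1) = 0]
   and [P (k + 1) = chi (p k)], the node towards which [P] was moving; hence [c k = 1 - th k] and
   the formula persists. *)
have uE k : u k = P (k + 1) - P k.
  have gap0 : beta (p k) - beta (e k) != 0 by rewrite gt_eqF.
  have [k1|k1] := ltP (k + 1) (e k).
    have mk : mu (k + 1) = mu k.
      apply: (level_unique C_ge1 beta_nincr nP (muP _)).
      by rewrite k1 andbT; apply: le_trans (pk k) _; rewrite lerDl.
    have cE : c k = th (k + 1) - th k.
      by rewrite /c /th /p /e mk -mulrBl; congr (_ / _); ring.
    apply/funext => x; rewrite /u /P /combo /r /p mk cE.
    rewrite -[RHS]/(_ - _) !(of_realD, of_realN, of_real1); ring.
  have {}k1 : k + 1 = e k.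
    by apply/eqP; rewrite eq_le k1 andbT lezD1 ke.
  have mk : mu (k + 1) = mu k + 1.
    apply: (level_unique C_ge1 beta_nincr nP (muP _)).
    rewrite k1 lexx /=; exact: (level_start_lt C_ge1 beta_nincr beta_doubling nP).
  have th1 : th (k + 1) = 0 by rewrite /th /p mk k1 subrr mul0r.
  have cE : c k = 1 - th k.
    rewrite /c /th -(divff gap0) -mulrBl k1; congr (_ / _); ring.
  apply/funext => x; rewrite /u /P th1 cE /combo /r mk addrK -/(p k) -/(r k).
  by rewrite -[RHS]/(_ - _) !(of_realD, of_realN, of_real1, of_real0); ring.
have kb0 k : 0 < 2 ^ k :> R by exact: exprz_gt0.
have pB k : beta (p k) <= lam ^ (- mu k).
  exact/(level_start_le beta_nincr nP).
have rB k : beta (r k) <= lam * lam ^ (- mu k).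
  apply: le_trans (_ : lam ^ (- (mu k - 1)) <= _).
    exact/(level_start_le beta_nincr nP).
  by rewrite opprB expfzDr ?gt_eqF// expr1z.
have pow_le j k : j <= k -> 2 ^ j <= 2 ^ k :> R.
  by move=> jk; rewrite ler_weXz2l ?ler1n.
have ll k : lam ^ (mu k + 1) * lam ^ (- mu k) = lam.
  by rewrite -expfzDr ?gt_eqF// addrAC subrr add0r expr1z.
have cle k : c k <= (beta k - beta (k + 1)) * lam ^ (mu k + 1).
  apply: ler_wpM2l; first by rewrite subr_ge0.
  rewrite -[leRHS]invrK lef_pV2 ?posrE ?invr_gt0// invr_expz.
  exact: (level_gap C_ge1 beta_doubling nP (mu k)).
(* The denominator of [c k] is at least [lam^(-(mu + 1))], while the norms at the two nodes are of
   order [lam^(-mu)] and [lam^(1 - mu)]; the powers cancel to [lam (1 + lam)]. *)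
have slope k (N N' : R) (A : R) : N <= A * lam ^ (- mu k) ->
    N' <= A * (lam * lam ^ (- mu k)) -> 0 <= A -> 0 <= N + N' ->
    c k * (N + N') <= lam * (1 + lam) * A * (beta k - beta (k + 1)).
  move=> NA NA' A0 NN; apply: le_trans (ler_wpM2r NN (cle k)) _.
  have d0 : 0 <= beta k - beta (k + 1) by rewrite subr_ge0.
  rewrite -[leLHS]mulrA.
  apply: le_trans (ler_wpM2l d0 (ler_wpM2l (ltW (lz (mu k + 1))) (lerD NA NA'))) _.
  rewrite [leLHS](_ : _ = (beta k - beta (k + 1)) * (A * (1 + lam)) *
    (lam ^ (mu k + 1) * lam ^ (- mu k))); last by ring.
  by rewrite ll [leRHS](_ : _ = (beta k - beta (k + 1)) * (A * (1 + lam)) * lam)//; ring.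
have q0 j : 0 <= qnorm A0' (chi j).
  by apply: dual_qnorm_ge0 (chi0 j).1; exact: seminormed_homogeneous.
have q1 j : 0 <= qnorm A1' (phi - chi j).
  by apply: dual_qnorm_ge0 (chi1 j).1; exact: seminormed_homogeneous.
have bound0 k : A0' (u k) /\ qnorm A0' (u k) <=
    2 ^ k * (lam * (1 + lam) * M * (beta k - beta (k + 1))).
  have [d le_u] := dual_combo sX0 sD D0 (c k) (- c k) (chi0 (p k)).1 (chi0 (r k)).1.
  split=> //; apply: le_trans le_u _; rewrite normrN ger0_norm// -mulrDr.
  rewrite [leRHS](_ : _ = lam * (1 + lam) * (M * 2 ^ k) * (beta k - beta (k + 1))); last by ring.
  apply: slope; rewrite ?addr_ge0 ?mulr_ge0 ?(ltW (kb0 k))//.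
    apply: le_trans (chi0 _).2 _; rewrite -mulrA ler_wpM2l//.
    by rewrite ler_pM ?(ltW (kb0 _)) ?(ltW (beta_gt0 _)) ?pow_le.
  apply: le_trans (chi0 _).2 _; rewrite -mulrA ler_wpM2l//.
  rewrite ler_pM ?(ltW (kb0 _)) ?(ltW (beta_gt0 _)) ?pow_le//.
  exact: le_trans (ltW (rp k)) (pk k).
have bound1 k : A1' (u k) /\ qnorm A1' (u k) <=
    lam * (1 + lam) * M * (beta k - beta (k + 1)).
  (* In [A1'] only the differences [phi - chi] are bounded; subtracting both nodes from [phi]
     exchanges their roles. *)
  have -> : u k = combo (c k) (- c k) (phi - chi (r k)) (phi - chi (p k)).
    apply/funext => x; rewrite /u /combo -[(phi - chi (r k)) x]/(_ - _).
    by rewrite -[(phi - chi (p k)) x]/(_ - _) of_realN; ring.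
  have [d le_u] := dual_combo sX1 sD D1 (c k) (- c k) (chi1 (r k)).1 (chi1 (p k)).1.
  split=> //; apply: le_trans le_u _; rewrite normrN ger0_norm// -mulrDr addrC.
  apply: slope => //.
  - by apply: le_trans (chi1 _).2 _; rewrite ler_wpM2l.
  - by apply: le_trans (chi1 _).2 _; rewrite ler_wpM2l.
  - by rewrite addr_ge0.
have rk k : r k <= k by exact: le_trans (ltW (rp k)) (pk k).
have P0 k : A0' (P k) /\ qnorm A0' (P k) <=
    (1 - th k) * qnorm A0' (chi (r k)) + th k * qnorm A0' (chi (p k)).
  have /andP[t0 t1] := th01 k.
  have := dual_combo sX0 sD D0 (1 - th k) (th k) (chi0 (r k)).1 (chi0 (p k)).1.
  by rewrite [`|th k|]ger0_norm// ger0_norm// subr_ge0.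
have P1 k : A1' (phi - P k) /\ qnorm A1' (phi - P k) <= M * lam * lam * beta k.
  have -> : phi - P k = combo (1 - th k) (th k) (phi - chi (r k)) (phi - chi (p k)).
    apply/funext => x; rewrite /P /combo -[(phi - chi (r k)) x]/(_ - _).
    rewrite -[(phi - chi (p k)) x]/(_ - _) -[LHS]/(_ - _).
    by rewrite of_realD of_realN of_real1; ring.
  have /andP[t0 t1] := th01 k; have t1' : 0 <= 1 - th k by rewrite subr_ge0.
  have [d le_u] := dual_combo sX1 sD D1 (1 - th k) (th k) (chi1 (r k)).1 (chi1 (p k)).1.
  split=> //; apply: le_trans le_u _; rewrite [`|th k|]ger0_norm// ger0_norm//.
  have bk : lam ^ (- mu k) <= lam * beta k.
    have -> : lam ^ (- mu k) = lam * lam ^ (- (mu k + 1)).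
      by rewrite opprD expfzDr ?gt_eqF// mulrCA mulfV ?mulr1// gt_eqF.
    rewrite ler_pM2l// ltW// ltNge; apply/negP => /(level_start_le beta_nincr nP).
    by rewrite leNgt ke.
  have lk : M * (lam * lam ^ (- mu k)) <= M * lam * lam * beta k.
    rewrite [leRHS](_ : _ = M * (lam * (lam * beta k))); last by ring.
    by rewrite ler_wpM2l// ler_wpM2l ?(ltW l0).
  apply: le_trans lk; set A := M * (lam * _).
  have Ar : qnorm A1' (phi - chi (r k)) <= A.
    by apply: le_trans (chi1 _).2 _; rewrite ler_wpM2l.
  have Ap : qnorm A1' (phi - chi (p k)) <= A.
    apply: le_trans (chi1 _).2 _; rewrite ler_wpM2l//; apply: le_trans (pB k) _.
    by rewrite ler_peMl ?(ltW (lz _)) ?(ltW l1).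
  apply: le_trans (lerD (ler_wpM2l t1' Ar) (ler_wpM2l t0 Ap)) _.
  by rewrite -mulrDl subrK mul1r.
(* The series telescopes, so the remainder is [P (- m) + (phi - P j)]: its first part tends to 0 in
   [A0'] and its second in [A1']. *)
have ZE m j : Zpartial_sum u m j = P j%:Z - P (- m%:Z).
  have posE : \sum_(i < j) u (Posz i) = P j%:Z - P 0.
    elim: j => [|j ih]; first by rewrite big_ord0 subrr.
    by rewrite big_ord_recr /= ih uE -PoszD addn1 addrC addrA subrK.
  have negE : \sum_(i < m) u (Negz i) = P 0 - P (- m%:Z).
    elim: m => [|m ih]; first by rewrite big_ord0 oppr0 subrr.
    have m1 : Negz m + 1 = - m%:Z by rewrite NegzE -addn1 PoszD opprD subrK.
    by rewrite big_ord_recr /= ih uE m1 addrA subrK.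
  by rewrite /Zpartial_sum posE negE addrA subrK.
have dge0 : forall x, A0' x -> 0 <= qnorm A0' x.
  by move=> x; apply: dual_qnorm_ge0; exact: seminormed_homogeneous.
have dge1 : forall x, A1' x -> 0 <= qnorm A1' x.
  by move=> x; apply: dual_qnorm_ge0; exact: seminormed_homogeneous.
exists u; split.
- split=> [k|]; first by split; [case: (bound0 k)|case: (bound1 k)].
  apply/cvgrPdist_lt => eps eps0 /=.
  have eps3 : 0 < eps / 3 by exact: divr_gt0.
  have [k0 k0P] := chi_small eps3.
  have Mll : 0 <= M * lam * lam.
    by apply: mulr_ge0 (ltW l0); apply: mulr_ge0 (ltW l0).
  have [k1 k1P] : exists k1, M * lam * lam * beta k1 < eps / 2.
    have A0 : 0 < M * lam * lam + 1 by rewrite ltr_wpDl.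
    have [k1 k1e] := beta_cvg0 (divr_gt0 (divr_gt0 eps0 (ltr0n _ 2)) A0); exists k1.
    move: k1e; rewrite ltr_pdivlMr// mulrC; apply: le_lt_trans.
    by rewrite ler_wpM2r ?lerDl// ltW.
  exists ([set m | (`|k0| <= m)%N], [set j | (`|k1| <= j)%N]) => /=.
    by split; [exists `|k0|%N|exists `|k1|%N].
  move=> [m j] /= [k0m k1j]; rewrite ZE sub0r normrN.
  have mk0 : - m%:Z <= k0.
    rewrite lerNl; apply: le_trans (ler_norm _) _.
    by rewrite normrN -abszE lez_nat.
  have k1j' : k1 <= j%:Z by apply: le_trans (ler_norm _) _; rewrite -abszE lez_nat.
  rewrite opprB addrCA.
  have S : sum_set A0' A1' (P (- m%:Z) + (phi - P j%:Z)).
    by exists (P (- m%:Z)), (phi - P j%:Z); split=> //; [case: (P0 (- m%:Z))|case: (P1 j%:Z)].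
  rewrite ger0_norm; last exact: (Kfun_ge0 dge0 dge1 ler01 S).
  apply: le_lt_trans (Kfun_le dge0 dge1 ler01 (P0 (- m%:Z)).1 (P1 j%:Z).1) _.
  rewrite mul1r [eps]splitr; apply: ltrD; last first.
    apply: le_lt_trans (P1 j%:Z).2 _; apply: le_lt_trans k1P.
    by rewrite ler_wpM2l ?bhomo.
  apply: le_lt_trans (P0 (- m%:Z)).2 _.
  have /andP[t0 t1] := th01 (- m%:Z); have t1' : 0 <= 1 - th (- m%:Z) by rewrite subr_ge0.
  have small i : i <= - m%:Z -> qnorm A0' (chi i) <= eps / 3.
    by move=> im; apply/ltW/k0P; exact: le_trans im mk0.
  apply: (@le_lt_trans _ _ (eps / 3)); last by rewrite ltr_pM2l// ltf_pV2 ?posrE// ltr_nat.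
  apply: le_trans (lerD (ler_wpM2l t1' (small _ (rk _))) (ler_wpM2l t0 (small _ (pk _)))) _.
  by rewrite -mulrDl subrK mul1r.
- move=> k; rewrite /Jfun ge_max; have [_ u0] := bound0 k; have [_ u1] := bound1 k.
  have -> : lam * (1 + lam) * M * 2 ^ k * (beta k - beta (k + 1)) =
    2 ^ k * (lam * (1 + lam) * M * (beta k - beta (k + 1))) by ring.
  by rewrite u0 ler_wpM2l ?(ltW (kb0 k)).
- move=> k chik; have kk1 : k <= k + 1 by rewrite lerDl.
  have c1 := chik _ (le_trans (rk k) kk1); have c2 := chik _ (le_trans (pk k) kk1).
  by apply/funext => x; rewrite /u c1 c2 /combo -[(0 : D -> K) x]/0 !mulr0 addr0.
Qed.

End BlockDecomposition.

(** * The three inclusions *)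

Section WeightB.
Context (R : realType) (q : R) (b : R -> R).
Hypothesis q_gt0 : 0 < q.
Hypothesis q_le1 : q <= 1.
Hypothesis b_sv : slowly_varying b.
Hypothesis b_int : forall t : R, 0 < t -> (int_bq q b `]0%R, t[ < +oo)%E.
Local Notation BQ := (BQ q b).
Local Notation Bfun := (Bfun q b).
Local Notation afun := (afun q b).

Let qV0 : 0 <= q^-1. Proof. by rewrite invr_ge0 ltW. Qed.

Let BqK x : 0 <= x -> (x `^ q) `^ q^-1 = x.
Proof. by move=> x0; rewrite -powRrM mulfV ?gt_eqF// powRr1. Qed.

Lemma Bfun_homo x y : 0 < x -> x <= y -> Bfun x <= Bfun y.
Proof. by move=> x0 xy; apply: ler_powRl => //; [exact: BQ_ge0|exact: BQ_homo]. Qed.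

Lemma Bfun_doubling : exists2 C, 1 <= C & forall t, 0 < t -> Bfun (2 * t) <= C * Bfun t.
Proof.
have [c c1 cB] := BQ_doubling q_gt0 b_sv b_int.
exists (c `^ q^-1); first exact: powR_ge1.
move=> t t0; rewrite -powRM ?BQ_ge0//; last exact: le_trans ler01 c1.
by apply: ler_powRl; [|exact: BQ_ge0|exact: cB].
Qed.

(** The concave function [z^q] lies below its tangent at 1. This is Young's inequality for [z^q] and
    1 with exponents [1/q] and [1/(1-q)], whence the separate case [q = 1]. *)
Lemma powR_tangent z : 0 <= z -> z `^ q <= 1 + q * (z - 1).
Proof.
move=> z0; have [->|q1] := eqVneq q 1; first by rewrite powRr1// mul1r addrC subrK.
have q1' : 0 < 1 - q by rewrite subr_gt0 lt_neqAle q1.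
have := @conjugate_powR R (z `^ q) 1 q^-1 (1 - q)^-1 (powR_ge0 _ _) ler01.
rewrite !invr_gt0 => /(_ q_gt0 q1'); rewrite !invrK addrC subrK => /(_ erefl).
rewrite mulr1 BqK// (_ : 1 `^ _ = 1) ?powR1// => /le_trans; apply.
by rewrite [leLHS](_ : _ = 1 + q * (z - 1))//; ring.
Qed.

(** With [z = B(t/2) / B(t)] the tangent inequality reads [q (1 - z) <= 1 - z^q]. Multiplied by
    [B(t)], it turns a difference of [B] into [B(t)^(1-q)] times a difference of [B^q], which
    [BQ_ge_weight] bounds by [b(t)^q]. *)
Lemma Bfun_diff : exists2 c, 0 < c & forall t, 0 < t -> Bfun t - Bfun (t / 2) <= c * afun t.
Proof.
have [c c1 cB] := BQ_ge_weight q_gt0 b_sv b_int; have c0 := lt_le_trans ltr01 c1.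
exists c => // t t0; have [_ h] := cB _ t0.
have Bt := Bfun_gt0 q_gt0 b_sv b_int t0; have t20 := half_gt0 t0.
have Bt2 := Bfun_gt0 q_gt0 b_sv b_int t20.
pose z := Bfun (t / 2) / Bfun t; have z0 : 0 <= z := divr_ge0 (ltW Bt2) (ltW Bt).
have Bz : Bfun (t / 2) = z * Bfun t by rewrite divfK// (gt_eqF Bt).
have := powR_tangent z0; rewrite -lerBlDl -(ler_pM2r Bt).
have split_pow : Bfun t = Bfun t `^ (1 - q) * Bfun t `^ q.
  rewrite -powRD ?subrK; first by rewrite (powRr1 (ltW Bt)).
  by apply/implyP; rewrite oner_eq0.
move=> tangent.
have step : q * (Bfun t - Bfun (t / 2)) <= Bfun t `^ (1 - q) * (BQ t - BQ (t / 2)).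
  rewrite -!(Bfun_powR b q_gt0) Bz (powRM _ z0 (ltW Bt)).
  rewrite [leRHS](_ : _ = Bfun t `^ (1 - q) * Bfun t `^ q * (1 - z `^ q)); last by ring.
  rewrite -split_pow -subr_ge0 (_ : _ - _ = q * (z - 1) * Bfun t - (z `^ q - 1) * Bfun t).
    by rewrite subr_ge0.
  by ring.
rewrite -(ler_pM2l q_gt0); apply: le_trans step _.
rewrite /Defs.afun [leRHS](_ : _ = Bfun t `^ (1 - q) * (c * b t `^ q)); last first.
  rewrite [LHS](_ : _ = q * q^-1 * (Bfun t `^ (1 - q) * (c * b t `^ q))); last by ring.
  by rewrite mulfV ?gt_eqF// mul1r.
by rewrite ler_wpM2l ?powR_ge0.
Qed.

Lemma Bfun_small e : 0 < e -> exists2 t, 0 < t & Bfun t < e.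
Proof.
move=> e0; have [t t0 te] := BQ_small b_sv b_int (powR_gt0 q e0).
exists t => //; rewrite -[e]BqK ?(ltW e0)//.
by rewrite gt0_ltr_powR ?invr_gt0 ?nnegrE ?BQ_ge0 ?powR_ge0.
Qed.

Lemma Bfun_large M : int_bq q b `]0, +oo[ = +oo%E -> exists2 t, 0 < t & M < Bfun t.
Proof.
move=> byy; have [t t0 Mt] := BQ_large b_sv b_int byy (Num.max M 0 `^ q).
exists t => //; apply: (@le_lt_trans _ _ (Num.max M 0)); first by rewrite le_max lexx.
have M0 : 0 <= Num.max M 0 by rewrite le_max lexx orbT.
rewrite -[Num.max M 0]BqK//.
by rewrite gt0_ltr_powR ?invr_gt0 ?nnegrE ?BQ_ge0 ?powR_ge0.
Qed.

(** By [BQ_growth] the quotient is at most [M' / y] with [y = 2^(n/2)]. *)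
Lemma Bfun_div_small e : 0 < e ->
  exists n0 : nat, forall n, (n0 <= n)%N -> Bfun (2 ^+ n) / 2 ^+ n < e.
Proof.
move=> e0; have [M M0 BM] := BQ_growth q_gt0 b_sv b_int.
pose M' := M `^ q^-1; have M'0 : 0 < M' by exact: powR_gt0.
exists (Num.truncn ((M' / e) ^+ 2)).+1 => n n0.
have n2 : (M' / e) ^+ 2 < 2 ^+ n :> R.
  apply: lt_trans (truncnS_gt _) _; by rewrite -natrX ltr_nat (leq_ltn_trans n0)// ltn_expl.
pose y : R := Num.sqrt (2 ^+ n); have y0 : 0 < y by rewrite sqrtr_gt0 exprn_gt0.
have yy : 2 ^+ n = y * y :> R by rewrite -expr2 sqr_sqrtr// exprn_ge0.
have ye : M' / e < y.
  rewrite /y -[M' / e]gtr0_norm ?divr_gt0// -sqrtr_sqr ltr_sqrt ?exprn_gt0//.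
have By : Bfun (2 ^+ n) <= M' * y.
  have -> : M' * y = (M * (2 ^+ n) `^ (q / 2)) `^ q^-1.
    rewrite (powRM _ (ltW M0) (powR_ge0 _ _)) -powRrM mulrAC mulfV ?gt_eqF// mul1r.
    by rewrite powR12_sqrt// exprn_ge0.
  by apply: ler_powRl; [|exact: BQ_ge0|exact: BM].
rewrite ltr_pdivrMr ?exprn_gt0//; apply: le_lt_trans By _.
by rewrite yy mulrA ltr_pM2r// mulrC -ltr_pdivrMr.
Qed.

Lemma btildeE t : 0 < t -> btilde q b t = (Bfun t^-1)^-1.
Proof.
move=> t0; rewrite /btilde; congr (_^-1); rewrite /Lr_norm unlock /=.
rewrite (_ : (\int[leb R]_x _)%E = int_bq q b `]0, t^-1[); last first.
  rewrite /int_bq [RHS]integral_mkcond; apply: eq_integral => x _.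
  rewrite !patchE; case: ifPn => [|_]; last by rewrite abse0 poweR0r ?gt_eqF.
  rewrite inE/= in_itv/= => /andP[x0 _]; congr (_%:E).
  have bx := sv_gt0 b_sv x0.
  rewrite ger0_norm ?mulr_ge0 ?powR_ge0 ?(ltW bx)// powRM ?powR_ge0 ?(ltW bx)//.
  by rewrite -powRrM mulNr mulVf ?gt_eqF// powR_inv1 ?(ltW x0)// mulrC.
have tV : 0 < t^-1 by rewrite invr_gt0.
by have := BQE b_int tV; rewrite /lint /int_bq => ->; rewrite poweR_EFin.
Qed.

End WeightB.

(** * The K-space with [r = +oo]: from essential to pointwise bounds *)

Section SupSpaces.
Context (R : realType) (q : R) (b : R -> R).
Hypothesis q_gt0 : 0 < q.
Hypothesis b_sv : slowly_varying b.
Hypothesis b_int : forall t : R, 0 < t -> (int_bq q b `]0%R, t[ < +oo)%E.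
Context (W : zmodType) (Y0 Y1 : qspace R W).
Hypothesis Y0_ge0 : forall x, Y0 x -> 0 <= qnorm Y0 x.
Hypothesis Y1_ge0 : forall x, Y1 x -> 0 <= qnorm Y1 x.
Local Notation Bfun := (Bfun q b).
Local Notation Kf := (Kfun Y0 Y1).
Local Notation KY := (K1_space Y0 Y1 +oo%E (btilde q b)).

Let integrand (phi : W) (t : R) : R :=
  t `^ (- 1 - fine ((+oo : \bar R)^-1)%E) * btilde q b t * Kf t phi.

Let integrandE phi t : 0 < t -> integrand phi t = (t * Bfun t^-1)^-1 * Kf t phi.
Proof.
move=> t0; rewrite /integrand invey /= subr0 (powR_inv1 (ltW t0)).
by rewrite (btildeE q_gt0 b_sv b_int t0) invfM.
Qed.

(** The [Lnorm] of exponent [+oo] unfolds to the essential supremum when the whole space has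
    positive measure. *)
Let leb_gt0 : (0 < leb R [set: R])%E.
Proof.
apply: (@lt_le_trans _ _ (leb R `[0, 1[%classic)).
  by rewrite leb_itv// lte_fin subr0.
apply: le_measure; rewrite ?inE//; first exact: measurable_itvL.
Qed.

Let K1E phi : K1_norm Y0 Y1 +oo%E (btilde q b) phi =
  ess_sup (leb R) (fun x => `|patch (fun=> 0%E) `]0%R, +oo[ (EFin \o integrand phi) x|%E).
Proof. by rewrite /K1_norm /Lr_norm unlock leb_gt0. Qed.

Let K1_ge0 phi : (0 <= K1_norm Y0 Y1 +oo%E (btilde q b) phi)%E.
Proof. exact: Lnorm_ge0. Qed.

Lemma Ksup_space_intro phi M : 0 <= M -> sum_set Y0 Y1 phi ->
  (forall t, 0 < t -> Kf t phi <= M * (t * Bfun t^-1)) -> KY phi /\ qnorm KY phi <= M.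
Proof.
move=> M0 ff fM.
have le_M : (K1_norm Y0 Y1 +oo%E (btilde q b) phi <= M%:E)%E.
  rewrite K1E; apply/ess_supP; apply: nearW => x; rewrite patchE.
  case: ifPn => [|_]; last by rewrite abse0 lee_fin.
  rewrite inE/= in_itv/= andbT => x0; rewrite /= integrandE// lee_fin.
  have xB : 0 < x * Bfun x^-1.
    by apply: mulr_gt0 => //; apply: (Bfun_gt0 q_gt0 b_sv b_int); rewrite invr_gt0.
  rewrite ger0_norm; last first.
    apply: mulr_ge0; first by rewrite invr_ge0 ltW.
    by apply: Kfun_ge0 => //; exact: ltW.
  by rewrite ler_pdivrMl// mulrC fM.
have fi : (K1_norm Y0 Y1 +oo%E (btilde q b) phi < +oo)%E.
  by apply: le_lt_trans le_M _; rewrite ltry.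
split; first by split.
by rewrite -lee_fin /= fineK// ge0_fin_numE.
Qed.

(** The norm bounds the integrand only almost everywhere, but some good point lies in [[t, 2 t[], a
    set of positive measure. Monotonicity of [K] and of [B] carries the bound back to [t], at the
    cost of the factor 2. *)
Lemma Ksup_space_bound phi t : KY phi -> 0 < t ->
  Kf t phi <= 2 * qnorm KY phi * (t * Bfun t^-1).
Proof.
move=> [ff fi] t0.
have NE : K1_norm Y0 Y1 +oo%E (btilde q b) phi = (qnorm KY phi)%:E.
  by rewrite fineK// ge0_fin_numE.
have N0 : 0 <= qnorm KY phi by exact: fine_ge0.
have := @ess_sup_ge _ _ _ (leb R)
  (fun x => `|patch (fun=> 0%E) `]0%R, +oo[ (EFin \o integrand phi) x|%E).
rewrite -K1E NE => -[A [mA A0 nA]].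
have [x xt xN] : exists2 x, t <= x < 2 * t & integrand phi x <= qnorm KY phi.
  apply: contrapT => nx.
  have tA : `[t, 2 * t[ `<=` A.
    move=> x /=; rewrite in_itv/= => xt; apply: nA => /= xN; apply: nx; exists x => //.
    have x0 : 0 < x by case/andP: xt => tx _; exact: lt_le_trans tx.
    move: xN; rewrite patchE ifT; last by rewrite inE/= in_itv/= andbT.
    by rewrite /= lee_fin; apply: le_trans; exact: ler_norm.
  have tt : t <= 2 * t by rewrite ler_peMl ?ler1n ?(ltW t0).
  have : (leb R `[t, (2 * t)%R[%classic <= 0)%E.
    rewrite -A0; apply: le_measure; rewrite ?inE//; exact: measurable_itvL.
  by rewrite leb_itv// lee_fin (_ : 2 * t - t = t) ?leNgt ?t0//; ring.
have /andP[tx x2t] := xt; have x0 : 0 < x := lt_le_trans t0 tx.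
have xV : 0 < x^-1 by rewrite invr_gt0.
have Bx := Bfun_gt0 q_gt0 b_sv b_int xV.
move: xN; rewrite integrandE// ler_pdivrMl; last exact: mulr_gt0.
move=> xN; apply: le_trans (Kfun_homo Y0_ge0 Y1_ge0 (ltW t0) tx ff) _.
apply: le_trans xN _; rewrite mulrC [leRHS](_ : _ = qnorm KY phi * ((2 * t) * Bfun t^-1)); last by ring.
apply: (ler_wpM2l N0); apply: (ler_pM (ltW x0) (ltW Bx) (ltW x2t)).
have tV : 0 < t^-1 by rewrite invr_gt0.
by apply: (Bfun_homo q_gt0 b_sv b_int xV); rewrite lef_pV2 ?posrE.
Qed.

End SupSpaces.

Lemma dual_zero (R : realType) (s : scalars) (V : lmodType (scalar_field R s))
    (D : set V) (X : qspace R V) :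
  seminormed X -> subspace D -> D `<=` carrier X ->
  dual D X 0 /\ qnorm (dual D X) 0 <= 0.
Proof.
move=> sX sD DX; apply: dual_intro => //.
  by move=> a x y _ _; rewrite !extend0 mulr0 addr0.
by move=> x _; rewrite extend0 kabs0 mul0r.
Qed.

Section DualityMaps.
Context (R : realType) (s : scalars).
Local Notation K := (scalar_field R s).
Context (V : lmodType K) (X0 X1 : qspace R V).
Hypothesis sX0 : seminormed X0.
Hypothesis sX1 : seminormed X1.
Context (q : R) (b : R -> R).
Hypothesis q_gt0 : 0 < q.
Hypothesis q_le1 : q <= 1.
Hypothesis b_sv : slowly_varying b.
Hypothesis b_int : forall t : R, 0 < t -> (int_bq q b `]0%R, t[ < +oo)%E.
Local Notation D := (carrier X0 `&` carrier X1).
Local Notation E := (K1_space X0 X1 q%:E b).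
Local Notation A0' := (dual D X0).
Local Notation A1' := (dual D X1).
Local Notation E' := (dual D E).
Local Notation J' := (J1_space A0' A1' +oo%E (fun t => (abar q b t)^-1)).
Local Notation K' := (K1_space A0' A1' +oo%E (btilde q b)).
Local Notation Bfun := (Bfun q b).
Local Notation afun := (afun q b).

Let hE := homogeneous_K1 sX0 sX1 q_gt0 b_sv.
Let h0 := seminormed_homogeneous sX0.
Let h1 := seminormed_homogeneous sX1.
Let sD := subspace_capD sX0 sX1.

Let D0 : D `<=` carrier X0. Proof. by move=> ? []. Qed.
Let D1 : D `<=` carrier X1. Proof. by move=> ? []. Qed.

Lemma D_sub_K1 : D `<=` carrier E.
Proof.
have [c c0 cJ] := K1_qnorm_le_J sX0 sX1 q_gt0 b_sv b_int.
by move=> x Dx; exact: (cJ x 1 Dx ltr01).1.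
Qed.

Let A0_ge0 x : A0' x -> 0 <= qnorm A0' x. Proof. exact: dual_qnorm_ge0. Qed.
Let A1_ge0 x : A1' x -> 0 <= qnorm A1' x. Proof. exact: dual_qnorm_ge0. Qed.

Let E'_bound phi x : E' phi -> D x ->
  kabs (extend phi x) <= qnorm E' phi * qnorm E x.
Proof. by move=> dphi Dx; apply: dual_bound => //; exact: D_sub_K1. Qed.

Lemma dual_to_K1 : exists2 C, 0 < C & forall phi, E' phi ->
  K' phi /\ qnorm K' phi <= C * qnorm E' phi.
Proof.
have [c c0 cJ] := K1_qnorm_le_J sX0 sX1 q_gt0 b_sv b_int.
exists (2 * c) => [|phi dphi]; first by rewrite mulr_gt0.
have N0 : 0 <= qnorm E' phi := dual_qnorm_ge0 hE dphi.
have lphi := dual_linear D_sub_K1 dphi sD.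
have dec t : 0 < t -> exists phi0 phi1, [/\ phi = phi0 + phi1, A0' phi0, A1' phi1 &
    qnorm A0' phi0 + t * qnorm A1' phi1 <= 2 * c * qnorm E' phi * (t * Bfun t^-1)].
  move=> t0; have tV : 0 < t^-1 by rewrite invr_gt0.
  have B0 := ltW (Bfun_gt0 q_gt0 b_sv b_int tV).
  pose M := qnorm E' phi * c * (t * Bfun t^-1).
  have M0 : 0 <= M.
    by apply: mulr_ge0; [exact: (mulr_ge0 N0 (ltW c0))|exact: (mulr_ge0 (ltW t0) B0)].
  have phiM x : D x -> kabs (extend phi x) <= M * Jfun X0 X1 t^-1 x.
    move=> Dx; apply: le_trans (E'_bound dphi Dx) _.
    apply: le_trans (ler_wpM2l N0 (cJ x _ Dx tV).2) _.
    by rewrite invrK /M [leLHS](_ : _ = qnorm E' phi * c * (t * Bfun t^-1) * Jfun X0 X1 t^-1 x)//; ring.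
  have [phi0 [phi1 [phiE d0 d1 n0 n1]]] := dual_decomposition sX0 sX1 M0 tV lphi phiM.
  exists phi0, phi1; split=> //; apply: le_trans (lerD n0 (ler_wpM2l (ltW t0) n1)) _.
  rewrite mulrCA mulfV ?mulr1 ?gt_eqF//.
  by rewrite /M [leRHS](_ : _ = qnorm E' phi * c * (t * Bfun t^-1) + qnorm E' phi * c * (t * Bfun t^-1))//; ring.
apply: (Ksup_space_intro q_gt0 b_sv b_int A0_ge0 A1_ge0).
- by rewrite mulr_ge0// mulr_ge0// ltW.
- by have [phi0 [phi1 [phiE d0 d1 _]]] := dec _ ltr01; exists phi0, phi1.
- move=> t t0; have [phi0 [phi1 [-> d0 d1]]] := dec _ t0; apply: le_trans.
  by apply: Kfun_le => //; exact: ltW.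
Qed.

Lemma dual_to_A1 : (int_bq q b `]0%R, +oo[ < +oo)%E -> exists2 C, 0 < C &
  forall phi, E' phi -> A1' phi /\ qnorm A1' phi <= C * qnorm E' phi.
Proof.
move=> bfin; have [c c0 cX1] := K1_qnorm_le_X1 sX0 sX1 q_gt0 b_sv b_int bfin.
exists c => // phi dphi; have N0 : 0 <= qnorm E' phi := dual_qnorm_ge0 hE dphi.
have lphi := dual_linear D_sub_K1 dphi sD.
apply: dual_intro => //; first by rewrite mulr_ge0// ltW.
move=> x Dx; apply: le_trans (E'_bound dphi Dx) _.
rewrite [c * _]mulrC -mulrA; apply: ler_wpM2l => //.
by apply: (cX1 x _).2; exact: D1.
Qed.

Section SupSequence.
Variable w : int -> R.

Let norm_ge0 : (0 <= lr_norm +oo%E w)%E.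
Proof.
apply: le_trans (ereal_sup_ubound _); last by exists 0.
by rewrite lee_fin.
Qed.

Lemma lr_norm_sup_ge k : (lr_norm +oo%E w < +oo)%E -> `|w k| <= fine (lr_norm +oo%E w).
Proof.
move=> wfin; rewrite -lee_fin fineK; last by rewrite ge0_fin_numE.
by apply: ereal_sup_ubound; exists k.
Qed.

Lemma lr_norm_sup_le M : (forall k, `|w k| <= M) ->
  (lr_norm +oo%E w < +oo)%E /\ fine (lr_norm +oo%E w) <= M.
Proof.
move=> wM; have le_M : (lr_norm +oo%E w <= M%:E)%E.
  by apply: ge_ereal_sup => _ [k _ <-]; rewrite lee_fin.
have wfin : (lr_norm +oo%E w < +oo)%E by apply: le_lt_trans le_M _; rewrite ltry.
by split=> //; rewrite -lee_fin fineK// ge0_fin_numE.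
Qed.

Lemma lr_norm_sup_ge0 : 0 <= fine (lr_norm +oo%E w).
Proof. exact: fine_ge0. Qed.

End SupSequence.

Lemma J1_to_dual : exists2 C, 0 < C & forall phi, J' phi ->
  E' phi /\ qnorm E' phi <= C * qnorm J' phi.
Proof.
have [C C0 CJ] := J_to_dual sX0 sX1 q_gt0 q_le1 b_sv b_int.
exists C => // phi [ff [u [uphi ufin]]].
have bound v : J_representation A0' A1' v phi ->
    (J1_seq_norm A0' A1' +oo%E (fun t => (abar q b t)^-1)%R v < +oo)%E ->
    E' phi /\ qnorm E' phi <=
      C * fine (J1_seq_norm A0' A1' +oo%E (fun t => (abar q b t)^-1) v).
  move=> vphi vfin; apply: (CJ phi v _ (lr_norm_sup_ge0 _) ff vphi) => k.
  by apply: le_trans (ler_norm _) _; exact: (lr_norm_sup_ge k vfin).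
split; first by case: (bound u uphi ufin).
rewrite -ler_pdivrMl//; apply: lb_le_inf.
  by exists (fine (J1_seq_norm A0' A1' +oo%E (fun t => (abar q b t)^-1) u)), u.
by move=> _ [v [vphi vfin] <-]; rewrite ler_pdivrMl//; case: (bound v vphi vfin).
Qed.

Lemma J1_intro phi u M : sum_set A0' A1' phi -> J_representation A0' A1' u phi ->
  (forall k, Jfun A0' A1' (2 ^ k) (u k) <= M * (2 ^ k * abar q b (2 ^ k))) ->
  J' phi /\ qnorm J' phi <= M.
Proof.
move=> ff uphi uM.
have uM' k : `|2 ^ (- k) * (abar q b (2 ^ k))^-1 * Jfun A0' A1' (2 ^ k) (u k)| <= M.
  have k0 : 0 < 2 ^ k :> R by exact: exprz_gt0.
  have a0 : 0 < abar q b (2 ^ k) by apply: (afun_gt0 q_gt0 b_sv b_int); rewrite invr_gt0.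
  have J0 : 0 <= Jfun A0' A1' (2 ^ k) (u k).
    by rewrite le_max; apply/orP; left; apply: A0_ge0; case: (uphi.1 k).
  rewrite -invr_expz -invfM ger0_norm; last first.
    by apply: mulr_ge0 => //; rewrite invr_ge0; apply: mulr_ge0; exact: ltW.
  by rewrite ler_pdivrMl; [rewrite mulrC uM|exact: mulr_gt0].
have [ufin ule] := lr_norm_sup_le uM'.
split; first by split=> //; exists u.
apply: le_trans ule; apply: ge_inf; last by exists u.
by exists 0 => _ [v _ <-]; exact: lr_norm_sup_ge0.
Qed.

(** The last hypothesis covers both regimes of [B]: a difference of [beta] is either controlled by
    [a], or it multiplies only vanishing nodes, so that [u k = 0]. *)
Lemma J1_of_blocks (beta : int -> R) C c M phi (chi : int -> (D -> K)) :
  1 <= C -> 0 <= c -> 0 <= M ->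
  (forall k, 0 < beta k) -> (forall k, beta (k + 1) <= beta k) ->
  (forall k, beta k <= C * beta (k + 1)) ->
  (forall e, 0 < e -> exists k, beta k < e) -> (forall N, exists k, N < beta k) ->
  (forall j, A0' (chi j) /\ qnorm A0' (chi j) <= M * (2 ^ j * beta j)) ->
  (forall j, A1' (phi - chi j) /\ qnorm A1' (phi - chi j) <= M * beta j) ->
  (forall e, 0 < e -> exists k, forall j, j <= k -> qnorm A0' (chi j) < e) ->
  (forall k, beta k - beta (k + 1) <= c * abar q b (2 ^ k) \/
             (forall j, j <= k + 1 -> chi j = 0)) ->
  J' phi /\ qnorm J' phi <= level_ratio C * (1 + level_ratio C) * c * M.
Proof.
move=> C1 c0 M0 b0 bn bd bs bl chi0 chi1 chis alt.
have l0 : 0 <= level_ratio C by apply: ltW; apply: lt_trans ltr01 (level_ratio_gt1 C1).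
pose L := level_ratio C * (1 + level_ratio C).
have L0 : 0 <= L by apply: mulr_ge0 => //; apply: addr_ge0.
have [u [uphi uJ u0]] := block_decomposition sX0 sX1 sD D0 D1 C1 b0 bn bd bs bl M0 chi0 chi1 chis.
apply: (@J1_intro _ u) => //.
  by exists (chi 0), (phi - chi 0); split; [case: (chi0 0)|case: (chi1 0)|rewrite addrC subrK].
move=> k; have k0 : 0 < 2 ^ k :> R by exact: exprz_gt0.
have a0 : 0 < abar q b (2 ^ k) by apply: (afun_gt0 q_gt0 b_sv b_int); rewrite invr_gt0.
have [le_a|z] := alt k.
  apply: le_trans (uJ k) _; rewrite -/L.
  apply: le_trans (ler_wpM2l _ le_a) _; first exact: (mulr_ge0 (mulr_ge0 L0 M0) (ltW k0)).
  by rewrite [leLHS](_ : _ = L * c * M * (2 ^ k * abar q b (2 ^ k)))//; ring.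
rewrite (u0 _ z); apply: (@le_trans _ _ 0).
  rewrite /Jfun ge_max (dual_zero sX0 sD D0).2/=.
  by rewrite pmulr_rle0// (dual_zero sX1 sD D1).2.
exact: (mulr_ge0 (mulr_ge0 (mulr_ge0 L0 c0) M0) (mulr_ge0 (ltW k0) (ltW a0))).
Qed.

End DualityMaps.

(** * The weight [B] at the points [2^-k] *)

Section DyadicWeights.
Context (R : realType) (q : R) (b : R -> R).
Hypothesis q_gt0 : 0 < q.
Hypothesis q_le1 : q <= 1.
Hypothesis b_sv : slowly_varying b.
Hypothesis b_int : forall t : R, 0 < t -> (int_bq q b `]0%R, t[ < +oo)%E.

Definition dyadic_B (k : int) : R := Bfun q b (2 ^ k)^-1.

Let pow2V_gt0 (k : int) : 0 < (2 ^ k)^-1 :> R.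
Proof. by rewrite invr_gt0 exprz_gt0. Qed.

Let pow2V_half (k : int) : (2 ^ (k + 1))^-1 = (2 ^ k)^-1 / 2 :> R.
Proof. by rewrite expfzDr// invfM expr1z. Qed.

Lemma dyadic_B_gt0 k : 0 < dyadic_B k.
Proof. exact: (Bfun_gt0 q_gt0 b_sv b_int (pow2V_gt0 k)). Qed.

Lemma dyadic_B_nincr k : dyadic_B (k + 1) <= dyadic_B k.
Proof.
apply: (Bfun_homo q_gt0 b_sv b_int (pow2V_gt0 _)).
by rewrite pow2V_half ler_pdivrMr// ler_peMr ?ler1n// ltW.
Qed.

Lemma dyadic_B_doubling : exists2 C, 1 <= C & forall k, dyadic_B k <= C * dyadic_B (k + 1).
Proof.
have [C C1 CB] := Bfun_doubling q_gt0 b_sv b_int; exists C => // k.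
have := CB _ (pow2V_gt0 (k + 1)).
by rewrite {1}pow2V_half mulrC divfK ?pnatr_eq0.
Qed.

Lemma dyadic_B_small e : 0 < e -> exists n : nat, dyadic_B n < e.
Proof.
move=> e0; have [t t0 te] := Bfun_small q_gt0 b_sv b_int e0.
exists (Num.truncn t^-1).+1; apply: le_lt_trans te.
apply: (Bfun_homo q_gt0 b_sv b_int (pow2V_gt0 _)).
rewrite -[leRHS]invrK lef_pV2 ?posrE ?invr_gt0 ?exprz_gt0//.
apply: ltW; apply: lt_trans (truncnS_gt _) _.
by rewrite -exprnP -natrX ltr_nat ltn_expl.
Qed.

Lemma dyadic_B_large N : int_bq q b `]0, +oo[ = +oo%E -> exists k, N < dyadic_B k.
Proof.
move=> byy; have [t t0 tN] := Bfun_large q_gt0 b_sv b_int N byy.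
exists (- (Num.truncn t).+1%:Z); apply: lt_le_trans tN _.
apply: (Bfun_homo q_gt0 b_sv b_int t0).
rewrite -invr_expz invrK; apply: ltW; apply: lt_trans (truncnS_gt _) _.
by rewrite -exprnP -natrX ltr_nat ltn_expl.
Qed.

Lemma dyadic_B_diff : exists2 c, 0 < c & forall k,
  dyadic_B k - dyadic_B (k + 1) <= c * abar q b (2 ^ k).
Proof.
have [c c0 cB] := Bfun_diff q_gt0 q_le1 b_sv b_int; exists c => // k.
by rewrite /dyadic_B pow2V_half; exact: (cB _ (pow2V_gt0 k)).
Qed.

(** For [j = - n] the product is [B(2^n) / 2^n]. *)
Lemma dyadic_B_vanish e : 0 < e -> exists k : int, forall j, j <= k -> 2 ^ j * dyadic_B j < e.
Proof.
move=> e0; have [n0 n0P] := Bfun_div_small q_gt0 b_sv b_int e0.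
exists (- n0%:Z) => j jn; have [n jE] : exists n : nat, j = - n%:Z.
  by exists `|j|%N; rewrite lez0_abs ?opprK// (le_trans jn)// oppr_le0.
rewrite jE /dyadic_B -invr_expz invrK mulrC -exprnP; apply: n0P.
by move: jn; rewrite jE lerN2.
Qed.

End DyadicWeights.

Section KtoJ.
Context (R : realType) (s : scalars).
Local Notation K := (scalar_field R s).
Context (V : lmodType K) (X0 X1 : qspace R V).
Hypothesis sX0 : seminormed X0.
Hypothesis sX1 : seminormed X1.
Context (q : R) (b : R -> R).
Hypothesis q_gt0 : 0 < q.
Hypothesis q_le1 : q <= 1.
Hypothesis b_sv : slowly_varying b.
Hypothesis b_int : forall t : R, 0 < t -> (int_bq q b `]0%R, t[ < +oo)%E.
Local Notation D := (carrier X0 `&` carrier X1).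
Local Notation A0' := (dual D X0).
Local Notation A1' := (dual D X1).
Local Notation J' := (J1_space A0' A1' +oo%E (fun t => (abar q b t)^-1)).
Local Notation K' := (K1_space A0' A1' +oo%E (btilde q b)).
Local Notation beta := (dyadic_B q b).

Let A0_ge0 x : A0' x -> 0 <= qnorm A0' x.
Proof. exact: dual_qnorm_ge0 (seminormed_homogeneous sX0). Qed.

Let A1_ge0 x : A1' x -> 0 <= qnorm A1' x.
Proof. exact: dual_qnorm_ge0 (seminormed_homogeneous sX1). Qed.

Let D0 : D `<=` carrier X0. Proof. by move=> ? []. Qed.

(** The inequality is strict so that a decomposition exists even if [phi] has quasi-norm 0; the 2 is
    that of [Ksup_space_bound]. *)
Let near_optimal phi j M : K' phi -> 2 * qnorm K' phi < M ->
  exists chi, [/\ A0' chi, qnorm A0' chi <= M * (2 ^ j * beta j),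
                  A1' (phi - chi) & qnorm A1' (phi - chi) <= M * beta j].
Proof.
move=> Kphi MN; have j0 : 0 < 2 ^ j :> R by exact: exprz_gt0.
have jb : 0 < 2 ^ j * beta j by apply: mulr_gt0 => //; exact: dyadic_B_gt0.
have : Kfun A0' A1' (2 ^ j) phi < M * (2 ^ j * beta j).
  apply: le_lt_trans (Ksup_space_bound q_gt0 b_sv b_int A0_ge0 A1_ge0 Kphi j0) _.
  by rewrite -/(beta j) (ltr_pM2r jb).
move=> /(Kfun_lt Kphi.1)[chi [chi1 [d0 d1 phiE /ltW le_M]]].
have chi1E : phi - chi = chi1 by rewrite phiE addrAC subrr add0r.
exists chi; rewrite chi1E; split=> //.
  apply: le_trans le_M; rewrite lerDl; apply: mulr_ge0 (ltW j0) (A1_ge0 d1).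
rewrite -(ler_pM2l j0) mulrCA; apply: le_trans le_M.
by rewrite lerDr; exact: A0_ge0.
Qed.

(** Recovers the limiting constant from the strict inequality on [M] in [near_optimal]. *)
Let le_of_gt (x y c : R) : 0 <= c -> (forall z, y < z -> x <= c * z) -> x <= c * y.
Proof.
move=> c0 xz; apply/ler_addgt0Pr => e e0.
have c1 : 0 < c + 1 by exact: ltr_wpDl.
have /xz := ltr_pwDr (divr_gt0 e0 c1) (lexx y).
move=> /le_trans; apply; rewrite mulrDr lerD2l mulrCA ger_pMr//.
by rewrite ler_pdivrMr// mul1r lerDl.
Qed.

(** The doubling condition for [beta_k - k] at negative indices, with [u = beta k],
    [v = beta (k + 1)] and [x = - (k + 1)]. *)
Let shift_doubling (u v c d x : R) : u <= c * v -> 1 <= d * v -> 1 <= c -> 0 <= d ->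
  0 <= x -> u + (x + 1) <= (c + d) * (v + x).
Proof.
move=> uv dv c1 d0 x0; have dx := mulr_ge0 d0 x0; have cx := ler_wpM2r x0 c1.
by rewrite mulrDl !mulrDr; lra.
Qed.

Lemma K1_to_J1 : int_bq q b `]0, +oo[ = +oo%E -> exists2 C, 0 < C &
  forall phi, K' phi -> J' phi /\ qnorm J' phi <= C * qnorm K' phi.
Proof.
move=> byy; have [C C1 bC] := dyadic_B_doubling q_gt0 b_sv b_int.
have [c c0 bc] := dyadic_B_diff q_gt0 q_le1 b_sv b_int.
have l0 : 0 < level_ratio C := lt_trans ltr01 (level_ratio_gt1 C1).
pose L := level_ratio C * (1 + level_ratio C) * c.
have L0 : 0 < L by exact: (mulr_gt0 (mulr_gt0 l0 (addr_gt0 ltr01 l0)) c0).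
exists (L * 2) => [|phi Kphi]; first exact: mulr_gt0.
have N0 : 0 <= qnorm K' phi by exact: fine_ge0 (Lnorm_ge0 _ _ _).
have Jle M : 2 * qnorm K' phi < M -> J' phi /\ qnorm J' phi <= L * M.
  move=> MN; have M0 : 0 < M by apply: le_lt_trans MN; exact: mulr_ge0.
  have /choice[chi chiP] := fun j => near_optimal j Kphi MN.
  apply: (@J1_of_blocks _ _ _ _ _ sX0 sX1 _ _ q_gt0 b_sv b_int beta C c M phi chi
    C1 (ltW c0) (ltW M0) (dyadic_B_gt0 q_gt0 b_sv b_int)
    (dyadic_B_nincr q_gt0 b_sv b_int) bC).
  - by move=> e e0; have [n ne] := dyadic_B_small q_gt0 b_sv b_int e0; exists n.
  - by move=> N; exact: (dyadic_B_large q_gt0 b_sv b_int N byy).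
  - by move=> j; have [] := chiP j.
  - by move=> j; have [] := chiP j.
  - move=> e e0; have [k kP] := dyadic_B_vanish q_gt0 b_sv b_int (divr_gt0 e0 M0).
    exists k => j /kP; rewrite ltr_pdivlMr// mulrC; apply: le_lt_trans.
    by have [] := chiP j.
  - by move=> k; left; exact: bc.
have [|Jphi _] := Jle (2 * qnorm K' phi + 1); first by rewrite ltrDl.
split=> //; rewrite -mulrA; apply: (le_of_gt (ltW L0)) => M /Jle[_ leM]; exact: leM.
Qed.

(** As [phi] lies in [A1'], the choice [chi j = 0] is admissible for [j <= 0]; it removes the terms
    of negative index, and with them any demand on [a] at large arguments. *)
Lemma KA1_to_J1 : exists2 C, 0 < C &
  forall phi, A1' phi -> K' phi -> J' phi /\
    qnorm J' phi <= C * Num.max (qnorm A1' phi) (qnorm K' phi).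
Proof.
have [C C1 bC] := dyadic_B_doubling q_gt0 b_sv b_int.
have [c c0 bc] := dyadic_B_diff q_gt0 q_le1 b_sv b_int.
have bgt0 := dyadic_B_gt0 q_gt0 b_sv b_int; have b0 := bgt0 0.
have bhomo := beta_homo (dyadic_B_nincr q_gt0 b_sv b_int).
have Vb0 : 0 < (beta 0)^-1 by rewrite invr_gt0.
(* For [k + 1 <= 0] one has [1 <= beta (k + 1) / beta 0], which absorbs the unit step of the added
   term. *)
pose C' := C + (beta 0)^-1.
have C'1 : 1 <= C' by apply: ler_wpDr C1; exact: (ltW Vb0).
have l0 : 0 < level_ratio C' := lt_trans ltr01 (level_ratio_gt1 C'1).
pose L := level_ratio C' * (1 + level_ratio C') * c.
have L0 : 0 < L by exact: (mulr_gt0 (mulr_gt0 l0 (addr_gt0 ltr01 l0)) c0).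
have r0 : 0 < 2 + (beta 0)^-1 by apply: ltr_pwDl => //; exact: (ltW Vb0).
exists (L * (2 + (beta 0)^-1)) => [|phi A1phi Kphi]; first exact: mulr_gt0.
set N := Num.max _ _.
have NK0 : 0 <= qnorm K' phi by exact: fine_ge0 (Lnorm_ge0 _ _ _).
have KN : qnorm K' phi <= N by rewrite le_max lexx orbT.
have AN : qnorm A1' phi <= N by rewrite le_max lexx.
have N0 := le_trans NK0 KN.
(* [beta] may be bounded; the added term makes it blow up at [-oo]. *)
pose gam (k : int) : R := beta k + (Num.max 0 (- k))%:~R.
have max0 (k : int) : 0 <= k -> Num.max 0 (- k) = 0 :> int.
  by move=> k0; apply/max_idPl; rewrite oppr_le0.
have maxN (k : int) : k <= 0 -> Num.max 0 (- k) = - k :> int.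
  by move=> k0; apply/max_idPr; rewrite oppr_ge0.
have gam_pos k : 0 <= k -> gam k = beta k by move=> k0; rewrite /gam max0// addr0.
have gam_neg k : k <= 0 -> gam k = beta k - k%:~R by move=> k0; rewrite /gam maxN// rmorphN.
have gamB k : beta k <= gam k by rewrite lerDl ler0z le_max lexx.
have lt0S (k : int) : (0 <= k) \/ (k + 1 <= 0) by case: (lerP 0 k) => k0; [left|right; rewrite lezD1].
have posS (k : int) : 0 <= k -> 0 <= k + 1 by move=> k0; exact: addr_ge0.
have negS (k : int) : k + 1 <= 0 -> k <= 0 by apply: le_trans; rewrite lerDl.
(* The 2 serves [near_optimal]; [1 / beta 0] ensures that the [A1']-norm of [phi] is at most
   [M * beta 0], as required where [chi j = 0]. *)
have Jle M : (2 + (beta 0)^-1) * N < M -> J' phi /\ qnorm J' phi <= L * M.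
  move=> MN; have M0 : 0 < M by apply: le_lt_trans MN; exact: mulr_ge0 (ltW r0) N0.
  have MK : 2 * qnorm K' phi < M.
    apply: le_lt_trans MN; apply: ler_pM => //.
    by rewrite lerDl (ltW Vb0).
  have MA : qnorm A1' phi <= M * beta 0.
    rewrite -ler_pdivrMr// mulrC; apply: ltW; apply: le_lt_trans MN; apply: ler_pM => //.
    - exact: (ltW Vb0).
    - exact: A1_ge0.
    - by rewrite lerDr.
  have /choice[chi' chiP] := fun j => near_optimal j Kphi MK.
  pose chi (j : int) := if j <= 0 then 0 else chi' j.
  have [z0 z0le] := dual_zero sX0 (subspace_capD sX0 sX1) D0.
  apply: (@J1_of_blocks _ _ _ _ _ sX0 sX1 _ _ q_gt0 b_sv b_int gam C' c M phi chi
    C'1 (ltW c0) (ltW M0)).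
  - by move=> k; exact: lt_le_trans (bgt0 k) (gamB k).
  - move=> k; apply: lerD; first exact: (dyadic_B_nincr q_gt0 b_sv b_int).
    by rewrite ler_int ge_max !le_max lexx/= lerN2 lerDl orbT.
  - move=> k; have [k0|k0] := lt0S k.
      rewrite (gam_pos _ k0) (gam_pos _ (posS _ k0)).
      apply: (le_trans (bC k)); apply: (ler_wpM2r (ltW (bgt0 _))).
      by rewrite /C' lerDl (ltW Vb0).
    rewrite (gam_neg _ (negS _ k0)) (gam_neg _ k0).
    have k1 : 1 <= (beta 0)^-1 * beta (k + 1).
      rewrite -[leLHS](mulVf (lt0r_neq0 b0)).
      exact: (ler_wpM2l (ltW Vb0) (bhomo _ _ k0)).
    have x0 : 0 <= - (k + 1)%:~R :> R by rewrite oppr_ge0 lerz0.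
    rewrite (_ : k%:~R = (k + 1)%:~R - 1 :> R); last by rewrite rmorphD/= addrK.
    rewrite opprB [1 - _]addrC; exact: (shift_doubling (bC k) k1 C1 (ltW Vb0) x0).
  - move=> e e0; have [n ne] := dyadic_B_small q_gt0 b_sv b_int e0; exists n.
    by rewrite gam_pos.
  - move=> x; exists (- (Num.truncn x).+1%:Z); rewrite gam_neg ?oppr_le0//.
    rewrite rmorphN/= opprK; apply: lt_le_trans (truncnS_gt _) _.
    by rewrite lerDr (ltW (bgt0 _)).
  - move=> j; rewrite /chi; case: lerP => [j0|/ltW j0]; last first.
      by rewrite (gam_pos _ j0); have [? ? ? ?] := chiP j; split.
    split; first exact: z0.
    apply: (le_trans z0le); apply: (mulr_ge0 (ltW M0)).
    exact: (mulr_ge0 (ltW (exprz_gt0 _ (ltr0n _ 2))) (le_trans (ltW (bgt0 j)) (gamB j))).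
  - move=> j; rewrite /chi; case: lerP => [j0|/ltW j0]; last first.
      by rewrite (gam_pos _ j0); have [? ? ? ?] := chiP j; split.
    rewrite subr0; split; first exact: A1phi.
    apply: (le_trans MA); apply: (ler_wpM2l (ltW M0)).
    exact: (le_trans (bhomo _ _ j0) (gamB j)).
  - by move=> e e0; exists 0 => j j0; rewrite /chi j0; exact: le_lt_trans z0le e0.
  (* For [k >= 0] the sequence is the original [beta]; for [k + 1 <= 0] all nodes up to [k + 1]
     vanish. *)
  - move=> k; have [k0|k0] := lt0S k; [left|right].
      by rewrite (gam_pos _ k0) (gam_pos _ (posS _ k0)); exact: bc.
    by move=> j jk; rewrite /chi ifT//; exact: le_trans jk k0.
have [|Jphi _] := Jle ((2 + (beta 0)^-1) * N + 1); first by rewrite ltrDl.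
split=> //; rewrite -mulrA; apply: (le_of_gt (ltW L0)) => M /Jle[_ leM]; exact: leM.
Qed.

End KtoJ.

(** * Equality of quasi-normed spaces from bounded inclusions *)

Section BoundedInclusions.
Context (R : realType) (V : Type).
Implicit Types X Y Z : qspace R V.

Definition bounded_inclusion X Y := exists2 C, 0 < C &
  forall f, X f -> Y f /\ qnorm Y f <= C * qnorm X f.

Lemma bounded_inclusion_trans X Y Z :
  bounded_inclusion X Y -> bounded_inclusion Y Z -> bounded_inclusion X Z.
Proof.
move=> [C C0 XY] [C' C'0 YZ]; exists (C' * C) => [|f Xf]; first exact: mulr_gt0.
have [Yf Yle] := XY f Xf; have [Zf Zle] := YZ f Yf; split=> //.
by apply: le_trans Zle _; rewrite -mulrA ler_pM2l.
Qed.

Lemma qspace_eq_intro X Y :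
  bounded_inclusion X Y -> bounded_inclusion Y X -> qspace_eq X Y.
Proof.
move=> [C C0 XY] [C' C'0 YX]; split.
  by apply/seteqP; split=> f; [case/XY|case/YX].
exists C^-1, C'; split=> [||f Xf]; rewrite ?invr_gt0//.
have [Yf Yle] := XY f Xf; have [_ Xle] := YX f Yf.
by rewrite ler_pdivrMl// Yle.
Qed.

Lemma qspace_eq_cycle X Y Z : bounded_inclusion X Z -> bounded_inclusion Z Y ->
  bounded_inclusion Y X -> qspace_eq X Y /\ qspace_eq Y Z.
Proof.
move=> XZ ZY YX; split; apply: qspace_eq_intro => //.
  exact: bounded_inclusion_trans XZ ZY.
exact: bounded_inclusion_trans YX XZ.
Qed.

Lemma bounded_inclusionI X Y Z : (forall f, X f -> 0 <= qnorm X f) ->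
  bounded_inclusion X Y -> bounded_inclusion X Z -> bounded_inclusion X (qspaceI Y Z).
Proof.
move=> X0 [C C0 XY] [C' C'0 XZ]; exists (Num.max C C'); first by rewrite lt_max C0.
move=> f Xf; have [Yf Yle] := XY f Xf; have [Zf Zle] := XZ f Xf; split=> //=.
rewrite ge_max (le_trans Yle) ?(le_trans Zle)//.
  by apply: (ler_wpM2r (X0 f Xf)); rewrite le_max lexx orbT.
by apply: (ler_wpM2r (X0 f Xf)); rewrite le_max lexx.
Qed.

End BoundedInclusions.

(** * Density and the identification of functionals; embedded Banach spaces *)

Section EmbeddedSpaces.
Context (R : realType) (s : scalars).
Local Notation K := (scalar_field R s).

Lemma dual_identified_dense (V : lmodType K) (D : set V) (E : qspace R V) :
  homogeneous E -> D `<=` carrier E ->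
  (forall f e, E f -> 0 < e -> exists2 y, D y & qnorm E (f - y) < e) ->
  dual_identified D E.
Proof.
move=> hE DE dense_D; split=> // g h [_ cg] [_ ch] gh x Ex; have [sE _ _] := hE.
apply/eqP; rewrite -subr_eq0; apply/eqP; apply: kabs_eq0; apply/eqP.
rewrite eq_le kabs_ge0 andbT; apply/ler_addgt0Pr => e e0; rewrite add0r.
have e20 : 0 < e / 2 by rewrite divr_gt0.
have [d d0 dg] := cg x Ex _ e20; have [d' d'0 dh] := ch x Ex _ e20.
have [|y Dy yd] := dense_D x (Num.min d d') Ex; first by rewrite lt_min d0.
move: yd; rewrite lt_min => /andP[yd yd'].
have Ey := DE y Dy; have Exy : E (x - y) by exact: (subspaceB sE).
have yx : qnorm E (y - x) = qnorm E (x - y) by rewrite -(homogeneous_qnormN hE Exy) opprB.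
rewrite -yx in yd yd'.
have := lerD (ltW (dg y Ey yd)) (ltW (dh y Ey yd')); rewrite -splitr.
apply: le_trans; rewrite -/(kabs (g y - g x)) -/(kabs (h y - h x)) -[kabs (g y - g x)]kabsN.
rewrite opprB; apply: le_trans (ler_kabsD _ _).
by rewrite (gh y Dy) addrA subrK.
Qed.

Context (V : lmodType K) (A : normedModType K) (j : {linear A -> V}).
Hypothesis j_inj : injective j.

Lemma normr_rabs (x : A) : `|x| = of_real (rabs x) :> K.
Proof. by rewrite -[LHS]normr_id norm_kabs /kabs normr_id. Qed.

Lemma embedded_qnorm x : qnorm (embedded j) (j x) = rabs x.
Proof.
rewrite /= (_ : [set _ | _ in _] = [set rabs x]) ?inf1//.
by apply/seteqP; split=> [_ [y /j_inj -> <-]//|_ ->]; exists x.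
Qed.

Lemma seminormed_embedded : seminormed (embedded j).
Proof.
split.
  split; first by exists 0 => //; rewrite linear0.
  by move=> a _ _ [x _ <-] [y _ <-]; exists (a *: x + y); rewrite ?linearP.
split=> [_ _ [x _ <-] [y _ <-]|a _ [x _ <-]].
  rewrite -linearD !embedded_qnorm -(@ler_of_real R s) of_realD -!normr_rabs.
  exact: ler_normD.
rewrite -linearZ !embedded_qnorm; apply: (@of_real_inj R s).
by rewrite of_realM -!normr_rabs -norm_kabs normrZ.
Qed.

Lemma embedded_dense (D : set V) : dense (j @^-1` D) ->
  forall x e, embedded j x -> 0 < e ->
    exists2 y, (range j `&` D) y & qnorm (embedded j) (x - y) < e.
Proof.
move=> dD _ e [x _ <-] e0.
have [] := dD (ball x (of_real e : K)).
- by exists x; apply: ballxx; rewrite lt_def of_real_eq0 (gt_eqF e0) -(@of_real0 R s) ler_of_real ltW.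
- exact: ball_open.
move=> y [xy Dy]; exists (j y); first by split=> //; exists y.
rewrite -linearB embedded_qnorm.
move: xy; rewrite -ball_normE/= normr_rabs lt_def ler_of_real => /andP[ne le_e].
by rewrite lt_def le_e andbT; apply: contraNN ne => /eqP ->.
Qed.

End EmbeddedSpaces.

(** * Differentiating B almost everywhere *)

Section BorelRepresentative.
Context (R : realType).
Local Notation lam := (@lebesgue_measure R).
Local Notation Borel := (@measurable _ (measurableTypeR R)).
Local Notation measurableB := (@measurable_fun _ _ (measurableTypeR R) (measurableTypeR R)).
Local Notation measurableL := (@measurable_fun _ _ (lebesgueType R) (measurableTypeR R)).

Lemma lebesgue_Borel (A : set R) : @measurable _ (lebesgueType R) A ->
  exists B F : set R, [/\ Borel B, Borel F, lam F = 0%E, B `<=` A & A `<=` B `|` F].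
Proof.
move=> mA; have : (completed_algebra_gen lam).-sigma.-measurable A.
  by rewrite completed_caratheodory_measurable.
rewrite g_sigma_completed_algebra_genE => -[B mB [N [F [mF F0 NF]] BNA]].
exists B, F; split=> //; first by rewrite -BNA; exact: subsetUl.
by rewrite -BNA; exact: setUS.
Qed.

(** [f] is the supremum of [r] times the indicator of [f > r] over rationals [r >= 0]. Replacing
    each level set by a Borel subset changes the supremum only on a null set. The fundamental
    theorem of calculus is then applied to this representative. *)
Lemma Borel_representative (f : R -> R) : measurableL setT f -> (forall x, 0 <= f x) ->
  exists g : R -> R, exists2 F : set R, [/\ measurableB setT g, forall x, 0 <= g x, Borel F & lam F = 0%E] &
    forall x, ~ F x -> g x = f x.
Proof.
move=> mf f0.
pose r (n : nat) : R := Num.max 0 (if unpickle n is Some x then ratr x else 0).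
have r0 n : 0 <= r n by rewrite le_max lexx.
have /choice[B /choice[F BF]] : forall n, exists B F : set R, [/\ Borel B, Borel F, lam F = 0%E,
    B `<=` f @^-1` `]r n, +oo[ & f @^-1` `]r n, +oo[ `<=` B `|` F].
  move=> n; apply: lebesgue_Borel; rewrite -[X in measurable X]setTI.
  by apply: mf; [exact: measurableT|exact: measurable_itv].
pose u n (x : R) : \bar R := (r n * \1_(B n) x)%:E.
have mu n : measurable_fun [set: measurableTypeR R] (u n).
  apply/measurable_EFinP; apply: measurable_funM => //.
  by apply: measurable_indic; have [] := BF n.
pose g (x : R) : R := fine (esups (u ^~ x) 0%N).
have uE x : esups (u ^~ x) 0%N = ereal_sup (range (u ^~ x)).
  rewrite /esups/=; congr ereal_sup; apply/seteqP.
  by split=> [_ [n _ <-]|_ [n _ <-]]; exists n.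
have sup_ge0 x : (0 <= esups (u ^~ x) 0%N)%E.
  rewrite uE; apply: (@le_trans _ _ (u 0%N x)).
    by rewrite lee_fin mulr_ge0.
  by apply: ereal_sup_ubound; exists 0%N.
have [N [mN N0 FN]] : lam.-negligible (\bigcup_n F n).
  by apply: negligible_bigcup => n; exists (F n); have [_ mF F0 _ _] := BF n; split.
exists g, N.
  split.
  - apply: (measurableT_comp (fine_measurable measurableT)).
    exact: (measurable_fun_esups mu).
  - by move=> x; exact: fine_ge0.
  - exact: mN.
  - exact: N0.
move=> x nF; suff : esups (u ^~ x) 0%N = (f x)%:E by rewrite /g => ->.
have uB n : \1_(B n) x = (r n < f x)%R%:R :> R.
  have [_ _ _ Bf fB] := BF n; rewrite indicE (_ : (x \in B n) = (r n < f x)%R)//; apply/idP/idP.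
    by rewrite inE => /Bf/=; rewrite in_itv/= andbT => ->.
  move=> rf; rewrite inE; have [|//|Fx] := fB x; first by rewrite /= in_itv/= rf.
  by exfalso; apply: nF; apply: FN; exists n.
apply/eqP; rewrite eq_le; apply/andP; split.
  rewrite uE; apply: ge_ereal_sup => _ [n _ <-]; rewrite /u uB lee_fin.
  by case: (ltrP (r n) (f x)) => [/ltW|_]; rewrite ?mulr1 ?mulr0.
rewrite leNgt; apply/negP => sf.
have sE : esups (u ^~ x) 0%N = (g x)%:E.
  by rewrite fineK// ge0_fin_numE// (lt_trans sf)// ltry.
move: (sf); rewrite sE lte_fin => /rat_in_itvoo[p]; rewrite in_itv/= => /andP[gp pf].
have rp : r (pickle p) = ratr p.
  rewrite /r pickleK; apply/max_idPr; apply: ltW; apply: le_lt_trans gp.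
  exact: fine_ge0.
have : (u (pickle p) x <= esups (u ^~ x) 0%N)%E by rewrite uE; apply: ereal_sup_ubound; exists (pickle p).
by rewrite /u uB rp pf mulr1 sE lee_fin leNgt gp.
Qed.

(** The identity is measurable from the Lebesgue to the Borel sigma-algebra and pushes [leb] forward
    to [lebesgue_measure]. *)
Lemma lint_Borel (g : R -> R) (D : set R) : Borel D -> measurableB setT g ->
  (forall x, 0 <= g x) -> lint g D = (\int[lam]_(x in D) (g x)%:E)%E.
Proof.
move=> mD mg g0.
pose i (x : lebesgueType R) : measurableTypeR R := x.
have mi : measurable_fun setT i.
  by move=> _ Y mY; rewrite setTI; exact: measurable_lebesgueType.
pose HM := isMeasurableFun.Build _ _ _ _ i mi.
pose i' : {mfun lebesgueType R >-> measurableTypeR R} := HB.pack i HM.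
have -> : (\int[lam]_(x in D) (g x)%:E)%E =
    (\int[pushforward (leb R) i']_(x in D) (g x)%:E)%E.
  by apply: eq_measure_integral => A mA _.
rewrite ge0_integral_pushforward//.
  apply/measurable_EFinP; exact: (measurable_funTS mg).
by move=> x _; rewrite lee_fin.
Qed.

End BorelRepresentative.

Section DerivativeOfB.
Context (R : realType) (q : R) (b : R -> R).
Hypothesis q_gt0 : 0 < q.
Hypothesis b_sv : slowly_varying b.
Hypothesis b_int : forall t : R, 0 < t -> (int_bq q b `]0%R, t[ < +oo)%E.
Local Notation lam := (@lebesgue_measure R).
Local Notation Borel := (@measurable _ (measurableTypeR R)).
Local Notation measurableB := (@measurable_fun _ _ (measurableTypeR R) (measurableTypeR R)).
Local Notation W := (fun x => b x `^ q / x).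
Local Notation P := (`]0, +oo[%classic : set R).

Let Borel_itv (i : interval R) : Borel [set` i]. Proof. exact: measurable_itv. Qed.

(** The representative is set to 0 on the nonpositive reals, which makes it locally integrable on
    the whole line. *)
Let weight_Borel : exists g : R -> R, exists2 N : set R,
  [/\ measurableB setT g, forall x, 0 <= g x, Borel N & lam N = 0%E] &
  (forall x, ~ N x -> 0 < x -> g x = W x) /\ (forall x, x <= 0 -> g x = 0).
Proof.
have [|x|g [N [mg g0 mN N0] gW]] := @Borel_representative R (W \_ P).
- exact: ((measurable_restrictT _ (measurable_itvL `]0, +oo[)).1 (measurable_weight q b_sv)).
- rewrite patchE; case: ifPn => [|_]; last exact: lexx.
  by rewrite inE/= in_itv/= andbT => x0; exact: (weight_ge0 q b x0).
exists (g \_ P), N.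
  split=> //; first exact: ((measurable_restrictT _ (Borel_itv `]0, +oo[)).1 (measurable_funTS mg)).
  by move=> x; rewrite patchE; case: ifP.
split=> x; first move=> Nx.
  by move=> x0; rewrite patchE ifT ?inE/= ?in_itv/= ?x0// gW// patchE ifT// inE/= in_itv/= x0.
by move=> x0; rewrite patchE ifN// notin_setE/= in_itv/= andbT; apply/negP; rewrite -leNgt.
Qed.

Let integral_Borel (g : R -> R) (N : set R) t : measurableB setT g -> (forall x, 0 <= g x) ->
  Borel N -> lam N = 0%E -> (forall x, ~ N x -> 0 < x -> g x = W x) ->
  (\int[lam]_(x in `]0%R, t]) (g x)%:E)%E = int_bq q b `]0, t[.
Proof.
move=> mg g0 mN N0 gW.
rewrite -integral_itv_bndo_bndc; last first.
  by apply/measurable_EFinP; exact: (measurable_funTS mg).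
rewrite -(lint_Borel (Borel_itv `]0, t[) mg g0).
apply: ge0_ae_eq_integral.
- exact: measurable_itvL.
- apply/measurable_EFinP; apply: measurable_funL; first exact: Borel_itv.
  exact: (measurable_funTS mg).
- apply/measurable_EFinP; apply: (measurable_funS (measurable_itvL `]0, +oo[) (@itv_ooy_pos _ t)).
  exact: (measurable_weight q b_sv).
- by move=> x _; rewrite lee_fin.
- by move=> x /itv_ooy_pos/=; rewrite in_itv/= andbT => x0; rewrite lee_fin; exact: (weight_ge0 q b x0).
exists N; split; first exact: measurable_lebesgueType.
  exact: N0.
move=> x /= nx; apply: contrapT => Nx; apply: nx.
by move=> /itv_ooy_pos/=; rewrite in_itv/= andbT => x0; rewrite gW.
Qed.

Lemma BQ_derivative_ae : exists2 N : set R, Borel N /\ lam N = 0%E &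
  forall x, ~ N x -> 0 < x -> is_derive x 1 (BQ q b) (W x).
Proof.
have [g [N [mg g0 mN N0] [gW gneg]]] := weight_Borel.
have intE t := integral_Borel t mg g0 mN N0 gW.
have int_fin t : (\int[lam]_(x in `]0%R, t]) (g x)%:E < +oo)%E.
  rewrite intE; have [t0|t0] := ltP 0 t; first exact: b_int.
  by rewrite /int_bq set_itv_ge ?bnd_simp -?leNgt// integral_set0.
have ig t : lam.-integrable `]0, t] (EFin \o g).
  apply/integrableP; split; first by apply/measurable_EFinP; exact: (measurable_funTS mg).
  apply: le_lt_trans (int_fin t); rewrite le_eqVlt; apply/orP; left; apply/eqP.
  by apply: eq_integral => x _ /=; rewrite ger0_norm.
(* A compact set is bounded by some [T], and [g] vanishes on the nonpositive reals, so its integral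
   over the set is at most that over []0, T]]. *)
have loc : locally_integrable setT g.
  split; [exact: mg|exact: openT|move=> K _ cK].
  have [M [_ KM]] := compact_bounded cK.
  pose T := Num.max M 0 + 1; have MT : M < T by rewrite ltr_pwDr// le_max lexx.
  have gE : (\int[lam]_(x in K) `|g x|%:E = \int[lam]_(x in K `&` P) (g x)%:E)%E.
    rewrite integral_mkcondr; apply: eq_integral => x _; rewrite patchE ger0_norm//.
    case: ifPn => //; rewrite notin_setE/= in_itv/= andbT => /negP; rewrite -leNgt => x0.
    by rewrite gneg.
  rewrite gE; apply: le_lt_trans (int_fin T); apply: ge0_subset_integral.
  - by apply: measurableI; [exact: compact_measurable|exact: Borel_itv].
  - exact: Borel_itv.
  - by apply/measurable_EFinP; exact: (measurable_funTS mg).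
  - by move=> x _; rewrite lee_fin.
  - move=> x [Kx]; rewrite /= !in_itv/= andbT => ->/=.
    by apply: le_trans (ler_norm _) _; exact: KM Kx.
have [N' [mN' N'0 N'P]] := FTC1 (a := BRight 0) ig loc.
have BE : (fun t => \int[lam]_(x in `]0, t]) g x) = BQ q b.
  by apply/funext => t; rewrite /Rintegral intE.
exists (N `|` N').
  split; first exact: measurableU.
  by rewrite measureU0.
move=> x /not_orP[Nx N'x] x0; rewrite -(gW _ Nx x0).
have [d dE] : derivable (BQ q b) x 1 /\ derive1 (BQ q b) x = g x.
  by rewrite -BE; apply: contrapT => nd; apply: N'x; apply: N'P => /= h; apply: nd; exact: (h x0).
by rewrite -dE derive1E; exact: derivableP.
Qed.

Lemma Bfun_derivative_ae : {ae leb R, forall t : R, 0 < t ->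
  derivable (Bfun q b) t 1 /\ afun q b t = t * derive1 (Bfun q b) t}.
Proof.
have [N [mN N0] NP] := BQ_derivative_ae.
exists N; split; first exact: measurable_lebesgueType.
  exact: N0.
move=> t /= nt; apply: contrapT => Nt; apply: nt => t0.
have B0 := BQ_gt0 q_gt0 b_sv b_int t0.
(* Chain rule for [B = BQ^(1/q)]; the power [1/q - 1] of [BQ] is the power [1 - q] of [B]. *)
have dB : is_derive t 1 (Bfun q b) (q^-1 * BQ q b t `^ (q^-1 - 1) * W t).
  exact: (@is_derive1_comp _ (fun y => y `^ q^-1) (BQ q b) t _ _ (is_derive1_powR _ B0) (NP t Nt t0)).
split; first exact: ex_derive.
rewrite derive1E derive_val /afun /Bfun -/(BQ q b t) -powRrM mulrBr mulr1 mulVf ?gt_eqF//.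
by field; rewrite !gt_eqF.
Qed.

End DerivativeOfB.

Theorem theorem4p3 (R : realType) (s : scalars)
    (V : topologicalLmodType (scalar_field R s))
    (A0 A1 : completeNormedModType (scalar_field R s))
    (j0 : {linear A0 -> V}) (j1 : {linear A1 -> V})
    (couple : banach_couple j0 j1) (regular : regular_couple j0 j1)
    (q : R) (q_gt0 : 0 < q) (q_le1 : q <= 1)
    (b : R -> R) (b_sv : slowly_varying b)
    (b_int : forall t : R, 0 < t -> (int_bq q b `]0%R, t[ < +oo)%E) :
  let D := range j0 `&` range j1 in
  let E := K1_space (embedded j0) (embedded j1) q%:E b in
  let A0' := dual D (embedded j0) in
  let A1' := dual D (embedded j1) in
  let J' := J1_space A0' A1' +oo%E (fun t => (abar q b t)^-1) in
  let K' := K1_space A0' A1' +oo%E (btilde q b) in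
  [/\ {ae leb R, forall t : R, 0 < t ->
        derivable (Bfun q b) t 1 /\ afun q b t = t * derive1 (Bfun q b) t},
      dual_identified D E,
      int_bq q b `]0%R, +oo[ = +oo%E ->
        qspace_eq (dual D E) J' /\ qspace_eq J' K' &
      (int_bq q b `]0%R, +oo[ < +oo)%E ->
        qspace_eq (dual D E) J' /\ qspace_eq J' (qspaceI A1' K')].

Proof.
move=> D E A0' A1' J' K'; case: couple => _ [j0_inj _] [j1_inj _] _.
have sX0 := seminormed_embedded j0_inj; have sX1 := seminormed_embedded j1_inj.
have hE := homogeneous_K1 sX0 sX1 q_gt0 b_sv.
have DE : D `<=` carrier E by exact: (D_sub_K1 sX0 sX1 q_gt0 b_sv b_int).
have JE : bounded_inclusion J' (dual D E) by exact: (J1_to_dual sX0 sX1 q_gt0 q_le1 b_sv b_int).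
have EK : bounded_inclusion (dual D E) K' by exact: (dual_to_K1 sX0 sX1 q_gt0 b_sv b_int).
split.
- exact: (Bfun_derivative_ae q_gt0 b_sv b_int).
(* Regularity enters as density of the intersection in [A1], from which density in [E] follows. *)
- apply: (dual_identified_dense hE DE); apply: (D_dense_K1 sX0 sX1 q_gt0 b_sv b_int).
  move=> x e Xx e0; have [y [y1 y0] xy] := embedded_dense j1_inj regular.2 Xx e0.
  by exists y => //; split.
- move=> byy; apply: (qspace_eq_cycle EK _ JE).
  exact: (K1_to_J1 sX0 sX1 q_gt0 q_le1 b_sv b_int byy).
- move=> bfin; apply: qspace_eq_cycle _ _ JE.
    apply: bounded_inclusionI => [phi dphi||]; last exact: EK.
      exact: (dual_qnorm_ge0 hE dphi).
    exact: (dual_to_A1 sX0 sX1 q_gt0 b_sv b_int bfin).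
  have [C C0 CJ] := KA1_to_J1 sX0 sX1 q_gt0 q_le1 b_sv b_int.
  by exists C => // phi [d1 Kphi]; exact: CJ.
Qed.
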